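(* Let $P$ be the uniform distribution on the ellipse $\{(x_1,x_2)\in\mathbb{R}^2: x_1^2+4x_2^2=4\}$. Then, with decimal values understood as approximations correct to within one unit in the last displayed digit, the optimal set of six-means for $P$ is $$\{(1.7975,0),(0.748205,0.897609),(-0.748205,0.897609),(-1.7975,0),(-0.748205,-0.897609),(0.748205,-0.897609)\},$$ with quantization error $V_6=0.198794$.
   Context: For a Borel probability measure $P$ on $\mathbb{R}^2$ with finite second moment, the $n$th quantization error is $V_n=V_n(P)=\inf\{\int\min_{a\in\alpha}\|x-a\|^2\,dP(x):\alpha\subset\mathbb{R}^2,\ \mathrm{card}(\alpha)\le n\}$; a set with at most $n$ points attaining the infimum is an optimal set of $n$-means. The uniform distribution on the ellipse is normalized arc length: with $x_1=2\cos\theta$, $x_2=\sin\theta$, $0\le\theta\le2\pi$, $dP=\frac1A\sqrt{4\sin^2\theta+\cos^2\theta}\,d\theta$, where $A=\int_0^{2\pi}\sqrt{4\sin^2\theta+\cos^2\theta}\,d\theta\approx9.6884482205$. The decimal convention means: the points of the optimal set have coordinates differing from the listed decimals by less than one unit in the last displayed digit (coordinates listed as $0$ being exactly $0$), and likewise for the quantization error. *)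

(* Defs.v *)
From HB Require Import structures.
From mathcomp Require Import all_boot all_order all_algebra.
From mathcomp Require Import all_classical all_reals all_analysis.
From mathcomp Require Import measurable_realfun lra.

Set Implicit Arguments.
Unset Strict Implicit.
Unset Printing Implicit Defensive.

Import Order.TTheory GRing.Theory Num.Theory.
Import numFieldNormedType.Exports.

Local Open Scope classical_set_scope.
Local Open Scope card_scope.
Local Open Scope ring_scope.

Section quantization.
Context {R : realType}.
Implicit Types (P : probability (R * R)%type R) (alpha : set (R * R)).

(* The library norm on [R * R] is the sup norm; this is the squared
   Euclidean distance. *)
Definition sqdist (x a : R * R) : R := (x.1 - a.1) ^+ 2 + (x.2 - a.2) ^+ 2.

(* For a nonempty finite [alpha] the infimum is the minimum over [alpha];
   for the empty set it is [+oo]. *)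
Definition distortion P alpha : \bar R :=
  (\int[P]_x ereal_inf [set (sqdist x a)%:E | a in alpha])%E.

Definition quantization_error P (n : nat) : \bar R :=
  ereal_inf [set distortion P alpha | alpha in [set alpha | alpha #<= `I_n]].

Definition optimal_means P (n : nat) alpha : Prop :=
  alpha #<= `I_n /\ distortion P alpha = quantization_error P n.

End quantization.

Section ellipse.
Context {R : realType}.
Local Notation mu := (@lebesgue_measure R).

Definition ellipse_curve (t : R) : R * R := (2 * cos t, sin t).

Lemma ellipse_curveP (x : R * R) :
  x.1 ^+ 2 + 4 * x.2 ^+ 2 = 4 <->
  exists2 t : R, 0 <= t <= 2 * pi & x = ellipse_curve t.
Proof.
case: x => x y /=; split=> [xyE|[t _ [-> ->]]]; last first.
  by have := cos2Dsin2 t; lra.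
have y2E : y ^+ 2 = 1 - (x / 2) ^+ 2 by lra.
have x1 : -1 <= x / 2 <= 1.
  by have y2 := sqr_ge0 y; apply/andP; split; nra.
have cosE : 2 * cos (acos (x / 2)) = x.
  by rewrite acosK ?in_itv//=; lra.
have sinE : sin (acos (x / 2)) = `|y| by rewrite sin_acos// -y2E sqrtr_sqr.
have t0 := acos_ge0 x1; have tpi := acos_lepi x1.
have [y0|y0] := leP 0 y.
  exists (acos (x / 2)); first by lra.
  by rewrite /ellipse_curve cosE sinE ger0_norm.
exists (2 * pi - acos (x / 2)); first by lra.
rewrite /ellipse_curve addrC (mulr_natl pi) cosD2pi sinD2pi cosN sinN cosE sinE.
by rewrite ltr0_norm// opprK.
Qed.

Definition ellipse_speed (t : R) : R :=
  Num.sqrt (4 * sin t ^+ 2 + cos t ^+ 2).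

Definition ellipse_length : R :=
  (\int[mu]_(t in `[0%R, (2 * pi)%R]) ellipse_speed t)%R.

(* Law of the angle [t] of a uniformly distributed point. *)
Definition ellipse_angle_prob (U : set R) : \bar R :=
  (\int[mu]_(t in U `&` `[0%R, (2 * pi)%R])
    (ellipse_speed t / ellipse_length)%:E)%E.

Lemma ellipse_speed_ge1 t : 1 <= ellipse_speed t.
Proof.
rewrite -sqrtr1 ler_wsqrtr//.
by have := cos2Dsin2 t; have := sqr_ge0 (sin t); lra.
Qed.

Lemma continuous_ellipse_speed : continuous ellipse_speed.
Proof.
move=> t; rewrite /ellipse_speed.
apply: (@continuous_comp _ _ _ (fun t => 4 * sin t ^+ 2 + cos t ^+ 2) Num.sqrt);
  last exact: sqrt_continuous.
apply: cvgD.
- apply: cvgM; first exact: cvg_cst.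
  by apply: (@continuous_comp _ _ _ sin (fun x => x ^+ 2));
    [exact: continuous_sin | exact: exprn_continuous].
- by apply: (@continuous_comp _ _ _ cos (fun x => x ^+ 2));
    [exact: continuous_cos | exact: exprn_continuous].
Qed.

Lemma measurable_ellipse_speed : measurable_fun setT ellipse_speed.
Proof.
by apply: continuous_measurable_fun; exact: continuous_ellipse_speed.
Qed.

Lemma integrable_ellipse_speed :
  mu.-integrable `[0, 2 * pi] (EFin \o ellipse_speed).
Proof.
apply: continuous_compact_integrable; first exact: segment_compact.
exact/continuous_subspaceT/continuous_ellipse_speed.
Qed.

Lemma EFin_ellipse_length :
  (ellipse_length%:E =
   \int[mu]_(t in `[0%R, (2 * pi)%R]) (ellipse_speed t)%:E)%E.
Proof.
rewrite /ellipse_length /Rintegral fineK//.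
by apply: integrable_fin_num => //; exact: integrable_ellipse_speed.
Qed.

Lemma ellipse_length_gt0 : 0 < ellipse_length.
Proof.
have pi2 : 0 < 2 * pi :> R by rewrite mulr_gt0 ?pi_gt0.
apply: (lt_le_trans pi2); rewrite -lee_fin EFin_ellipse_length.
apply: (@le_trans _ _ (\int[mu]_(t in `[0%R, (2 * pi)%R]) (cst 1%:E t)))%E.
  rewrite integral_cst//= lebesgue_measure_itv/= lte_fin pi2.
  by rewrite mul1e oppr0 adde0.
apply: ge0_le_integral => //=.
- apply/measurable_EFinP; apply: measurable_funTS.
  exact: measurable_ellipse_speed.
- by move=> t _; rewrite lee_fin ellipse_speed_ge1.
Qed.

Let dens_ge0 t : (0 <= (ellipse_speed t / ellipse_length)%:E)%E.
Proof.
by rewrite lee_fin divr_ge0 ?sqrtr_ge0 ?(ltW ellipse_length_gt0).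
Qed.

Let angle0 : ellipse_angle_prob set0 = 0%E.
Proof. by rewrite /ellipse_angle_prob set0I integral_set0. Qed.

Let angle_ge0 U : (0 <= ellipse_angle_prob U)%E.
Proof. by apply: integral_ge0 => t _; exact: dens_ge0. Qed.

Let angle_sigma_additive : semi_sigma_additive ellipse_angle_prob.
Proof.
move=> /= F mF tF mUF; rewrite /ellipse_angle_prob; apply: cvg_toP.
  apply: ereal_nondecreasing_is_cvgn => m n mn.
  apply: lee_sum_nneg_natr => // k _ _; exact: angle_ge0.
rewrite setI_bigcupl ge0_integral_bigcup//=.
- move=> k; apply: measurableI; [exact: mF | exact: measurable_itv].
- apply: measurable_funTS; apply/measurable_EFinP.
  by apply: measurable_funM => //; exact: measurable_ellipse_speed.
- exact: trivIset_setIr.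
Qed.

HB.instance Definition _ := isMeasure.Build _ _ _ ellipse_angle_prob
  angle0 angle_ge0 angle_sigma_additive.

Let angle_setT : ellipse_angle_prob [set: R] = 1%:E.
Proof.
rewrite /ellipse_angle_prob setTI.
under eq_integral do rewrite EFinM.
rewrite integralZr//; last exact: integrable_ellipse_speed.
by rewrite -EFin_ellipse_length -EFinM divff// gt_eqF// ellipse_length_gt0.
Qed.

HB.instance Definition _ := @Measure_isProbability.Build _ _ R
  ellipse_angle_prob angle_setT.

Let measurable_ellipse_curve : measurable_fun setT ellipse_curve.
Proof.
apply: measurable_fun_pair.
- apply: measurable_funM => //.
  by apply: continuous_measurable_fun; exact: continuous_cos.
- by apply: continuous_measurable_fun; exact: continuous_sin.
Qed.

HB.instance Definition _ :=
  isMeasurableFun.Build _ _ _ _ ellipse_curve measurable_ellipse_curve.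

Definition ellipse_uniform : probability (R * R)%type R :=
  distribution ellipse_angle_prob ellipse_curve.

End ellipse.

Arguments ellipse_uniform R : clear implicits.

(* [decimal n [:: d1; ...; dk]] is the number [n.d1...dk]. Its digits are kept
   separate because six-digit numerals of type [nat] or [int] are unary. *)
Definition decimal {R : realType} (n : nat) (ds : seq nat) : R :=
  n%:R + \sum_(i < size ds) (nth 0%N ds i)%:R / 10 ^+ i.+1.

(* Approximation to within one unit of the [k]-th decimal place. *)
Definition decimal_approx {R : realType} (k : nat) (x y : R) : Prop :=
  `|x - y| < 10 ^- k.

(* Main.v *)
(** Let [x] be the curve, [s] its speed and [v] a cubic polynomial in [cos (2 t)].
    For a point [c] put [Lam c = \int (v - |x - c|^2)_+ s]. Since
    [min_a |x - a|^2 >= v - \sum_a (v - |x - a|^2)_+], a set [alpha] of at most six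
    points has distortion at least [\int v s - \sum_(a in alpha) Lam a], up to the
    factor [1 / ellipse_length]. The function [v] is chosen to agree with the distance
    to the nearest of the six points at the ends of their Voronoi cells and to give
    these points the same value [Kval] of [Lam]. Then [Lam c <= Kval], with equality
    only at the six points, which therefore are the only minimizer. By symmetry, [c]
    may be taken in the first quadrant. Near one of the six points, at distance [r],
    the concavity of [v - |x - c|^2] bounds the effect of the displaced ends of its
    cell by less than the gain [mass * r^2]. Elsewhere [|c|^2] is replaced by an affine
    minorant on each box of a subdivision; this makes [Lam] convex, so that integer
    arithmetic at the vertices suffices. *)
Require Import Defs.
From Stdlib Require Import ZArith Lia.
From HB Require Import structures.
From mathcomp Require Import all_boot all_order all_algebra.
From mathcomp Require Import all_classical all_reals all_analysis.
From mathcomp Require Import measurable_realfun zify ssrZ ring lra.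
Set Implicit Arguments.
Unset Strict Implicit.
Unset Printing Implicit Defensive.
Import Order.TTheory GRing.Theory Num.Theory.
Import numFieldNormedType.Exports.
Local Open Scope classical_set_scope.
Local Open Scope ring_scope.
Delimit Scope Z_scope with ZZ.

(** The bound is weak duality for a linear relaxation of the problem: [v] is a dual potential and
    [Lam c] the saving due to a point [c]. It is attained because the integral of [v - |x - c|^2]
    over the own cell of a contact point is already [Kval]. Each contact point is the centroid of
    its cell, so a displacement by [r] changes this integral only by [- mass * r^2]. No quantity has
    a closed form: the arc moments are elliptic integrals, and the end [tcut] of a cell is a zero of
    a transcendental function. All constants are therefore reals defined by integrals and known
    through enclosures with integer ends. Trigonometric values come from bisecting the right angle,
    moments from a polynomial that replaces the speed and whose residual is certified. A strict
    inequality cannot be decided by enclosures where [Lam] equals [Kval], nor with a uniform margin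
    nearby. This forces the separate treatment of small discs around the contact points, with
    constants sharp enough for the quadratic gain to win. Outside the discs one finite integer
    computation decides. *)

#[global] Arguments Z.shiftr : simpl never.
#[global] Arguments Z.div : simpl never.
#[global] Arguments Z.sqrt : simpl never.

(* Locked, lest [lra] evaluate the large integers under it. *)
HB.lock Definition ZR {R : realType} (m : Z) : R := (int_of_Z m)%:~R.

Definition prec : Z := 52.
Definition bunit : Z := (2 ^ prec)%ZZ.
Lemma bunit_gt0 : (0 < bunit)%ZZ. Proof. by []. Qed.
Lemma prec_ge0 : (0 <= prec)%ZZ. Proof. by []. Qed.
HB.lock Definition scale {R : realType} : R := ZR bunit.

(** * Ball arithmetic on integers scaled by [2^52] *)

Section balls.
Context {R : realType}.
Implicit Types (x y : R) (m n : Z).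
Local Notation ZR m := (@ZR R m%ZZ).

Lemma ZRD m n : ZR (m + n)%ZZ = ZR m + ZR n.
Proof. by rewrite ZR.unlock (rmorphD int_of_Z) intrD. Qed.
Lemma ZRN m : ZR (- m)%ZZ = - ZR m.
Proof. by rewrite ZR.unlock (rmorphN int_of_Z) intrN. Qed.
Lemma ZRB m n : ZR (m - n)%ZZ = ZR m - ZR n.
Proof. by rewrite ZRD ZRN. Qed.
Lemma ZRM m n : ZR (m * n)%ZZ = ZR m * ZR n.
Proof. by rewrite ZR.unlock (rmorphM int_of_Z) intrM. Qed.
Lemma ZR0 : ZR 0 = 0. Proof. by rewrite ZR.unlock. Qed.
Lemma ZR1 : ZR 1 = 1. Proof. by rewrite ZR.unlock. Qed.
Lemma ZR2 : ZR 2 = 2. Proof. by rewrite -[2%ZZ]/(1 + 1)%ZZ ZRD ZR1. Qed.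

Lemma ler_ZR m n : (m <= n)%ZZ -> ZR m <= ZR n.
Proof. by move=> mn; rewrite ZR.unlock ler_int; lia. Qed.
Lemma ltr_ZR m n : (m < n)%ZZ -> ZR m < ZR n.
Proof. by move=> mn; rewrite ZR.unlock ltr_int; lia. Qed.
Lemma ZR_abs m : ZR (Z.abs m) = `|ZR m|.
Proof.
have [m0|m0] := Z_le_gt_dec 0 m.
  by rewrite Z.abs_eq// ger0_norm// -ZR0 ler_ZR.
by rewrite Z.abs_neq ?ltr0_norm ?ZRN//; [rewrite -ZR0 ltr_ZR//; lia|lia].
Qed.
Lemma ZR_nat (n : nat) : ZR (Z.of_nat n) = n%:R.
Proof. by rewrite ZR.unlock; have -> : int_of_Z (Z.of_nat n) = n%:Z by lia. Qed.

Local Notation U := (@scale R).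
Lemma UE : U = ZR bunit. Proof. by rewrite scale.unlock. Qed.

Lemma U_gt0 : 0 < U. Proof. by have := ltr_ZR bunit_gt0; rewrite ZR0 UE. Qed.

(* The zball [(m, r)] is the interval of radius [r / 2^52] around [m / 2^52]. *)
Definition zball : Type := (Z * Z)%type.
Definition inb (b : zball) x : Prop := `|x * U - ZR b.1| <= ZR b.2.

Lemma inbP b x : inb b x <-> ZR b.1 - ZR b.2 <= x * U <= ZR b.1 + ZR b.2.
Proof.
rewrite /inb ler_norml; split=> /andP[? ?]; apply/andP; split; lra.
Qed.

Definition badd (a b : zball) : zball := ((a.1 + b.1)%ZZ, (a.2 + b.2)%ZZ).
Definition bopp (a : zball) : zball := ((- a.1)%ZZ, a.2).
Definition bsub (a b : zball) : zball := ((a.1 - b.1)%ZZ, (a.2 + b.2)%ZZ).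
Definition bscale (k : Z) (a : zball) : zball := ((k * a.1)%ZZ, (Z.abs k * a.2)%ZZ).
(** The [+ 2] pays one unit for the floor of the midpoint and one for the floor of the radius. *)
Definition bmul (a b : zball) : zball :=
  (Z.shiftr (a.1 * b.1) prec,
   (Z.shiftr (Z.abs a.1 * b.2 + a.2 * (Z.abs b.1 + b.2)) prec + 2)%ZZ).
Definition bhalf (a : zball) : zball := (Z.div2 a.1, (Z.div2 a.2 + 2)%ZZ).
Definition bcst (m : Z) : zball := (m, 0%ZZ).
Definition bint (k : Z) : zball := ((k * bunit)%ZZ, 0%ZZ).
Definition bwiden (e : Z) (a : zball) : zball := (a.1, (a.2 + e)%ZZ).
Definition bhull (a b : zball) : zball :=
  (a.1, (Z.abs (a.1 - b.1) + a.2 + b.2)%ZZ).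
(** The ball is centred at the lower end and has the whole width as radius, so that nothing has to
    be halved; [bsqrt] does the same. *)
Definition binv (a : zball) : zball :=
  let lo := (bunit * bunit / (a.1 + a.2))%ZZ in
  let hi := (bunit * bunit / (a.1 - a.2) + 1)%ZZ in (lo, (hi - lo)%ZZ).
Definition bsqrt (a : zball) : zball :=
  let lo := Z.sqrt ((a.1 - a.2) * bunit) in
  let hi := (Z.sqrt ((a.1 + a.2) * bunit) + 1)%ZZ in (lo, (hi - lo)%ZZ).

Lemma inb_add a b x y : inb a x -> inb b y -> inb (badd a b) (x + y).
Proof. by rewrite !inbP/= !ZRD mulrDl => /andP[? ?] /andP[? ?]; lra. Qed.
Lemma inb_opp a x : inb a x -> inb (bopp a) (- x).
Proof. by rewrite !inbP/= !ZRN mulNr => /andP[? ?]; lra. Qed.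
Lemma inb_sub a b x y : inb a x -> inb b y -> inb (bsub a b) (x - y).
Proof. by rewrite !inbP/= ZRB ZRD mulrBl => /andP[? ?] /andP[? ?]; lra. Qed.
Lemma inb_scale k a x : inb a x -> inb (bscale k a) (ZR k * x).
Proof.
by rewrite /inb/= !ZRM ZR_abs -mulrA -mulrBr normrM => ?; rewrite ler_wpM2l.
Qed.
Lemma inb_cst m : inb (bcst m) (ZR m / U).
Proof. by rewrite /inb/= divfK ?subrr ?normr0 ?ZR0 ?gt_eqF ?U_gt0//. Qed.
Lemma inb_int k : inb (bint k) (ZR k).
Proof. by rewrite /inb/= ZRM UE subrr normr0 ZR0. Qed.
Lemma inb_widen e a x y : inb a x -> `|y - x| * U <= ZR e -> inb (bwiden e a) y.
Proof.
rewrite /inb/= ZRD => ax yx.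
rewrite (_ : y * U - _ = (x * U - ZR a.1) + (y - x) * U); last by ring.
by rewrite (le_trans (ler_normD _ _))// lerD// normrM (gtr0_norm U_gt0).
Qed.
Lemma inb_hull a b x y z : inb a x -> inb b y -> x <= z <= y ->
  inb (bhull a b) z.
Proof.
move=> ax b_y /andP[xz zy]; have := U_gt0 => U0.
have /andP[] : ZR a.1 - ZR a.2 <= x * U <= ZR a.1 + ZR a.2 by apply/inbP.
have /andP[] : ZR b.1 - ZR b.2 <= y * U <= ZR b.1 + ZR b.2 by apply/inbP.
have : x * U <= z * U by rewrite ler_pM2r.
have : z * U <= y * U by rewrite ler_pM2r.
rewrite inbP/= !ZRD ZR_abs ZRB.
have := ler_norm (ZR a.1 - ZR b.1).
have := ler_norm (- (ZR a.1 - ZR b.1)); rewrite normrN.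
have : 0 <= ZR b.2 by apply: le_trans b_y.
have : 0 <= ZR a.2 by apply: le_trans ax.
move: (ZR a.1) (ZR a.2) (ZR b.1) (ZR b.2) => a1 a2 b1 b2 *.
lra.
Qed.

Lemma ZR_shiftr m :
  ZR (Z.shiftr m prec) * U <= ZR m < (ZR (Z.shiftr m prec) + 1) * U.
Proof.
rewrite UE -ZR1 -ZRD -!ZRM (Z.shiftr_div_pow2 m prec prec_ge0).
change (2 ^ prec)%ZZ with bunit; have := bunit_gt0.
move: bunit => p P.
have := Z.div_mod m p ltac:(lia); have := Z.mod_pos_bound m p P.
move: (m mod p)%ZZ (m / p)%ZZ => r q *.
by rewrite ler_ZR ?ltr_ZR//; lia.
Qed.

Lemma inb_mul a b x y : inb a x -> inb b y -> inb (bmul a b) (x * y).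
Proof.
case: a b => [m1 r1] [m2 r2]; rewrite /inb /bmul /fst /snd => ax b_y.
have U0 := U_gt0.
have r20 : 0 <= ZR r2 by apply: le_trans b_y.
have r10 : 0 <= ZR r1 by apply: le_trans ax.
have /andP[p1 p2] := ZR_shiftr (m1 * m2).
have /andP[_ q2] := ZR_shiftr (Z.abs m1 * r2 + r1 * (Z.abs m2 + r2)).
move: p1 p2 q2; rewrite !(ZRD, ZRM, ZR_abs) ZR2 => p1 p2 q2.
set s := ZR (Z.shiftr _ _) in p1 p2 *; set u := ZR (Z.shiftr _ _) in q2 *.
rewrite -(ler_pM2r U0) -[leLHS](_ : `|(x * y * U - s) * U| = _); last by rewrite normrM (gtr0_norm U0).
have -> : (x * y * U - s) * U = ZR m1 * (y * U - ZR m2) +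
   (x * U - ZR m1) * (ZR m2 + (y * U - ZR m2)) + (ZR m1 * ZR m2 - s * U) by ring.
have h1 : `|ZR m1 * (y * U - ZR m2)| <= `|ZR m1| * ZR r2.
  by rewrite normrM ler_wpM2l.
have h2 : `|(x * U - ZR m1) * (ZR m2 + (y * U - ZR m2))| <= ZR r1 * (`|ZR m2| + ZR r2).
  by rewrite normrM ler_pM// (le_trans (ler_normD _ _))// lerD.
have h3 : `|ZR m1 * ZR m2 - s * U| <= U by rewrite ler_norml; apply/andP; split; lra.
apply: (le_trans (ler_normD _ _)); apply: le_trans (lerD (ler_normD _ _) h3) _.
apply: le_trans (lerD (lerD h1 h2) (lexx U)) _.
by rewrite (_ : (u + 2) * U = (u + 1) * U + U) ?lerD2r ?ltW//; ring.
Qed.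

Lemma ZR_div2 m : ZR (Z.div2 m) * 2 <= ZR m <= ZR (Z.div2 m) * 2 + 1.
Proof.
rewrite -ZR2 -ZR1 -ZRM -ZRD; have := Z.div2_odd m.
by move: (Z.div2 m) => k; case: Z.odd; rewrite /Z.b2z => e; rewrite !ler_ZR//; lia.
Qed.

Lemma inb_half a x : inb a x -> inb (bhalf a) (x / 2).
Proof.
case: a => m r; rewrite !inbP/= ZRD ZR2 mulrAC.
have /andP[] := ZR_div2 m; have /andP[] := ZR_div2 r.
by move: (ZR m) (ZR r) (ZR _) (ZR _) => ? ? ? ? ? ? ? ? /andP[? ?]; lra.
Qed.

Lemma inb_inv a x : Z.ltb a.2 a.1 -> inb a x -> 0 < x /\ inb (binv a) x^-1.
Proof.
case: a => m r /= /Z.ltb_lt/ltr_ZR rm; rewrite inbP/= => /andP[xlo xhi].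
have U0 := U_gt0; have xU0 : 0 < x * U by lra.
have x0 : 0 < x by rewrite -(pmulr_lgt0 _ U0).
split=> //; rewrite inbP /binv /fst /snd.
have mr0 : (0 < m - r)%ZZ.
  by case: (Z.ltb_spec 0 (m - r)) => // /ler_ZR; rewrite ZR0 ZRB; lra.
have pr0 : (0 < m + r)%ZZ.
  by case: (Z.ltb_spec 0 (m + r)) => // /ler_ZR; rewrite ZR0 ZRD; lra.
have r0 : (0 <= r)%ZZ.
  by case: (Z.leb_spec 0 r) => // /ltr_ZR; rewrite ZR0; lra.
have BB : (0 <= bunit * bunit)%ZZ by have := bunit_gt0; move: bunit => u; nia.
move: BB UE; move: bunit => B BB UB.
have e1 := Z.mul_div_le (B * B) (m + r) pr0.
have e2 := Z.mul_succ_div_gt (B * B) _ mr0.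
have e3 := Z.div_le_compat_l _ (m - r) (m + r) BB ltac:(lia).
have l0 := Z.div_pos _ _ BB pr0.
move: e1 e2 e3 l0; rewrite -Z.add_1_r.
set lo := (_ / (m + r))%ZZ; set hi := (_ / (m - r) + 1)%ZZ => e1 /Z.lt_le_incl e2 e3 l0.
have lh : (lo <= hi)%ZZ by rewrite /hi; lia.
move: e1 e2 lh l0; clearbody lo hi; clear e3 => /ler_ZR e1 /ler_ZR e2 /ler_ZR lh /ler_ZR l0.
move: e1 e2 l0; rewrite !ZRM -!UB ZRB ZRD ZR0 => e1 e2 l0.
have h0 : 0 <= ZR hi by apply: le_trans lh.
rewrite ZRB subrKC.
have iU : x^-1 * U = U * U / (x * U) by rewrite invfM mulrACA divff ?mulr1 1?mulrC// gt_eqF.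
rewrite iU ler_pdivlMr// ler_pdivrMr//.
apply/andP; split; last first.
  by apply: le_trans e2 _; rewrite mulrC ler_wpM2l.
apply: (@le_trans _ _ (ZR lo * (x * U))).
  by rewrite ler_wpM2r ?(ltW xU0)//; lra.
by apply: le_trans e1; rewrite mulrC ler_wpM2r.
Qed.

Lemma inb_sqrt a x : Z.leb a.2 a.1 -> inb a x -> inb (bsqrt a) (Num.sqrt x).
Proof.
case: a => m r /= /Z.leb_le/ler_ZR rm; rewrite inbP/= => /andP[lo hi].
have U0 := U_gt0; have xU0 : 0 <= x * U by lra.
have x0 : 0 <= x by rewrite -(pmulr_lge0 _ U0).
have mr0 : (0 <= m - r)%ZZ.
  by case: (Z.leb_spec 0 (m - r)) => // /ltr_ZR; rewrite ZR0 ZRB; lra.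
have pr0 : (0 <= m + r)%ZZ.
  by case: (Z.leb_spec 0 (m + r)) => // /ltr_ZR; rewrite ZR0 ZRD; lra.
move: bunit_gt0 UE; rewrite /bsqrt; move: bunit => B B0 UB.
have S1 : (0 <= (m - r) * B)%ZZ by nia.
have S2 : (0 <= (m + r) * B)%ZZ by nia.
have [a1 _] := Z.sqrt_spec ((m - r) * B) S1.
have [_ a2] := Z.sqrt_spec ((m + r) * B) S2.
have := Z.sqrt_nonneg ((m - r) * B); have := Z.sqrt_nonneg ((m + r) * B).
rewrite inbP/= ZRB subrKC; move: a1 a2; rewrite -Z.add_1_r.
move: (Z.sqrt _) (Z.sqrt _) => s2 s1 /ler_ZR a1 /ltr_ZR a2 /ler_ZR b2 /ler_ZR b1.
move: a1 a2 b1 b2; rewrite !(ZRM, ZRB, ZRD) -?UB ZR0 ZR1 => a1 a2 b1 b2.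
have s0 := sqrtr_ge0 x; have ss : Num.sqrt x ^+ 2 = x by rewrite sqr_sqrtr.
have sU : (Num.sqrt x * U) ^+ 2 = x * U * U by rewrite exprMn ss -mulrA.
have sU0 : 0 <= Num.sqrt x * U by rewrite mulr_ge0// ltW.
have l1 : ZR s1 <= Num.sqrt x * U.
  rewrite -(@ler_pXn2r _ 2)// ?nnegrE// sU expr2; apply: le_trans a1 _.
  by rewrite ler_wpM2r// ltW.
have l2 : Num.sqrt x * U <= ZR s2 + 1.
  rewrite -(@ler_pXn2r _ 2)// ?nnegrE ?addr_ge0// sU expr2; apply: le_trans (ltW a2).
  by rewrite ler_wpM2r// ltW.
by apply/andP; split; lra.
Qed.

Lemma inb_gt0 a x : inb a x -> Z.ltb a.2 a.1 -> 0 < x.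
Proof.
move=> /inbP/andP[h _] /Z.ltb_lt/ltr_ZR l; have := U_gt0 => U0.
by rewrite -(pmulr_lgt0 _ U0); lra.
Qed.

End balls.

(** * Integrals of continuous functions over segments *)

Section itg.
Context {R : realType}.
Implicit Types (f g F G : R -> R) (a b c k : R).
Notation mu := (@lebesgue_measure R).

Definition itg f a b : R := (\int[mu]_(x in `[a, b]) f x)%R.

Lemma cont_integrable f a b : continuous f -> mu.-integrable `[a, b] (EFin \o f).
Proof.
move=> cf; apply: continuous_compact_integrable; first exact: segment_compact.
exact: continuous_subspaceT.
Qed.

Lemma EFin_itg f a b : continuous f ->
  (\int[mu]_(x in `[a, b]) (f x)%:E = (itg f a b)%:E)%E.
Proof.
move=> cf; rewrite /itg /Rintegral fineK//.
by apply: integrable_fin_num => //; exact: cont_integrable.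
Qed.

Lemma itgD f g a b : continuous f -> continuous g ->
  itg (fun x => f x + g x) a b = itg f a b + itg g a b.
Proof. by move=> cf cg; rewrite /itg RintegralD//; exact: cont_integrable. Qed.

Lemma itgB f g a b : continuous f -> continuous g ->
  itg (fun x => f x - g x) a b = itg f a b - itg g a b.
Proof. by move=> cf cg; rewrite /itg RintegralB//; exact: cont_integrable. Qed.

Lemma itgZ f k a b : continuous f ->
  itg (fun x => k * f x) a b = k * itg f a b.
Proof. by move=> cf; rewrite /itg RintegralZl//; exact: cont_integrable. Qed.

Lemma eq_itg f g a b : {in `[a, b], f =1 g} -> itg f a b = itg g a b.
Proof. by move=> fg; apply: eq_Rintegral => x; rewrite inE => /fg. Qed.

Lemma le_itg f g a b : continuous f -> continuous g ->
  {in `[a, b], forall x, f x <= g x} -> itg f a b <= itg g a b.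
Proof.
move=> cf cg fg; apply: le_Rintegral => //; do ?exact: cont_integrable.
Qed.

Lemma itg_ge0 f a b : {in `[a, b], forall x, 0 <= f x} -> 0 <= itg f a b.
Proof. by move=> f0; apply: Rintegral_ge0 => x /= /f0. Qed.

Lemma itgxx f a : itg f a a = 0.
Proof. by rewrite /itg set_itv1 Rintegral_set1. Qed.

Lemma itg_chasles f a b c : continuous f -> a <= b -> b <= c ->
  itg f a c = itg f a b + itg f b c.
Proof.
rewrite /itg => cf ab bc; have ci := cont_integrable a c cf.
have := @Rintegral_itvB R f (BLeft a) (BRight c) b ci.
rewrite !bnd_simp => /(_ ab bc) /eqP; rewrite subr_eq => /eqP ->.
rewrite addrC Rintegral_itv_obnd_cbnd //.
apply: integrableS (cont_integrable b c cf) => //.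
by apply: subset_itvr; rewrite bnd_simp.
Qed.

Lemma itg_FTC f F a b : continuous f -> a <= b ->
  (forall x, a <= x <= b -> is_derive x 1 F (f x)) -> itg f a b = F b - F a.
Proof.
move=> cf; rewrite le_eqVlt => /predU1P[->|ab] dF.
  by rewrite itgxx subrr.
have {}dF x : x \in `[a, b] -> is_derive x 1 F (f x).
  by rewrite in_itv/=; exact: dF.
have cF x : x \in `[a, b] -> {for x, continuous F}.
  by move=> /dF d; apply: differentiable_continuous; apply/derivable1_diffP; apply: ex_derive.
apply: EFin_inj; rewrite -EFin_itg// EFinB.
apply: continuous_FTC2 => //.
- exact: continuous_subspaceT.
- split.
  + move=> x xab; have := dF x (subset_itv_oo_cc xab) => d; exact: ex_derive.
  + by apply: cvg_at_right_filter; apply: cF; rewrite in_itv/= lexx ltW.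
  + by apply: cvg_at_left_filter; apply: cF; rewrite in_itv/= lexx ltW.
- move=> x xab; have := dF x (subset_itv_oo_cc xab) => d.
  by rewrite derive1E; apply: derive_val.
Qed.

(** Starting the integral at [a - 1] makes every point of [[a, b]] interior, so that the derivative
    is two-sided also at the ends. *)
Lemma antiderivative f a b : continuous f ->
  exists F, forall x, a <= x <= b -> is_derive x 1 F (f x).
Proof.
move=> cf; exists (fun x => itg f (a - 1) x) => x /andP[ax xb].
have bx : x < b + 1 by lra.
have xa : a - 1 < x by lra.
have [d e] := @continuous_FTC1_closed R f (a - 1) x (b + 1) bx (cont_integrable _ _ cf) xa (cf x).
by rewrite -e derive1E; apply: DeriveDef.
Qed.

Lemma itg_reflect f a b c : continuous f -> a <= b ->
  itg f (c - b) (c - a) = itg (fun x => f (c - x)) a b.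
Proof.
move=> cf ab; have [F dF] := antiderivative (c - b) (c - a) cf.
have cb : c - b <= c - a by lra.
rewrite (itg_FTC cf cb dF).
have cr : continuous (fun x => f (c - x)).
  move=> x; apply: (@continuous_comp _ _ _ (fun x => c - x) f); last exact: cf.
  by apply: cvgB; [exact: cvg_cst|exact: cvg_id].
have dr x : a <= x <= b -> is_derive x 1 (fun x => - F (c - x)) (f (c - x)).
  move=> /andP[ax xb].
  have d1 : is_derive x 1 (fun x => c - x) (- 1 : R).
    by apply: is_derive_eq; rewrite add0r mul1r.
  have d2 : is_derive (c - x) 1 F (f (c - x)) by apply: dF; lra.
  have d3 : is_derive x 1 (F \o (fun x => c - x)) (f (c - x) * -1).
    exact: is_derive1_comp.
  by apply: is_derive_eq; rewrite mulrN1 opprK.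
by rewrite (itg_FTC cr ab dr) opprK addrC.
Qed.

Lemma itg_cst k a b : a <= b -> itg (fun=> k) a b = k * (b - a).
Proof.
move=> ab; have dk x : a <= x <= b -> is_derive x 1 (fun x => k * x) k.
  by move=> _; apply: is_derive_eq; rewrite /GRing.scale/= mulr1.
by rewrite (itg_FTC _ ab dk) ?mulrBr// => x; exact: cvg_cst.
Qed.

Lemma normr_itg_le f e a b : continuous f -> a <= b ->
  {in `[a, b], forall x, `|f x| <= e} -> `|itg f a b| <= e * (b - a).
Proof.
move=> cf ab fe; have ce k : continuous (fun _ : R => k) by move=> x; exact: cvg_cst.
rewrite ler_norml -mulNr -(itg_cst e ab) -(itg_cst (- e) ab).
by apply/andP; split; apply: le_itg => // x /fe; rewrite ler_norml => /andP[].
Qed.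

Lemma nondecreasing_is_derive (F f : R -> R) a b : a <= b ->
  (forall x, a <= x <= b -> is_derive x 1 F (f x)) ->
  (forall x, a < x < b -> 0 <= f x) -> F a <= F b.
Proof.
rewrite le_eqVlt => /predU1P[->//|ab] dF f0.
have d0 x : x \in `]a, b[ -> is_derive x 1 F (f x).
  by rewrite in_itv/= => /andP[ax xb]; apply: dF; rewrite !ltW.
have [|c] := MVT ab d0.
  apply: continuous_in_subspaceT => x; rewrite inE/= in_itv/= => xab.
  apply: differentiable_continuous; apply/derivable1_diffP.
  by have := dF x xab => d; exact: ex_derive.
rewrite in_itv/= => /f0 fc0 E; rewrite -subr_ge0 E mulr_ge0//; lra.
Qed.

End itg.

(** * Polynomials with integer coefficients and their bounds in the Chebyshev basis *)

Section listpoly.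
Implicit Types (l m : seq Z) (a c k : Z).

Fixpoint ladd l m : seq Z :=
  match l, m with
  | [::], _ => m
  | _, [::] => l
  | a :: l', c :: m' => (a + c)%ZZ :: ladd l' m'
  end.
Definition lscale k l : seq Z := map (Z.mul k) l.
Fixpoint lmul l m : seq Z :=
  if l is a :: l' then ladd (lscale a m) (0%ZZ :: lmul l' m) else [::].
Fixpoint lderiv l : seq Z :=
  if l is _ :: l' then ladd l' (0%ZZ :: lderiv l') else [::].
Fixpoint l1 l : Z := if l is a :: l' then (Z.abs a + l1 l')%ZZ else 0%ZZ.

(* If [l] lists the coefficients of [P], then [cheb l] lists the coefficients
   of [2 ^ size l * P] in the Chebyshev basis; here
   [2 z T_k = T_(k+1) + T_(k-1)]. *)
Definition cheb2X l : seq Z :=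
  if l is a :: l' then ladd (0%ZZ :: (2 * a)%ZZ :: l') l' else [::].
Fixpoint cheb l : seq Z :=
  if l is a :: l' then ladd [:: (a * 2 ^ Z.of_nat (size l))%ZZ] (cheb2X (cheb l'))
  else [::].
(* Upper bound of [|P|] on [[-1, 1]]. *)
Definition cheb_norm l : Z := (l1 (cheb l) / 2 ^ Z.of_nat (size l) + 1)%ZZ.

Context {R : realType}.
Implicit Types (z t : R).

Fixpoint hornerZ l z : R := if l is c :: l' then ZR c + z * hornerZ l' z else 0.

Lemma hornerZ_add l m z : hornerZ (ladd l m) z = hornerZ l z + hornerZ m z.
Proof.
elim: l m => [|a l IH] [|c m] /=; rewrite ?add0r ?addr0//.
by rewrite IH ZRD; ring.
Qed.
Lemma hornerZ_scale k l z : hornerZ (lscale k l) z = ZR k * hornerZ l z.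
Proof. by elim: l => [|a l IH] /=; rewrite ?mulr0// IH ZRM; ring. Qed.
Lemma hornerZ_mul l m z : hornerZ (lmul l m) z = hornerZ l z * hornerZ m z.
Proof.
elim: l => [|a l IH] /=; rewrite ?mul0r// hornerZ_add hornerZ_scale/= IH ZR0.
ring.
Qed.

Lemma is_derive_hornerZ l (f : R -> R) (df t : R) : is_derive t 1 f df ->
  is_derive t 1 (fun u => hornerZ l (f u)) (hornerZ (lderiv l) (f t) * df).
Proof.
move=> d; elim: l => [|c l IH] /=.
  by rewrite mul0r; exact: is_derive_cst.
apply: is_derive_eq; rewrite hornerZ_add/= ZR0 /GRing.scale/=.
ring.
Qed.

Lemma continuous_hornerZ l : continuous (hornerZ l).
Proof.
elim: l => [|c l IH] z /=; first exact: cvg_cst.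
by apply: cvgD; [exact: cvg_cst|apply: cvgM; [exact: cvg_id|exact: IH]].
Qed.

Lemma hornerZ_le_l1 l z : `|z| <= 1 -> `|hornerZ l z| <= ZR (l1 l).
Proof.
move=> z1; elim: l => [|a l IH] /=; first by rewrite normr0 ZR0.
rewrite ZRD ZR_abs (le_trans (ler_normD _ _))// lerD2l normrM.
by rewrite -[leRHS]mul1r ler_pM.
Qed.

Fixpoint cosum (k : nat) l t : R :=
  if l is a :: l' then ZR a * cos (k%:R * t) + cosum k.+1 l' t else 0.

Lemma cosum_cons (k : nat) a l t :
  cosum k (a :: l) t = ZR a * cos (k%:R * t) + cosum k.+1 l t.
Proof. by []. Qed.

Lemma cosum_add (k : nat) l m t : cosum k (ladd l m) t = cosum k l t + cosum k m t.
Proof.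
elim: l m k => [|a l IH] [|c m] k /=; rewrite ?add0r ?addr0//.
by rewrite IH ZRD; ring.
Qed.

Lemma cosum_shift (k : nat) l t :
  cosum k.+2 l t + cosum k l t = 2 * cos t * cosum k.+1 l t.
Proof.
elim: l k => [|a l IH] k /=; first by rewrite addr0 mulr0.
have e1 : cos (k.+2%:R * t) = cos (k.+1%:R * t) * cos t - sin (k.+1%:R * t) * sin t.
  by rewrite -cosD -(natr1 k.+1) mulrDl mul1r.
have e2 : cos (k%:R * t) = cos (k.+1%:R * t) * cos t + sin (k.+1%:R * t) * sin t.
  by rewrite -cosB -(natr1 k) mulrDl mul1r addrK.
have h := IH k.+1; rewrite [RHS]mulrDr -h e1 e2; ring.
Qed.

Lemma cosum_cheb2X l t : cosum 0 (cheb2X l) t = 2 * cos t * cosum 0 l t.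
Proof.
case: l => [|a l]; first by rewrite mulr0.
have -> : cheb2X (a :: l) = ladd (0%ZZ :: (2 * a)%ZZ :: l) l by [].
rewrite cosum_add !cosum_cons.
have := cosum_shift 0 l t; rewrite ZR0 ZRM ZR2 !mul0r add0r cos0 mul1r mulr1.
by rewrite mulrDr => <-; ring.
Qed.

Lemma cosum_cheb l t :
  cosum 0 (cheb l) t = ZR (2 ^ Z.of_nat (size l)) * hornerZ l (cos t).
Proof.
elim: l => [|a l IH]; first by rewrite /= mulr0.
have -> : cheb (a :: l) = ladd [:: (a * 2 ^ Z.of_nat (size l).+1)%ZZ] (cheb2X (cheb l)).
  by [].
rewrite cosum_add cosum_cheb2X IH cosum_cons mul0r cos0 addr0 mulr1.
have -> : Z.of_nat (size (a :: l)) = Z.succ (Z.of_nat (size l)).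
  by rewrite -Nat2Z.inj_succ.
rewrite -[hornerZ (a :: l) _]/(ZR a + cos t * hornerZ l (cos t)) ?Nat2Z.inj_succ.
rewrite Z.pow_succ_r; last exact: Nat2Z.is_nonneg.
by rewrite !ZRM ZR2; ring.
Qed.

Lemma cosum_le (k : nat) l t : `|cosum k l t| <= ZR (l1 l).
Proof.
elim: l k => [|a l IH] k /=; first by rewrite normr0 ZR0.
rewrite ZRD ZR_abs (le_trans (ler_normD _ _))// lerD// normrM ler_piMr//.
by rewrite ler_norml cos_geN1 cos_le1.
Qed.

(** Each [cos (k t)] is at most 1 in absolute value. A polynomial that is small on [[-1, 1]] has
    small Chebyshev coefficients, whereas its monomial coefficients may be large. *)
Lemma hornerZ_le_cheb l t : `|hornerZ l (cos t)| <= ZR (cheb_norm l).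
Proof.
have P : (0 < 2 ^ Z.of_nat (size l))%ZZ by apply: Z.pow_pos_nonneg; lia.
have := cosum_le 0 (cheb l) t; rewrite cosum_cheb normrM -ZR_abs Z.abs_eq; last lia.
have : ZR (l1 (cheb l)) <= ZR (2 ^ Z.of_nat (size l)) * ZR (cheb_norm l) :> R.
  rewrite -ZRM; apply: ler_ZR; rewrite /cheb_norm.
  by have := Z.mul_succ_div_gt (l1 (cheb l)) _ P; rewrite -Z.add_1_r; lia.
move=> h1 h2; have := le_trans h2 h1; rewrite ler_pM2l//.
by rewrite -ZR0; apply: ltr_ZR.
Qed.

Fixpoint hornerB l (b : zball) : zball :=
  if l is c :: l' then badd (bcst c) (bmul b (hornerB l' b)) else (0, 0)%ZZ.

Lemma inb_hornerB l b z : inb b z -> inb (hornerB l b) (hornerZ l z / scale).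
Proof.
move=> bz; elim: l => [|c l IH] /=; first by rewrite /inb/= !mul0r ZR0 subrr normr0.
by rewrite mulrDl -mulrA; apply: inb_add; [exact: inb_cst|exact: inb_mul].
Qed.

End listpoly.

(** * Polynomial approximation of the speed and of its moments, in [z = cos (2 t)] *)

Definition speed_poly : seq Z := [::
  7120816245988279; -2136244873795849; -320436731098212; -96131019390139;
  -36049130899655; -15140633348532; -6813310604727; -3212009110986;
  -1565607826026; -782670924385; -400563152041; -208107435950; -104212939837;
  -53892761641; -40820733133; -24475728937; 5576791491; 5765243863;
  -16542901207; -11043219702; 6921445704; 4615003177; -2383014789;
  -1468216115]%ZZ.
(** With [p] the approximate speed, the primitives are sought as [a t + sin (2 t) P(z)] for [z^j p],
    as [sin t P(z)] for [2 p cos t], and as [- cos t P(z)] for [p sin t]. Coefficients are scaled by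
    [2^52]; only the residual checks below vouch for them. *)
Definition prim0 : seq Z := [::
  -1105148595837685; -88212917641929; -18513079469880; -5402489911584;
  -1868432178643; -717078839301; -295307369825; -127973961921; -57643379160;
  -26776420261; -12745495025; -6134784236; -3012227275; -1654687762;
  -872326696; -183684140; -52939749; -336902470; -210144314; 116168744;
  76443394; -54159427; -31917742]%ZZ.
Definition prim1 : seq Z := [::
  3442008223738377; -555018644971446; -59199949627881; -13971617681656;
  -4345370833634; -1564192206311; -617048119724; -259262366228;
  -114085191963; -52010486037; -24396281465; -11706308925; -5673126675;
  -2801691471; -1546012633; -818486652; -173738933; -50465998; -318997644;
  -199526836; 110524768; 72908244; -51804669; -30587836]%ZZ.
Definition prim2 : seq Z := [::
  -742022423673084; 1713304693230362; -371011211836542; -44599578844472;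
  -11227799652925; -3635989965756; -1345581428260; -541624906387;
  -231094165444; -102927105415; -47384293350; -22406103740; -10824313722;
  -5276282220; -2618740029; -1450765410; -770919976; -164816470; -48209729;
  -302899590; -189930339; 105402800; 69685124; -49646141; -29364322]%ZZ.
Definition prim3 : seq Z := [::
  2278150516237658; -418149422070788; 1139075258118829; -278766281380525;
  -35795587159413; -9388537724835; -3126595041327; -1180816664849;
  -482699979932; -208468516058; -93764451703; -43516418645; -20717087976;
  -10066273965; -4931469119; -2458274502; -1366597930; -728588895;
  -156766569; -46143981; -288348028; -181214360; 100733728; 66734519;
  -47660296; -28234925]%ZZ.
Definition primX : seq Z := [::
  10914624504201853; -1663503993887353; -179505558517590; -42775721731921;
  -13396001667896; -4846575321176; -1919255152989; -808835412814;
  -356782060640; -163004409935; -76587097000; -36691033314; -17819953930;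
  -9118191099; -4943058443; -2056907619; -462896198; -777328162; -1076027039;
  -177031527; 379555246; 40925564; -169777434; -62477281]%ZZ.
Definition primY : seq Z := [::
  8407349872079950; -643266813045835; -51611108664586; -10396864629214;
  -2919120873205; -977704304081; -365490500304; -147281007199; -62674625188;
  -27785510991; -12737310778; -6049073895; -2874114015; -1244618826;
  -724573334; -660270215; -125229758; 285569809; -117491652; -320939739;
  36835753; 128837615; -21023051; -31238641]%ZZ.
Definition prim_slope : seq Z :=
  [:: 6944390410704422; -1110037289942892; 3426609386460725; -836298844141576]%ZZ.

Definition lsub (l m : seq Z) : seq Z := ladd l (lscale (-1) m).
Definition res_speed : seq Z :=
  lsub (lscale 2 (lmul speed_poly speed_poly))
       [:: 5 * bunit * bunit; -3 * bunit * bunit]%ZZ.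
Definition dprim (a : Z) (l : seq Z) : seq Z :=
  ladd [:: a] (ladd (0%ZZ :: lscale 2 l)
    (ladd (lscale (-2) (lderiv l)) [:: 0, 0 & lscale 2 (lderiv l)]%ZZ)).
Definition dprimX (l : seq Z) : seq Z :=
  ladd l (ladd (lscale (-2) (lderiv l)) (0%ZZ :: lscale 2 (lderiv l))).
Definition dprimY (l : seq Z) : seq Z :=
  ladd l (ladd (lscale 2 (lderiv l)) (0%ZZ :: lscale 2 (lderiv l))).
Definition prims := [:: prim0; prim1; prim2; prim3].
Definition res_prim (j : nat) : seq Z :=
  lsub (ncons j 0%ZZ speed_poly) (dprim (nth 0%ZZ prim_slope j) (nth [::] prims j)).

(** The second inequality says that the constant term dominates all others, hence that the
    approximate speed is nonnegative on [[-1, 1]]. *)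
Lemma res_speed_check :
  Z.leb (cheb_norm res_speed) (2 * 570 * bunit) &&
  Z.leb (l1 (behead speed_poly)) (head 0%ZZ speed_poly).
Proof. by vm_compute. Qed.
(** Residuals of the differentiated primitives, in units of [2^-52]. Added to the error 570 of the
    speed (doubled for [xmoment]) they give the constants 580, 1280 and 610 below. *)
Lemma res_prim_check :
  [&& all (fun j => Z.leb (cheb_norm (res_prim j)) 10) (iota 0 4),
      Z.leb (cheb_norm (lsub (lscale 2 speed_poly) (dprimX primX))) 140 &
      Z.leb (cheb_norm (lsub speed_poly (dprimY primY))) 40].
Proof. by vm_compute. Qed.

Section speed.
Context {R : realType}.
Implicit Types (t u : R).
Local Notation U := (@scale R).
Local Notation s := (@ellipse_speed R).

Lemma ZRN1 : ZR (-1) = -1 :> R. Proof. by rewrite -[in RHS]ZR1 -ZRN. Qed.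
Lemma ZRN2 : ZR (-2) = -2 :> R. Proof. by rewrite -[in RHS]ZR2 -ZRN. Qed.

Definition zc t := cos (2 * t).

Lemma zc_cos t : zc t = 2 * cos t ^+ 2 - 1.
Proof. by rewrite /zc mulr_natl cos_mulr2n mulr_natl. Qed.
Lemma zc_sin t : zc t = 1 - 2 * sin t ^+ 2.
Proof. by rewrite zc_cos; have := cos2Dsin2 t; lra. Qed.
Lemma sin_double t : sin (2 * t) = 2 * sin t * cos t.
Proof. by rewrite mulr_natl sin_mulr2n mulr_natl; ring. Qed.

Lemma speedE t : s t = Num.sqrt ((5 - 3 * zc t) / 2).
Proof. by rewrite /s; congr Num.sqrt; rewrite zc_sin; have := cos2Dsin2 t; lra. Qed.
Lemma zc_le1 t : `|zc t| <= 1.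
Proof. by rewrite ler_norml cos_geN1 cos_le1. Qed.
Lemma speed_sqr t : s t ^+ 2 = (5 - 3 * zc t) / 2.
Proof.
by rewrite speedE sqr_sqrtr//; have := zc_le1 t; rewrite ler_norml => /andP[_]; lra.
Qed.

Lemma is_derive_double t : is_derive t 1 (fun u : R => 2 * u) 2.
Proof. by apply: is_derive_eq; rewrite /GRing.scale/= mulr1. Qed.

Lemma is_derive_zc t : is_derive t 1 zc (- 2 * sin (2 * t)).
Proof.
have d := is_derive_double t.
by apply: is_derive_eq; rewrite mulrC mulNr mulrN.
Qed.

Lemma is_derive_sin_double t : is_derive t 1 (fun u : R => sin (2 * u)) (2 * zc t).
Proof.
have d := is_derive_double t.
by apply: is_derive_eq; rewrite mulrC.
Qed.

Lemma continuous_is_derive (f g : R -> R) :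
  (forall t, is_derive t 1 f (g t)) -> continuous f.
Proof.
move=> d t; apply: differentiable_continuous; apply/derivable1_diffP.
by have := d t => ?; exact: ex_derive.
Qed.

Lemma continuous_zc : continuous zc.
Proof. exact: continuous_is_derive is_derive_zc. Qed.

Definition speed_approx t := hornerZ speed_poly (zc t) / U.

(** Since [s >= 1] and the approximation [p] is nonnegative, [|s - p| <= |s^2 - p^2|]. The
    right-hand side is free of square roots: it is a polynomial in [z], up to scaling
    [res_speed]. *)
Lemma speed_approxP t : `|s t - speed_approx t| <= ZR 570 / U.
Proof.
have /andP[/Z.leb_le c1 /Z.leb_le c2] := res_speed_check.
move/(@ler_ZR R) : c1 => c1; move/(@ler_ZR R) : c2 => c2.
have U0 := @U_gt0 R.
have p0 : 0 <= speed_approx t.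
  rewrite divr_ge0 ?(ltW U0)//.
  have -> : hornerZ speed_poly (zc t) =
    ZR (head 0%ZZ speed_poly) + zc t * hornerZ (behead speed_poly) (zc t) by [].
  have := zc_le1 t; move: c2.
  have := hornerZ_le_l1 (behead speed_poly) (zc_le1 t).
  move: (hornerZ _ _) (ZR (l1 _)) (ZR (head _ _)) => h l a hl la z1.
  have : `|zc t * h| <= l by rewrite normrM -[leRHS]mul1r ler_pM.
  by rewrite ler_norml => /andP[] x1 x2; lra.
have s1 := ellipse_speed_ge1 t.
rewrite ler_pdivlMr//.
have e : `|s t - speed_approx t| * U * U <= `|(s t - speed_approx t) * (s t + speed_approx t)| * U ^+ 2.
  rewrite normrM expr2 mulrA ler_wpM2r ?(ltW U0)//.
  rewrite ler_wpM2r ?(ltW U0)// ler_peMr//.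
  by rewrite ger0_norm; lra.
have := hornerZ_le_cheb res_speed (2 * t); move/le_trans/(_ c1).
rewrite /res_speed /lsub hornerZ_add !hornerZ_scale hornerZ_mul.
have -> : hornerZ [:: 5 * bunit * bunit; -3 * bunit * bunit]%ZZ (cos (2 * t)) =
   ZR (5 * bunit * bunit)%ZZ + zc t * ZR (-3 * bunit * bunit)%ZZ :> R.
  by rewrite /= mulr0 addr0.
have z5 : ZR (5 * bunit * bunit)%ZZ = 5 * U ^+ 2 :> R.
  by rewrite UE expr2 mulrA -(ZR_nat 5) -2!ZRM.
have z3 : ZR (-3 * bunit * bunit)%ZZ = -3 * U ^+ 2 :> R.
  by rewrite UE expr2 mulrA -(ZR_nat 3) -ZRN -2!ZRM.
have z1 : ZR (2 * 570 * bunit)%ZZ = 2 * ZR 570 * U :> R.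
  by rewrite UE -ZR2 -2!ZRM.
rewrite z1 ZRN1 z3 z5 ZR2 -[cos (2 * t)]/(zc t).
have -> : hornerZ speed_poly (zc t) = speed_approx t * U.
  by rewrite /speed_approx divfK// gt_eqF.
rewrite (_ : _ + _ = - (2 * U ^+ 2 * ((s t - speed_approx t) * (s t + speed_approx t)))); last first.
  by rewrite -subr_sqr speed_sqr; field.
have U2 : 0 < 2 * U ^+ 2 by rewrite mulr_gt0// exprn_gt0.
rewrite normrN normrM (gtr0_norm U2) => h.
rewrite -(ler_pM2r U0); apply: le_trans e _; lra.
Qed.

Lemma continuous_pow_zc j : continuous (fun t => zc t ^+ j).
Proof.
move=> t; apply: (@continuous_comp _ _ _ zc (fun x : R => x ^+ j)).
  exact: continuous_zc.
exact: exprn_continuous.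
Qed.

Lemma continuous_M (f g : R -> R) : continuous f -> continuous g ->
  continuous (fun t => f t * g t).
Proof. by move=> cf cg t; apply: cvgM; [exact: cf|exact: cg]. Qed.
Lemma continuous_D (f g : R -> R) : continuous f -> continuous g ->
  continuous (fun t => f t + g t).
Proof. by move=> cf cg t; apply: cvgD; [exact: cf|exact: cg]. Qed.
Lemma continuous_B (f g : R -> R) : continuous f -> continuous g ->
  continuous (fun t => f t - g t).
Proof. by move=> cf cg t; apply: cvgB; [exact: cf|exact: cg]. Qed.
Lemma continuous_k (k : R) : continuous (fun _ : R => k).
Proof. by move=> t; exact: cvg_cst. Qed.

Definition moment j t : R := itg (fun u => zc u ^+ j * s u) 0 t.
Definition xmoment t : R := itg (fun u => 2 * cos u * s u) 0 t.
Definition ymoment t : R := itg (fun u => sin u * s u) 0 t.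

Lemma approx_prim (f g G : R -> R) e t : continuous f -> continuous g -> 0 <= t ->
  (forall u, is_derive u 1 G (g u)) -> (forall u, `|f u - g u| <= e) ->
  `|itg f 0 t - (G t - G 0)| <= e * t.
Proof.
move=> cf cg t0 dG fg; rewrite -(itg_FTC cg t0 (fun u _ => dG u)) -itgB//.
by rewrite -[X in _ <= _ * X](subr0 t) normr_itg_le//; exact: continuous_B.
Qed.

Definition gmoment j t : R :=
  (ZR (nth 0%ZZ prim_slope j) * t + sin (2 * t) * hornerZ (nth [::] prims j) (zc t)) / U.
Definition gxmoment t : R := sin t * hornerZ primX (zc t) / U.
Definition gymoment t : R := - (cos t * hornerZ primY (zc t)) / U.

Lemma is_derive_gmoment j t : is_derive t 1 (gmoment j)
  (hornerZ (dprim (nth 0%ZZ prim_slope j) (nth [::] prims j)) (zc t) / U).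
Proof.
have d1 := is_derive_hornerZ (nth [::] prims j) (is_derive_zc t).
have d2 := is_derive_sin_double t.
rewrite /gmoment; apply: is_derive_eq.
rewrite /dprim !hornerZ_add/= !hornerZ_scale ZR0 ZR2 ZRN2 /GRing.scale/=.
have e : sin (2 * t) ^+ 2 = 1 - zc t ^+ 2 by have := cos2Dsin2 (2 * t); rewrite -/(zc t); lra.
ring: e.
Qed.

Lemma is_derive_sin_hornerZ l t : is_derive t 1
  (fun u : R => sin u * hornerZ l (zc u) / U)
  (cos t * hornerZ (dprimX l) (zc t) / U).
Proof.
have d1 := is_derive_hornerZ l (is_derive_zc t).
apply: is_derive_eq.
rewrite /dprimX !hornerZ_add/= !hornerZ_scale ZR0 ZR2 ZRN2 /GRing.scale/= sin_double.
have e := zc_sin t.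
ring: e.
Qed.

Lemma is_derive_gxmoment t : is_derive t 1 gxmoment
  (cos t * hornerZ (dprimX primX) (zc t) / U).
Proof. exact: is_derive_sin_hornerZ. Qed.

Lemma is_derive_cos_hornerZ l t : is_derive t 1
  (fun u : R => - (cos u * hornerZ l (zc u)) / U)
  (sin t * hornerZ (dprimY l) (zc t) / U).
Proof.
have d1 := is_derive_hornerZ l (is_derive_zc t).
apply: is_derive_eq.
rewrite /dprimY !hornerZ_add/= !hornerZ_scale ZR0 ZR2 /GRing.scale/= sin_double.
have e := zc_cos t.
ring: e.
Qed.

Lemma is_derive_gymoment t : is_derive t 1 gymoment
  (sin t * hornerZ (dprimY primY) (zc t) / U).
Proof. exact: is_derive_cos_hornerZ. Qed.

Lemma continuous_hornerZ_zc l (f : R -> R) : continuous f ->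
  continuous (fun t => f t * hornerZ l (zc t) / U).
Proof.
move=> cf; apply: continuous_M; last exact: continuous_k.
apply: continuous_M => // t.
by apply: (@continuous_comp _ _ _ zc); [exact: continuous_zc|exact: continuous_hornerZ].
Qed.

Lemma res_le l t (k : Z) : Z.leb (cheb_norm l) k -> `|hornerZ l (zc t)| <= ZR k.
Proof.
by move=> /Z.leb_le/(@ler_ZR R); apply: le_trans; exact: hornerZ_le_cheb.
Qed.

Lemma hornerZ_sub l m (z : R) : hornerZ (lsub l m) z = hornerZ l z - hornerZ m z.
Proof. by rewrite hornerZ_add hornerZ_scale ZRN1 mulN1r. Qed.

Lemma hornerZ_ncons j l (z : R) : hornerZ (ncons j 0%ZZ l) z = z ^+ j * hornerZ l z.
Proof.
by elim: j => [|j IH] /=; rewrite ?mul1r// ZR0 add0r IH exprS mulrA.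
Qed.

Lemma moment_approx j t : (j < 4)%N -> 0 <= t -> `|moment j t - gmoment j t| <= ZR 580 / U * t.
Proof.
move=> j4 t0; have U0 := @U_gt0 R.
have -> : gmoment j t = gmoment j t - gmoment j 0.
  by rewrite {3}/gmoment mulr0 mulr0 sin0 mul0r addr0 mul0r subr0.
apply: (approx_prim _ _ t0 (is_derive_gmoment j)).
- apply: continuous_M; first exact: continuous_pow_zc.
  exact: continuous_ellipse_speed.
- have := @continuous_hornerZ_zc (dprim (nth 0%ZZ prim_slope j) (nth [::] prims j)) _ (@continuous_k 1).
  by under eq_fun do rewrite mul1r.
- move=> u; have /and3P[/allP/(_ j) r _ _] := res_prim_check.
  have {}r := @res_le _ u _ (r _); rewrite /res_prim hornerZ_sub hornerZ_ncons in r.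
  have {}r := r ltac:(by rewrite mem_iota).
  rewrite (_ : _ - _ = zc u ^+ j * (s u - speed_approx u) +
    (zc u ^+ j * hornerZ speed_poly (zc u) - hornerZ (dprim (nth 0%ZZ prim_slope j) (nth [::] prims j)) (zc u)) / U); last first.
    by rewrite /speed_approx; field; rewrite gt_eqF.
  apply: le_trans (ler_normD _ _) _.
  have -> : ZR 580 / U = ZR 570 / U + ZR 10 / U :> R by rewrite -mulrDl -ZRD.
  apply: lerD; last by rewrite normrM (gtr0_norm (_ : 0 < U^-1)) ?invr_gt0// ler_pM2r ?invr_gt0.
  rewrite normrM; apply: le_trans (speed_approxP u).
  by rewrite ler_piMl// normrX exprn_ile1// zc_le1.
Qed.

Lemma xmoment_approx t : 0 <= t -> `|xmoment t - gxmoment t| <= ZR 1280 / U * t.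
Proof.
move=> t0; have U0 := @U_gt0 R.
have -> : gxmoment t = gxmoment t - gxmoment 0.
  by rewrite {3}/gxmoment sin0 !mul0r subr0.
apply: (approx_prim _ _ t0 is_derive_gxmoment).
- apply: continuous_M; last exact: continuous_ellipse_speed.
  by apply: continuous_M; [exact: continuous_k|exact: continuous_cos].
- by apply: (@continuous_hornerZ_zc (dprimX primX)); exact: continuous_cos.
- move=> u; have /and3P[_ r _] := res_prim_check.
  have {}r := @res_le _ u _ r; rewrite hornerZ_sub hornerZ_scale ZR2 in r.
  rewrite (_ : _ - _ = cos u * (2 * (s u - speed_approx u)) + cos u *
    ((2 * hornerZ speed_poly (zc u) - hornerZ (dprimX primX) (zc u)) / U)); last first.
    by rewrite /speed_approx; field; rewrite gt_eqF.
  rewrite -mulrDr normrM.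
  have c1 : `|cos u| <= 1 by rewrite ler_norml cos_geN1 cos_le1.
  apply: le_trans (ler_piMl _ c1) _ => //.
  apply: le_trans (ler_normD _ _) _.
  have -> : ZR 1280 / U = 2 * (ZR 570 / U) + ZR 140 / U :> R.
    by rewrite mulrA -mulrDl -ZR2 -ZRM -ZRD.
  apply: lerD; last by rewrite normrM (gtr0_norm (_ : 0 < U^-1)) ?invr_gt0// ler_pM2r ?invr_gt0.
  by rewrite normrM ger0_norm// ler_pM2l// speed_approxP.
Qed.

Lemma ymoment_approx t : 0 <= t ->
  `|ymoment t - (gymoment t - gymoment 0)| <= ZR 610 / U * t.
Proof.
move=> t0; have U0 := @U_gt0 R.
apply: (approx_prim _ _ t0 is_derive_gymoment).
- apply: continuous_M; last exact: continuous_ellipse_speed.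
  exact: continuous_sin.
- by apply: (@continuous_hornerZ_zc (dprimY primY)); exact: continuous_sin.
- move=> u; have /and3P[_ _ r] := res_prim_check.
  have {}r := @res_le _ u _ r; rewrite hornerZ_sub in r.
  rewrite (_ : _ - _ = sin u * (s u - speed_approx u) + sin u *
    ((hornerZ speed_poly (zc u) - hornerZ (dprimY primY) (zc u)) / U)); last first.
    by rewrite /speed_approx; field; rewrite gt_eqF.
  rewrite -mulrDr normrM.
  have c1 : `|sin u| <= 1 by rewrite ler_norml sin_geN1 sin_le1.
  apply: le_trans (ler_piMl _ c1) _ => //.
  apply: le_trans (ler_normD _ _) _.
  have -> : ZR 610 / U = ZR 570 / U + ZR 40 / U :> R by rewrite -mulrDl -ZRD.
  apply: lerD; last by rewrite normrM (gtr0_norm (_ : 0 < U^-1)) ?invr_gt0// ler_pM2r ?invr_gt0.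
  exact: speed_approxP.
Qed.

End speed.

(** * Enclosures of [pi / 2] and of sines and cosines by bisection of angles *)

Definition half_angle (c : zball) : zball := bsqrt (bhalf (badd (bint 1) c)).

(* [chain n c] encloses the factors [1 / (2 cos (x / 2 ^ (k + 1)))], [k < n],
   if [c] encloses [cos x]. *)
Fixpoint chain n (c : zball) : seq zball :=
  if n is n'.+1 then
    let c' := half_angle c in bhalf (binv c') :: chain n' c'
  else [::].
Fixpoint chain_ok n (c : zball) : bool :=
  if n is n'.+1 then
    let c' := half_angle c in
    [&& Z.leb (bhalf (badd (bint 1) c)).2 (bhalf (badd (bint 1) c)).1,
        Z.ltb c'.2 c'.1 & chain_ok n' c']
  else true.
(** The start is the exact value [cos (pi / 2) = 0]. A factor depends only on the depth of the
    bisection, so it serves all midpoints of that depth. *)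
Definition bisect_factors : seq zball := Eval vm_compute in chain 34 (0, 0)%ZZ.
Lemma bisect_factorsE :
  bisect_factors = chain 34 (0, 0)%ZZ /\ chain_ok 34 (0, 0)%ZZ.
Proof. by vm_compute. Qed.

(* Viete's product [pi / 2 = prod_k 1 / cos (pi / 2 ^ (k + 1))], stopped after
   [n] factors. *)
Definition viete n : zball :=
  foldl (fun p f => bmul p (bscale 2 f)) (bint 1) (take n bisect_factors).
(** The truncated product is [2^n sin x] with [x = (pi / 2) / 2^n]. By [x cos x <= sin x <= x], the
    number [pi / 2] lies between this product and its quotient by [cos x]. *)
Definition bhalfpi : zball := Eval vm_compute in
  bhull (viete 24) (bmul (viete 24) (bscale 2 (nth (0, 0)%ZZ bisect_factors 23))).
Lemma bhalfpiE : bhalfpi =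
  bhull (viete 24) (bmul (viete 24) (bscale 2 (nth (0, 0)%ZZ bisect_factors 23))).
Proof. by vm_compute. Qed.

Record node := Node { nth_ : zball; ncos : zball; nsin : zball }.
(** Sum-to-product formulas: [cos t + cos u] is [2 cos ((u - t) / 2)] times the cosine of the
    midpoint, and the same factor serves for sines. So a midpoint costs two multiplications by [f]
    and no square root. *)
Definition nmid (f : zball) (a b : node) : node :=
  Node (bhalf (badd (nth_ a) (nth_ b))) (bmul f (badd (ncos a) (ncos b)))
       (bmul f (badd (nsin a) (nsin b))).
Definition node0 : node := Node (0, 0)%ZZ (bint 1) (0, 0)%ZZ.
Definition nodeq : node := Node bhalfpi (0, 0)%ZZ (bint 1).

Definition nzc (n : node) : zball := bsub (bscale 2 (bmul (ncos n) (ncos n))) (bint 1).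
(** The widening is the error [580 t] of the primitive for [t <= 2], which covers [[0, pi / 2]]; the
    constants 2560 and 1220 below arise in the same way from 1280 and 610. *)
Definition bmoment (n : node) (z : zball) (j : nat) : zball :=
  bwiden 1160 (badd (bmul (bcst (nth 0%ZZ prim_slope j)) (nth_ n))
    (bmul (bscale 2 (bmul (nsin n) (ncos n))) (hornerB (nth [::] prims j) z))).
Definition bxmoment (n : node) (z : zball) : zball :=
  bwiden 2560 (bmul (nsin n) (hornerB primX z)).
Definition bymoment (n : node) (z : zball) : zball :=
  bwiden 1220 (bsub (hornerB primY (bint 1)) (bmul (ncos n) (hornerB primY z))).

Section nodes.
Context {R : realType}.
Implicit Types (t u x : R).
Local Notation U := (@scale R).
Local Notation q := (pi / 2 : R).

Lemma q_gt0 : 0 < q. Proof. by rewrite divr_gt0// pi_gt0. Qed.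
Lemma q_lt2 : q < 2. Proof. by have := @pihalf_lt2 R. Qed.

Lemma cos_ge0q x : 0 <= x <= q -> 0 <= cos x.
Proof. by move=> /andP[? ?]; apply: cos_ge0_pihalf; have := q_gt0; lra. Qed.
Lemma cos_gt0q x : 0 <= x < q -> 0 < cos x.
Proof. by move=> /andP[? ?]; apply: cos_gt0_pihalf; have := q_gt0; lra. Qed.
Lemma sin_ge0q x : 0 <= x <= q -> 0 <= sin x.
Proof. by move=> /andP[? ?]; apply: sin_ge0_pi; have := q_gt0; lra. Qed.

Lemma cos_half x : 0 <= x <= q -> cos (x / 2) = Num.sqrt ((1 + cos x) / 2).
Proof.
move=> /andP[x0 xq]; have c0 : 0 <= cos (x / 2).
  by apply: cos_ge0q; have := q_gt0; lra.
have -> : (1 + cos x) / 2 = cos (x / 2) ^+ 2.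
  have -> : cos x = cos ((x / 2) *+ 2) by congr cos; rewrite -mulr_natr; lra.
  by rewrite cos_mulr2n -mulr_natl; lra.
by rewrite sqrtr_sqr ger0_norm.
Qed.

Lemma inb_chain n c x k : 0 <= x <= q -> inb c (cos x) -> chain_ok n c -> (k < n)%N ->
  inb (nth (0, 0)%ZZ (chain n c) k) (2 * cos (x / 2 ^+ k.+1))^-1.
Proof.
elim: n c x k => [//|n IH] c x k /andP[x0 xq] cx; cbn [chain chain_ok].
move=> /and3P[k1 k2 ok] kn.
have cx' : inb (half_angle c) (cos (x / 2)).
  rewrite cos_half; last by rewrite x0.
  apply: inb_sqrt k1 _; apply: inb_half; apply: inb_add => //.
  by rewrite -[X in inb _ X]ZR1; exact: inb_int.
have [xp xi] := inb_inv k2 cx'.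
case: k kn => [|k] kn.
  by rewrite /= expr1 invfM mulrC; exact: inb_half.
rewrite [nth _ _ _]/=.
have -> : x / 2 ^+ k.+2 = x / 2 / 2 ^+ k.+1 by rewrite exprS invfM mulrA.
by apply: IH => //; lra.
Qed.

Lemma inb00 : inb (0, 0)%ZZ (0 : R).
Proof. by rewrite /inb /= mul0r ZR0 subrr normr0. Qed.

Lemma inb1 : inb (bint 1) (1 : R).
Proof. by rewrite -[X in inb _ X]ZR1; exact: inb_int. Qed.

Lemma inb_factor k : (k < 34)%N ->
  inb (nth (0, 0)%ZZ bisect_factors k) (2 * cos (q / 2 ^+ k.+1))^-1.
Proof.
move=> k34; have [E ok] := bisect_factorsE.
have c0 : inb (0, 0)%ZZ (cos q) by rewrite cos_pihalf; exact: inb00.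
have q0 : 0 <= q <= q by rewrite lexx (ltW q_gt0).
by rewrite E; exact: (inb_chain q0 c0 ok k34).
Qed.

Lemma cos_dyadic_gt0 k : 0 < cos (q / 2 ^+ k.+1).
Proof.
have q0 := q_gt0.
apply: cos_gt0q; rewrite divr_ge0 ?exprn_ge0 ?ltW//=.
by rewrite ltr_pdivrMr ?exprn_gt0// ltr_pMr// exprn_egt1// ltr1n.
Qed.

Lemma inb_viete n : (n <= 34)%N -> inb (viete n) (2 ^+ n * sin (q / 2 ^+ n)).
Proof.
elim: n => [|n IH] n34.
  by rewrite /viete take0 /= expr0 mul1r divr1 sin_pihalf; exact: inb1.
rewrite /viete (take_nth (0, 0)%ZZ); last by have -> : size bisect_factors = 34%N by [].
rewrite -cats1 foldl_cat.
have c0 := cos_dyadic_gt0 n.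
have -> : 2 ^+ n.+1 * sin (q / 2 ^+ n.+1) =
   2 ^+ n * sin (q / 2 ^+ n) * (ZR 2 * (2 * cos (q / 2 ^+ n.+1))^-1).
  have -> : sin (q / 2 ^+ n) = 2 * sin (q / 2 ^+ n.+1) * cos (q / 2 ^+ n.+1).
    by rewrite -sin_double; congr sin; rewrite exprS; field; rewrite expf_neq0.
  move: (cos _) (sin _) c0 => c s c0.
  by rewrite ZR2 exprS; field; rewrite gt_eqF.
apply: inb_mul; first by apply: IH; lia.
by apply: inb_scale; exact: inb_factor.
Qed.

Lemma sin_bounds x : 0 <= x <= q -> x * cos x <= sin x <= x.
Proof.
move=> /andP[x0 xq]; apply/andP; split.
- have d u : 0 <= u <= x -> is_derive u 1 (fun u : R => sin u - u * cos u) (u * sin u).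
    by move=> _; apply: is_derive_eq; rewrite /GRing.scale/=; ring.
  have := nondecreasing_is_derive x0 d; rewrite sin0 mul0r subrr subr_ge0; apply.
  by move=> u /andP[u0 ux]; apply: mulr_ge0; [exact: ltW|apply: sin_ge0q; lra].
- have d u : 0 <= u <= x -> is_derive u 1 (fun u : R => u - sin u) (1 - cos u).
    by move=> _; apply: is_derive_eq.
  have := nondecreasing_is_derive x0 d; rewrite sin0 subrr subr_ge0; apply.
  by move=> u _; rewrite subr_ge0 cos_le1.
Qed.

Lemma inb_halfpi : inb bhalfpi q.
Proof.
have q0 := q_gt0.
rewrite bhalfpiE; have v := @inb_viete 24 isT.
have c0 := cos_dyadic_gt0 23.
apply: (inb_hull v (inb_mul v (inb_scale 2 (@inb_factor 23 isT)))).
have p0 : 0 < 2 ^+ 24 :> R by rewrite exprn_gt0.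
have h0 : 0 <= q / 2 ^+ 24 <= q.
  apply/andP; split; first by apply: divr_ge0; exact: ltW.
  by rewrite ler_pdivrMr// ler_pMr// exprn_ege1// ler1n.
have /andP[s1 s2] := sin_bounds h0.
have e : 2 ^+ 24 * (q / 2 ^+ 24) = q by rewrite mulrC divfK// gt_eqF.
have {s2} : 2 ^+ 24 * sin (q / 2 ^+ 24) <= q by rewrite -[leRHS]e ler_pM2l.
have {s1} : q <= 2 ^+ 24 * sin (q / 2 ^+ 24) * (cos (q / 2 ^+ 24))^-1.
  by rewrite -[leLHS]e -[leRHS]mulrA ler_pM2l// ler_pdivlMr.
move: c0; move: (cos _) (2 ^+ 24 * _) => c v' c0 h1 h2.
rewrite h2 (le_trans h1)// ZR2 invfM mulrA; lra.
Qed.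

Definition node_at (n : node) t : Prop :=
  [/\ inb (nth_ n) t, inb (ncos n) (cos t) & inb (nsin n) (sin t)].

Lemma node0P : node_at node0 0.
Proof. by split; rewrite /= ?cos0 ?sin0; [exact: inb00|exact: inb1|exact: inb00]. Qed.
Lemma nodeqP : node_at nodeq q.
Proof.
by split; rewrite /= ?cos_pihalf ?sin_pihalf; [exact: inb_halfpi|exact: inb00|exact: inb1].
Qed.

Lemma nmidP f a b t u : node_at a t -> node_at b u -> cos ((u - t) / 2) != 0 ->
  inb f (2 * cos ((u - t) / 2))^-1 -> node_at (nmid f a b) ((t + u) / 2).
Proof.
move=> [at_ ac as_] [bt bc bs] c0 fx; split; rewrite /=.
- exact/inb_half/inb_add.
- have -> : cos ((t + u) / 2) = (2 * cos ((u - t) / 2))^-1 * (cos t + cos u).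
    have -> : cos t = cos ((t + u) / 2 - (u - t) / 2) by congr cos; lra.
    have -> : cos u = cos ((t + u) / 2 + (u - t) / 2) by congr cos; lra.
    by rewrite cosB cosD; field.
  by apply: inb_mul => //; exact: inb_add.
- have -> : sin ((t + u) / 2) = (2 * cos ((u - t) / 2))^-1 * (sin t + sin u).
    have -> : sin t = sin ((t + u) / 2 - (u - t) / 2) by congr sin; lra.
    have -> : sin u = sin ((t + u) / 2 + (u - t) / 2) by congr sin; lra.
    by rewrite sinB sinD; field.
  by apply: inb_mul => //; exact: inb_add.
Qed.

Lemma inb_nzc n t : node_at n t -> inb (nzc n) (zc t).
Proof.
move=> [_ c _]; rewrite zc_cos -ZR2; apply: inb_sub; last exact: inb1.
by apply: inb_scale; rewrite expr2; exact: inb_mul.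
Qed.

Lemma inb_bmoment n t j : (j < 4)%N -> 0 <= t <= 2 -> node_at n t ->
  inb (bmoment n (nzc n) j) (moment j t).
Proof.
move=> j4 /andP[t0 t2] nt; have U0 := @U_gt0 R.
apply: (@inb_widen _ _ _ (gmoment j t)); last first.
  rewrite -ler_pdivlMr//; apply: le_trans (moment_approx j4 t0) _.
  rewrite mulrAC ler_pM2r ?invr_gt0//.
  have -> : ZR 1160 = ZR 580 * 2 :> R by rewrite -ZR2 -ZRM.
  by rewrite ler_pM2l// -ZR0; apply: ltr_ZR.
have z := inb_nzc nt; case: nt => nt c s.
rewrite /gmoment mulrDl; apply: inb_add.
  by rewrite mulrAC; apply: inb_mul => //; exact: inb_cst.
rewrite -mulrA; apply: inb_mul; last exact: inb_hornerB.
by rewrite sin_double -mulrA -ZR2; apply: inb_scale; exact: inb_mul.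
Qed.

Lemma inb_bxmoment n t : 0 <= t <= 2 -> node_at n t ->
  inb (bxmoment n (nzc n)) (xmoment t).
Proof.
move=> /andP[t0 t2] nt; have U0 := @U_gt0 R.
apply: (@inb_widen _ _ _ (gxmoment t)); last first.
  rewrite -ler_pdivlMr//; apply: le_trans (xmoment_approx t0) _.
  rewrite mulrAC ler_pM2r ?invr_gt0//.
  have -> : ZR 2560 = ZR 1280 * 2 :> R by rewrite -ZR2 -ZRM.
  by rewrite ler_pM2l// -ZR0; apply: ltr_ZR.
have z := inb_nzc nt; case: nt => nt c s.
rewrite /gxmoment -mulrA; apply: inb_mul => //; exact: inb_hornerB.
Qed.

Lemma inb_bymoment n t : 0 <= t <= 2 -> node_at n t ->
  inb (bymoment n (nzc n)) (ymoment t).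
Proof.
move=> /andP[t0 t2] nt; have U0 := @U_gt0 R.
apply: (@inb_widen _ _ _ (gymoment t - gymoment 0)); last first.
  rewrite -ler_pdivlMr//; apply: le_trans (ymoment_approx t0) _.
  rewrite mulrAC ler_pM2r ?invr_gt0//.
  have -> : ZR 1220 = ZR 610 * 2 :> R by rewrite -ZR2 -ZRM.
  by rewrite ler_pM2l// -ZR0; apply: ltr_ZR.
have z := inb_nzc nt; case: nt => nt c s.
have -> : gymoment t - gymoment 0 =
  hornerZ primY 1 / U - cos t * (hornerZ primY (zc t) / U).
  by rewrite /gymoment /zc mulr0 cos0 mul1r; lra.
apply: inb_sub; first by apply: inb_hornerB; exact: inb1.
apply: inb_mul => //; exact: inb_hornerB.
Qed.

End nodes.

(** * The boundary angle of the cells and the centroids *)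

Fixpoint descend (fs : seq zball) (bits : seq bool) (a b : node) : node * node :=
  match bits, fs with
  | bit :: bits', f :: fs' =>
    let m := nmid f a b in
    if bit then descend fs' bits' m b else descend fs' bits' a m
  | _, _ => (a, b)
  end.

Definition bdiv (a b : zball) : zball := bmul a (binv b).

(* The first 34 binary digits of [t / (pi / 2)], where the arc [[- t, t]] is the
   cell of the point on the major axis. *)
Definition cut_bits : seq bool :=
  [seq odd k | k <- [:: 0; 1; 1; 1; 1; 0; 0; 1; 1; 0; 0; 0; 0; 1; 0; 1; 1;
    0; 0; 0; 0; 0; 1; 0; 1; 1; 0; 0; 1; 0; 0; 1; 1; 0]]%N.

Definition M0q : zball := Eval vm_compute in bmoment nodeq (nzc nodeq) 0.
Definition M1q : zball := Eval vm_compute in bmoment nodeq (nzc nodeq) 1.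
Definition M2q : zball := Eval vm_compute in bmoment nodeq (nzc nodeq) 2.
Definition M3q : zball := Eval vm_compute in bmoment nodeq (nzc nodeq) 3.
Definition Xq : zball := Eval vm_compute in bxmoment nodeq (nzc nodeq).
Definition Yq : zball := Eval vm_compute in bymoment nodeq (nzc nodeq).

(** The centroid of the arc [[-t, t]] is [(cA, 0)], by symmetry; that of the arc [[t, pi / 2]] is
    [(cB1, cB2)]. *)
Definition bcA (n : node) : zball :=
  let z := nzc n in bdiv (bxmoment n z) (bmoment n z 0).
Definition bcB1 (n : node) : zball :=
  let z := nzc n in bdiv (bsub Xq (bxmoment n z)) (bsub M0q (bmoment n z 0)).
Definition bcB2 (n : node) : zball :=
  let z := nzc n in bdiv (bsub Yq (bymoment n z)) (bsub M0q (bmoment n z 0)).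
Definition bsqr (a : zball) : zball := bmul a a.
(** The difference [|x - A|^2 - |x - B|^2] of the squared distances from the curve point [x] at
    angle [t] to the two centroids [A] and [B]. A zero is an angle at which the cells and their
    centroids are consistent. *)
Definition bgap (n : node) : zball :=
  let a := bcA n in let b1 := bcB1 n in let b2 := bcB2 n in
  badd (badd (bsub (bsqr a) (badd (bsqr b1) (bsqr b2)))
    (bscale 4 (bmul (bsub b1 a) (ncos n)))) (bscale 2 (bmul b2 (nsin n))).

Definition cut_ends : node * node := Eval vm_compute in
  descend bisect_factors cut_bits node0 nodeq.
(** The arguments are swapped for the cosine because it decreases and [bhull] wants the smaller end
    first. *)
Definition nhull (a b : node) : node :=
  Node (bhull (nth_ a) (nth_ b)) (bhull (ncos b) (ncos a)) (bhull (nsin a) (nsin b)).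
Definition ncut : node := Eval vm_compute in nhull cut_ends.1 cut_ends.2.

(* The free coefficient of [v], close to [0.12]. *)
Definition kz : Z := 540431955284460.
Definition bM0 := Eval vm_compute in bmoment ncut (nzc ncut) 0.
Definition bM1 := Eval vm_compute in bmoment ncut (nzc ncut) 1.
Definition bM2 := Eval vm_compute in bmoment ncut (nzc ncut) 2.
Definition bM3 := Eval vm_compute in bmoment ncut (nzc ncut) 3.
Definition b_cA := Eval vm_compute in bcA ncut.
Definition b_cB1 := Eval vm_compute in bcB1 ncut.
Definition b_cB2 := Eval vm_compute in bcB2 ncut.
Definition b_mB := Eval vm_compute in bsub M0q bM0.
Definition b_zt := Eval vm_compute in nzc ncut.
Definition b_d2 := Eval vm_compute in badd (bsqr b_cB1) (bsqr (bsub (bint 1) b_cB2)).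
Definition b_vt := Eval vm_compute in
  badd (bsqr (bsub (bscale 2 (ncos ncut)) b_cA)) (bsqr (nsin ncut)).
Definition b_al := Eval vm_compute in bdiv (bsub b_vt b_d2) (badd (bint 1) b_zt).
Definition comb4 (c0 c1 c2 c3 m0 m1 m2 m3 : zball) :=
  badd (badd (bmul c0 m0) (bmul c1 m1)) (badd (bmul c2 m2) (bmul c3 m3)).
Definition comb3 (c0 c1 m0 m1 m2 : zball) := badd (badd (bmul c0 m0) (bmul c1 m1)) m2.
Definition b_w00 := Eval vm_compute in bsub (badd b_d2 b_al) (bhalf (bint 5)).
Definition b_w01 := Eval vm_compute in
  bsub (bsub b_al (bmul (bcst kz) b_zt)) (bhalf (bint 3)).
Definition b_w02 := Eval vm_compute in bmul (bcst kz) (bsub (bint 1) b_zt).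
Definition b_SA0 := Eval vm_compute in
  comb4 b_w00 b_w01 b_w02 (bcst kz) bM0 bM1 bM2 bM3.
Definition b_SB0 := Eval vm_compute in
  comb4 b_w00 b_w01 b_w02 (bcst kz) (bsub M0q bM0) (bsub M1q bM1) (bsub M2q bM2)
    (bsub M3q bM3).
Definition b_SA1 := Eval vm_compute in
  comb3 (bopp b_zt) (bsub (bint 1) b_zt) bM0 bM1 bM2.
Definition b_SB1 := Eval vm_compute in
  comb3 (bopp b_zt) (bsub (bint 1) b_zt) (bsub M0q bM0) (bsub M1q bM1) (bsub M2q bM2).
Definition b_be := Eval vm_compute in
  bdiv (bsub (badd b_SB0 (bmul (badd (bsqr b_cB1) (bsqr b_cB2)) b_mB))
             (bscale 2 (badd b_SA0 (bmul (bsqr b_cA) bM0))))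
       (bsub (bscale 2 b_SA1) b_SB1).
Definition b_K := Eval vm_compute in
  bscale 2 (badd (badd b_SA0 (bmul b_be b_SA1)) (bmul (bsqr b_cA) bM0)).
Definition b_w0 := Eval vm_compute in bsub b_w00 (bmul b_be b_zt).
Definition b_w1 := Eval vm_compute in badd b_w01 (bmul b_be (bsub (bint 1) b_zt)).
Definition b_w2 := Eval vm_compute in badd b_w02 b_be.

(** The constants above are stored in evaluated form; computation ties them back to their formulas.
    The last two conjuncts are the change of sign of [gap] between the ends of the bracket. *)
Lemma numericsE :
  (M0q = bmoment nodeq (nzc nodeq) 0 /\ M1q = bmoment nodeq (nzc nodeq) 1 /\
   M2q = bmoment nodeq (nzc nodeq) 2 /\ M3q = bmoment nodeq (nzc nodeq) 3 /\
   Xq = bxmoment nodeq (nzc nodeq) /\ Yq = bymoment nodeq (nzc nodeq)) /\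
  (cut_ends = descend bisect_factors cut_bits node0 nodeq /\
   ncut = nhull cut_ends.1 cut_ends.2 /\
   Z.ltb (bgap cut_ends.1).2 (- (bgap cut_ends.1).1) /\
   Z.ltb (bgap cut_ends.2).2 (bgap cut_ends.2).1).
Proof. by vm_compute. Qed.

Lemma moments_cutE :
  bM0 = bmoment ncut (nzc ncut) 0 /\ bM1 = bmoment ncut (nzc ncut) 1 /\
  bM2 = bmoment ncut (nzc ncut) 2 /\ bM3 = bmoment ncut (nzc ncut) 3 /\
  b_cA = bcA ncut /\ b_cB1 = bcB1 ncut /\ b_cB2 = bcB2 ncut /\
  b_mB = bsub M0q bM0 /\ b_zt = nzc ncut.
Proof. by vm_compute. Qed.

(* All the balls that are divided by are positive. *)
Definition positive (b : zball) : bool := Z.ltb b.2 b.1.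
Lemma denominators_check :
  [&& positive (bmoment ncut (nzc ncut) 0),
      positive (bsub M0q (bmoment ncut (nzc ncut) 0)),
      positive (badd (bint 1) b_zt) & positive (bsub (bscale 2 b_SA1) b_SB1)].
Proof. by vm_compute. Qed.
Lemma cut_ends_denominators :
  [/\ positive (bmoment cut_ends.1 (nzc cut_ends.1) 0),
      positive (bsub M0q (bmoment cut_ends.1 (nzc cut_ends.1) 0)),
      positive (bmoment cut_ends.2 (nzc cut_ends.2) 0) &
      positive (bsub M0q (bmoment cut_ends.2 (nzc cut_ends.2) 0))].
Proof. by vm_compute. Qed.
Lemma cut_ends_check : positive (nth_ cut_ends.1) && positive (ncos cut_ends.2).
Proof. by vm_compute. Qed.

Section cut.
Context {R : realType}.
Implicit Types (t u x : R).
Local Notation U := (@scale R).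
Local Notation q := (pi / 2 : R).
Local Notation s := (@ellipse_speed R).

Lemma descendP k bits a b t u : (k + size bits <= 34)%N ->
  node_at a t -> node_at b u -> u - t = q / 2 ^+ k ->
  let d := descend (drop k bisect_factors) bits a b in
  exists t' u', [/\ node_at d.1 t', node_at d.2 u', u' - t' = q / 2 ^+ (k + size bits),
    t <= t' & u' <= u].
Proof.
elim: bits k a b t u => [|c bits IH] k a b t u kb at_ bu tu /=.
  by exists t, u; rewrite addn0; case: drop.
have k34 : (k < 34)%N by move: kb => /=; lia.
have p0 : 0 < 2 ^+ k :> R by rewrite exprn_gt0.
rewrite (drop_nth (0, 0)%ZZ) //.
have h : (u - t) / 2 = q / 2 ^+ k.+1.
  by rewrite tu exprS; move: (2 ^+ k) p0 => y y0; field; rewrite gt_eqF.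
have c0 : cos ((u - t) / 2) != 0 by rewrite h gt_eqF// cos_dyadic_gt0.
have f := @inb_factor R k k34; rewrite -h in f.
have m := nmidP at_ bu c0 f.
have q0 : 0 < q / 2 ^+ k.+1 by rewrite divr_gt0 ?q_gt0 ?exprn_gt0.
have kb' : (k.+1 + size bits <= 34)%N by move: kb => /=; lia.
clear kb; case: c.
- have [|t' [u' [? ? ? ? ?]]] := IH k.+1 _ _ _ _ kb' m bu; first by rewrite -h; lra.
  by exists t', u'; rewrite addnS; split=> //; lra.
- have [|t' [u' [? ? ? ? ?]]] := IH k.+1 _ _ _ _ kb' at_ m; first by rewrite -h; lra.
  by exists t', u'; rewrite addnS; split=> //; lra.
Qed.

Lemma continuous_pow_speed j : continuous (fun t : R => zc t ^+ j * s t).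
Proof. by apply: continuous_M; [exact: continuous_pow_zc|exact: continuous_ellipse_speed]. Qed.
Lemma continuous_cos_speed : continuous (fun t : R => 2 * cos t * s t).
Proof.
apply: continuous_M; last exact: continuous_ellipse_speed.
by apply: continuous_M; [exact: continuous_k|exact: continuous_cos].
Qed.
Lemma continuous_sin_speed : continuous (fun t : R => sin t * s t).
Proof. by apply: continuous_M; [exact: continuous_sin|exact: continuous_ellipse_speed]. Qed.

Lemma within_continuous_itg (f : R -> R) a b : continuous f -> 0 <= a -> 
  {within `[a, b], continuous (fun t => itg f 0 t)}.
Proof.
move=> cf a0; have [ab|ba] := leP a b; last by rewrite set_itv_ge ?bnd_simp -?ltNge//; exact: continuous_subspace0.
have b0 : 0 <= b by apply: le_trans ab.
have := parameterized_integral_continuous b0 (cont_integrable 0 b cf).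
by apply: continuous_subspaceW; apply: subset_itvr; rewrite bnd_simp.
Qed.

Lemma moment0_ge t u : t <= u -> u - t <= itg s t u.
Proof.
move=> tu; rewrite -[leLHS]mul1r -itg_cst//; apply: le_itg.
- exact: continuous_k.
- exact: continuous_ellipse_speed.
- by move=> x _; exact: ellipse_speed_ge1.
Qed.

Lemma moment0E t : moment 0 t = itg s 0 t.
Proof. by apply: eq_itg => x _; rewrite mul1r. Qed.

Lemma moment0_gt0 t : 0 < t -> 0 < moment 0 t.
Proof.
by move=> t0; rewrite moment0E; apply: lt_le_trans (moment0_ge (ltW t0)); lra.
Qed.

Lemma moment0_lt t u : 0 <= t -> t < u -> 0 < moment 0 u - moment 0 t.
Proof.
move=> t0 tu; rewrite !moment0E (itg_chasles (@continuous_ellipse_speed R) t0 (ltW tu)).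
by rewrite addrAC subrr add0r; apply: lt_le_trans (moment0_ge (ltW tu)); lra.
Qed.

Definition cA t : R := xmoment t / moment 0 t.
Definition cB1 t : R := (xmoment q - xmoment t) / (moment 0 q - moment 0 t).
Definition cB2 t : R := (ymoment q - ymoment t) / (moment 0 q - moment 0 t).
Definition gap t : R := cA t ^+ 2 - (cB1 t ^+ 2 + cB2 t ^+ 2)
  + 4 * ((cB1 t - cA t) * cos t) + 2 * (cB2 t * sin t).

Lemma within_continuous_gap a b : 0 < a -> b < q ->
  {within `[a, b], continuous gap}.
Proof.
move=> a0 bq.
have C (f : R -> R) x : continuous f -> `[a, b]%classic x ->
    f y @[y --> within `[a, b] (nbhs x)] --> f x.
  move=> cf xab; have /subspace_continuousP := continuous_subspaceT (A := `[a, b]) cf.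
  exact.
have W (f : R -> R) x : continuous f -> `[a, b]%classic x ->
    itg f 0 y @[y --> within `[a, b] (nbhs x)] --> itg f 0 x.
  move=> cf xab; have /subspace_continuousP := within_continuous_itg (b := b) cf (ltW a0).
  exact.
apply/subspace_continuousP => x xab.
have /andP[ax xb] : a <= x <= b by move: xab; rewrite /= in_itv.
have x0 : 0 < x by lra.
have M1 := moment0_gt0 x0.
have M2 := moment0_lt (ltW x0) (le_lt_trans xb bq).
have cM := W _ x (@continuous_pow_speed 0) xab.
have cX := W _ x continuous_cos_speed xab; have cY := W _ x continuous_sin_speed xab.
have cc := C _ x (@continuous_cos R) xab; have cs := C _ x (@continuous_sin R) xab.
have ccA : cA y @[y --> within `[a, b] (nbhs x)] --> cA x.
  by apply: cvgM => //; apply: cvgV => //; rewrite gt_eqF.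
have cqB : (moment 0 q - moment 0 y)^-1 @[y --> within `[a, b] (nbhs x)] -->
    (moment 0 q - moment 0 x)^-1.
  apply: cvgV; first by rewrite gt_eqF.
  by apply: cvgB => //; exact: cvg_cst.
have ccB1 : cB1 y @[y --> within `[a, b] (nbhs x)] --> cB1 x.
  by apply: cvgM => //; apply: cvgB => //; exact: cvg_cst.
have ccB2 : cB2 y @[y --> within `[a, b] (nbhs x)] --> cB2 x.
  by apply: cvgM => //; apply: cvgB => //; exact: cvg_cst.
rewrite /gap; apply: cvgD; last first.
  by apply: cvgM; [exact: cvg_cst|exact: cvgM].
apply: cvgD; last first.
  by apply: cvgM; [exact: cvg_cst|apply: cvgM => //; exact: cvgB].
apply: cvgB; first by rewrite expr2; apply: cvgM.
by apply: cvgD; rewrite expr2; apply: cvgM.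
Qed.

Lemma inb_div (a b : zball) x y : inb a x -> inb b y -> positive b ->
  inb (bdiv a b) (x / y).
Proof. by move=> ax b_y pb; have [_ iy] := inb_inv pb b_y; exact: inb_mul. Qed.
Lemma inb_sqr (a : zball) x : inb a x -> inb (bsqr a) (x ^+ 2).
Proof. by move=> ax; rewrite expr2; exact: inb_mul. Qed.

Lemma q02 : 0 <= q <= 2. Proof. by have := @q_gt0 R; have := @q_lt2 R; lra. Qed.

Lemma inb_moments_q :
  [/\ inb M0q (moment 0 q), inb M1q (moment 1 q), inb M2q (moment 2 q),
      inb M3q (moment 3 q) & inb Xq (xmoment q) /\ inb Yq (ymoment q)].
Proof.
have [[-> [-> [-> [-> [-> ->]]]]] _] := numericsE.
have nq := @nodeqP R; have q2 := q02.
by split; [exact: inb_bmoment..|split; [exact: inb_bxmoment|exact: inb_bymoment]].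
Qed.

Section gap_node.
Context (n : node) (t : R).
Context (nt : node_at n t) (t02 : 0 <= t <= 2).
Context (p1 : positive (bmoment n (nzc n) 0)).
Context (p2 : positive (bsub M0q (bmoment n (nzc n) 0))).

Lemma inb_cA : inb (bcA n) (cA t).
Proof. by apply: inb_div => //; [exact: inb_bxmoment|exact: inb_bmoment]. Qed.
Lemma inb_cB1 : inb (bcB1 n) (cB1 t).
Proof.
have [m0 _ _ _ [x y]] := inb_moments_q.
apply: inb_div => //; apply: inb_sub => //; first exact: inb_bxmoment.
exact: inb_bmoment.
Qed.
Lemma inb_cB2 : inb (bcB2 n) (cB2 t).
Proof.
have [m0 _ _ _ [x y]] := inb_moments_q.
apply: inb_div => //; apply: inb_sub => //; first exact: inb_bymoment.
exact: inb_bmoment.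
Qed.
Lemma inb_gap : inb (bgap n) (gap t).
Proof.
have a := inb_cA; have b1 := inb_cB1; have b2 := inb_cB2.
have [_ c s'] := nt.
apply: inb_add; first apply: inb_add.
- by apply: inb_sub; [exact: inb_sqr|apply: inb_add; exact: inb_sqr].
- have -> : 4 = ZR 4 :> R by rewrite -(ZR_nat 4).
  by apply: inb_scale; apply: inb_mul => //; exact: inb_sub.
- by rewrite -ZR2; apply: inb_scale; exact: inb_mul.
Qed.
End gap_node.

Lemma nhullP a b t u x : node_at a t -> node_at b u -> 0 <= t -> t <= x <= u -> u <= q ->
  node_at (nhull a b) x.
Proof.
move=> [a1 a2 a3] [b1 b2 b3] t0 /andP[tx xu] uq; have q0 := @q_gt0 R.
have I y : 0 <= y <= q -> y \in `[0, pi].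
  by rewrite in_itv/= => /andP[? ?]; lra.
have J y : 0 <= y <= q -> y \in `[(- q), q].
  by rewrite in_itv/= => /andP[? ?]; lra.
have ti : 0 <= t <= q by lra.
have ui : 0 <= u <= q by lra.
have xi : 0 <= x <= q by lra.
split.
- by apply: inb_hull a1 b1 _; rewrite tx.
- apply: inb_hull b2 a2 _; rewrite !leNgt !(@ltr_cos R) ?I// -!leNgt.
  by rewrite tx xu.
- apply: inb_hull a3 b3 _; rewrite !leNgt !(@ltr_sin R) ?J// -!leNgt.
  by rewrite tx xu.
Qed.

Lemma cut_exists : exists t, [/\ 0 < t < q, node_at ncut t & gap t = 0].
Proof.
have [_ [-> [cE [s1 s2]]]] := numericsE.
have q0 := @q_gt0 R.
have [|t [u [nt nu ut t0 uq]]] := @descendP 0 cut_bits node0 nodeq 0 q isT (@node0P R) (@nodeqP R).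
  by rewrite expr0 divr1 subr0.
have p0 : 0 < q / 2 ^+ (0 + size cut_bits) by rewrite divr_gt0// exprn_gt0.
rewrite drop0 in nt nu; rewrite -(numericsE.2.1) in nt nu *.
have [a1 a2 b1 b2] := cut_ends_denominators.
have t2 : 0 <= t <= 2 by have := @q_lt2 R; clear -t0 uq ut p0 => ?; lra.
have u2 : 0 <= u <= 2 by have := @q_lt2 R; clear -t0 uq ut p0 => ?; lra.
have g1 := inb_gap nt t2 a1 a2; have g2 := inb_gap nu u2 b1 b2.
have g1' : gap t < 0 by rewrite -oppr_gt0; apply: inb_gt0 (inb_opp g1) s1.
have g2' : 0 < gap u by apply: inb_gt0 g2 s2.
(* Continuity of [gap] is available strictly inside []0, pi / 2[], where both arcs have positive
   mass; hence [0 < t] and, from a positive cosine, [u < pi / 2]. *)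
have /andP[/inb_gt0 t0' /inb_gt0 cu] := cut_ends_check.
have {}t0' : 0 < t by case: nt => + _ _; exact: t0'.
have {}uq : u < q.
  rewrite lt_neqAle uq andbT; apply/eqP => uq'.
  by case: nu => _ /cu + _; rewrite uq' cos_pihalf ltxx.
have [||x] := @IVT R gap t u 0 _ (within_continuous_gap t0' uq); first by clear -ut p0; lra.
  by rewrite ge_min le_max (ltW g1') (ltW g2') orbT.
rewrite in_itv/= => /andP[tx xu] gx.
have x0q : 0 < x < q by clear -tx xu t0' uq; lra.
exists x; split; [exact: x0q| |exact: gx].
rewrite (numericsE.2.2.1); apply: (nhullP nt nu); rewrite ?(ltW t0') ?(ltW uq) ?tx//.
Qed.

Definition tcut : R := projT1 (cid cut_exists).
Lemma tcut_itv : 0 < tcut < q. Proof. by rewrite /tcut; case: cid => t []. Qed.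
Lemma ncutP : node_at ncut tcut. Proof. by rewrite /tcut; case: cid => t []. Qed.
Lemma gap_cut : gap tcut = 0. Proof. by rewrite /tcut; case: cid => t []. Qed.

End cut.

(** * The dual potential and its value on the cells *)

Lemma coefficientsE :
  [/\ b_d2 = badd (bsqr b_cB1) (bsqr (bsub (bint 1) b_cB2)),
      b_vt = badd (bsqr (bsub (bscale 2 (ncos ncut)) b_cA)) (bsqr (nsin ncut)),
      b_al = bdiv (bsub b_vt b_d2) (badd (bint 1) b_zt) &
   [/\ b_w00 = bsub (badd b_d2 b_al) (bhalf (bint 5)),
       b_w01 = bsub (bsub b_al (bmul (bcst kz) b_zt)) (bhalf (bint 3)) &
       b_w02 = bmul (bcst kz) (bsub (bint 1) b_zt)]].
Proof. by vm_compute. Qed.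
Lemma integralsE :
  [/\ b_SA0 = comb4 b_w00 b_w01 b_w02 (bcst kz) bM0 bM1 bM2 bM3,
      b_SB0 = comb4 b_w00 b_w01 b_w02 (bcst kz)
        (bsub M0q bM0) (bsub M1q bM1) (bsub M2q bM2) (bsub M3q bM3),
      b_SA1 = comb3 (bopp b_zt) (bsub (bint 1) b_zt) bM0 bM1 bM2 &
      b_SB1 = comb3 (bopp b_zt) (bsub (bint 1) b_zt)
        (bsub M0q bM0) (bsub M1q bM1) (bsub M2q bM2)].
Proof. by vm_compute. Qed.
Lemma solutionE :
  [/\ b_be = bdiv (bsub (badd b_SB0 (bmul (badd (bsqr b_cB1) (bsqr b_cB2)) b_mB))
               (bscale 2 (badd b_SA0 (bmul (bsqr b_cA) bM0))))
               (bsub (bscale 2 b_SA1) b_SB1),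
      b_K = bscale 2 (badd (badd b_SA0 (bmul b_be b_SA1)) (bmul (bsqr b_cA) bM0)) &
   [/\ b_w0 = bsub b_w00 (bmul b_be b_zt),
       b_w1 = badd b_w01 (bmul b_be (bsub (bint 1) b_zt)) &
       b_w2 = badd b_w02 b_be]].
Proof. by vm_compute. Qed.

Section dual_functions.
Context {R : realType}.
Implicit Types (t : R).
Local Notation s := (@ellipse_speed R).

Definition lin4 (c0 c1 c2 c3 m0 m1 m2 m3 : R) : R :=
  (c0 * m0 + c1 * m1) + (c2 * m2 + c3 * m3).

Context (p0 p1 p2 p3 : R).

Definition wpoly t : R := lin4 p0 p1 p2 p3 1 (zc t) (zc t ^+ 2) (zc t ^+ 3).
(* If [wpoly t = v t - |ellipse_curve t|^2] and [e = c1 ^ 2 + c2 ^ 2], then this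
   is [v t - |ellipse_curve t - (c1, c2)|^2]. *)
Definition gpoly c1 c2 e t : R := wpoly t + 4 * c1 * cos t + 2 * c2 * sin t - e.

Lemma continuous_wpoly : continuous wpoly.
Proof.
have cp j : continuous (fun t : R => zc t ^+ j) by exact: continuous_pow_zc.
rewrite /wpoly /lin4; apply: continuous_D; apply: continuous_D; apply: continuous_M => //;
  try exact: continuous_k.
- exact: continuous_zc.
Qed.

Lemma continuous_gpoly c1 c2 e : continuous (gpoly c1 c2 e).
Proof.
apply: continuous_B; last exact: continuous_k.
apply: continuous_D; first apply: continuous_D; first exact: continuous_wpoly.
- by apply: continuous_M; [exact: continuous_k|exact: continuous_cos].
- by apply: continuous_M; [exact: continuous_k|exact: continuous_sin].
Qed.

Definition prim_gpoly c1 c2 e t : R :=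
  lin4 p0 p1 p2 p3 (moment 0 t) (moment 1 t) (moment 2 t) (moment 3 t)
  + 2 * c1 * xmoment t + 2 * c2 * ymoment t - e * moment 0 t.

Lemma itg_gpoly0 c1 c2 e b :
  itg (fun t => gpoly c1 c2 e t * s t) 0 b = prim_gpoly c1 c2 e b.
Proof.
have cp j : continuous (fun t : R => zc t ^+ j * s t) by exact: continuous_pow_speed.
have cc := @continuous_cos_speed R; have cs := @continuous_sin_speed R.
have ck k (f : R -> R) : continuous f -> continuous (fun t => k * f t).
  by move=> cf; apply: continuous_M => //; exact: continuous_k.
rewrite /prim_gpoly /lin4 /moment /xmoment /ymoment -!itgZ//.
rewrite -!(itgD, itgB); do ?[exact: ck|exact: cp|apply: continuous_D|apply: continuous_B] => //.
by apply: eq_itg => t _; rewrite /gpoly /wpoly /lin4; ring.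
Qed.

Lemma itg_gpoly c1 c2 e a b : 0 <= a -> a <= b ->
  itg (fun t => gpoly c1 c2 e t * s t) a b = prim_gpoly c1 c2 e b - prim_gpoly c1 c2 e a.
Proof.
move=> a0 ab; have c : continuous (fun t => gpoly c1 c2 e t * s t).
  by apply: continuous_M; [exact: continuous_gpoly|exact: continuous_ellipse_speed].
by rewrite -!itg_gpoly0 (itg_chasles c a0 ab) addrAC subrr add0r.
Qed.

End dual_functions.

Section params.
Context {R : realType}.
Implicit Types (t u x : R).
Local Notation U := (@scale R).
Local Notation q := (pi / 2 : R).
Local Notation s := (@ellipse_speed R).
Local Notation t0 := (@tcut R).

Definition massA : R := moment 0 t0.
Definition massB : R := moment 0 q - moment 0 t0.
Definition a1 : R := cA t0.
Definition b1 : R := cB1 t0.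
Definition b2 : R := cB2 t0.
Definition zt : R := zc t0.
Definition d2 : R := b1 ^+ 2 + (1 - b2) ^+ 2.
Definition vt : R := (2 * cos t0 - a1) ^+ 2 + sin t0 ^+ 2.
(** Newton form of the potential in [z = cos (2 t)]: [v = d2 + al (1 + z) + (1 + z) (z - zt) (be +
    kk z)]. Whatever [be] and [kk] are, it takes the value [d2] at [z = -1], that is at [pi / 2],
    and [vt] at [z = zt], that is at [tcut]. The definitions [w0], [w1], [w2] expand [v - |x|^2],
    where [|x|^2 = 5 / 2 + 3 / 2 z]. *)
Definition al : R := (vt - d2) / (1 + zt).
Definition kk : R := ZR kz / U.
Definition lin3 (c0 c1 m0 m1 m2 : R) : R := c0 * m0 + c1 * m1 + m2.
Definition w00 : R := d2 + al - 5 / 2.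
Definition w01 : R := al - kk * zt - 3 / 2.
Definition w02 : R := kk * (1 - zt).
Definition dm j : R := moment j q - moment j t0.
(** [SA0 + be * SA1] is the integral of [(v - |x|^2) s] over [[0, tcut]], half of the cell on the
    major axis; [SB0 + be * SB1] is the integral over [[tcut, pi / 2]], a whole cell. This explains
    the factors 2 in [be] and [Kval]. *)
Definition SA0 : R := lin4 w00 w01 w02 kk (moment 0 t0) (moment 1 t0) (moment 2 t0) (moment 3 t0).
Definition SB0 : R := lin4 w00 w01 w02 kk (dm 0) (dm 1) (dm 2) (dm 3).
Definition SA1 : R := lin3 (- zt) (1 - zt) (moment 0 t0) (moment 1 t0) (moment 2 t0).
Definition SB1 : R := lin3 (- zt) (1 - zt) (dm 0) (dm 1) (dm 2).
(* Chosen so that the two cells have the same dual value [Kval]. *)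
Definition be : R :=
  (SB0 + (b1 ^+ 2 + b2 ^+ 2) * massB - 2 * (SA0 + a1 ^+ 2 * massA)) / (2 * SA1 - SB1).
Definition Kval : R := 2 * (SA0 + be * SA1 + a1 ^+ 2 * massA).
Definition w0 : R := w00 - be * zt.
Definition w1 : R := w01 + be * (1 - zt).
Definition w2 : R := w02 + be.

Definition wfun : R -> R := wpoly w0 w1 w2 kk.
Definition gfun : R -> R -> R -> R -> R := gpoly w0 w1 w2 kk.
Definition prim_g : R -> R -> R -> R -> R := prim_gpoly w0 w1 w2 kk.

Let t02 : 0 <= t0 <= 2.
Proof. by have /andP[? ?] := @tcut_itv R; have := @q_lt2 R; lra. Qed.

Lemma inb_M : [/\ inb bM0 (moment 0 t0), inb bM1 (moment 1 t0), inb bM2 (moment 2 t0) &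
  inb bM3 (moment 3 t0)].
Proof.
have [-> [-> [-> [-> _]]]] := moments_cutE.
have n := @ncutP R; have t := t02; split; exact: inb_bmoment.
Qed.

Lemma inb_massB : inb b_mB massB.
Proof.
have [_ [_ [_ [_ [_ [_ [_ [-> _]]]]]]]] := moments_cutE.
by have [m _ _ _] := inb_M; have [m' _ _ _ _] := @inb_moments_q R; exact: inb_sub.
Qed.

Lemma inb_c : [/\ inb b_cA a1, inb b_cB1 b1, inb b_cB2 b2 & inb b_zt zt].
Proof.
have [_ [_ [_ [_ [-> [-> [-> [_ ->]]]]]]]] := moments_cutE.
have /and4P[p1 p2 _ _] := denominators_check.
have n := @ncutP R; have t := t02; split.
- exact: (inb_cA n t p1).
- exact: (inb_cB1 n t p2).
- exact: (inb_cB2 n t p2).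
- exact: inb_nzc.
Qed.

Lemma inb_int5 k : inb (bint (Z.of_nat k)) (k%:R : R).
Proof. by rewrite -ZR_nat; exact: inb_int. Qed.

Lemma inb_al : inb b_d2 d2 /\ inb b_al al /\ 0 < 1 + zt.
Proof.
have [a b c z] := inb_c; have [_ nc ns] := @ncutP R.
have [-> -> -> _] := coefficientsE.
have d : inb (badd (bsqr b_cB1) (bsqr (bsub (bint 1) b_cB2))) d2.
  apply: inb_add; apply: inb_sqr => //; apply: inb_sub => //; exact: inb1.
have /and4P[_ _ p _] := denominators_check.
have z1 : inb (badd (bint 1) b_zt) (1 + zt) by apply: inb_add => //; exact: inb1.
split=> //; split; last exact: inb_gt0 z1 p.
apply: inb_div => //; apply: inb_sub => //; apply: inb_add; apply: inb_sqr => //.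
by apply: inb_sub => //; rewrite -ZR2; exact: inb_scale.
Qed.

Lemma inb_w0x : [/\ inb b_w00 w00, inb b_w01 w01 & inb b_w02 w02].
Proof.
have [_ _ _ z] := inb_c; have [d [a _]] := inb_al.
have [_ _ _ [-> -> ->]] := coefficientsE.
have k : inb (bcst kz) kk by exact: inb_cst.
split.
- by apply: inb_sub; [exact: inb_add|apply: inb_half; exact: (inb_int5 5)].
- apply: inb_sub; last by apply: inb_half; exact: (inb_int5 3).
  by apply: inb_sub => //; exact: inb_mul.
- by apply: inb_mul => //; apply: inb_sub => //; exact: inb1.
Qed.

Lemma inb_lin4 (b0 b1' b2' b3 n0 n1 n2 n3 : zball) (c0 c1 c2 c3 m0 m1 m2 m3 : R) :
  inb b0 c0 -> inb b1' c1 -> inb b2' c2 -> inb b3 c3 ->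
  inb n0 m0 -> inb n1 m1 -> inb n2 m2 -> inb n3 m3 ->
  inb (comb4 b0 b1' b2' b3 n0 n1 n2 n3) (lin4 c0 c1 c2 c3 m0 m1 m2 m3).
Proof. by move=> *; do 2?apply: inb_add; exact: inb_mul. Qed.
Lemma inb_lin3 (b0 b1' n0 n1 n2 : zball) (c0 c1 m0 m1 m2 : R) :
  inb b0 c0 -> inb b1' c1 -> inb n0 m0 -> inb n1 m1 -> inb n2 m2 ->
  inb (comb3 b0 b1' n0 n1 n2) (lin3 c0 c1 m0 m1 m2).
Proof. by move=> *; apply: inb_add => //; apply: inb_add; exact: inb_mul. Qed.

Lemma inb_S : [/\ inb b_SA0 SA0, inb b_SB0 SB0, inb b_SA1 SA1 & inb b_SB1 SB1].
Proof.
have [_ _ _ z] := inb_c; have [wa wb wc] := inb_w0x.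
have [n0 n1 n2 n3] := inb_M; have [m0 m1 m2 m3 _] := @inb_moments_q R.
have k : inb (bcst kz) kk by exact: inb_cst.
have z1 : inb (bsub (bint 1) b_zt) (1 - zt) by apply: inb_sub => //; exact: inb1.
have [-> -> -> ->] := integralsE.
split.
- exact: inb_lin4.
- by apply: inb_lin4 => //; exact: inb_sub.
- by apply: inb_lin3 => //; exact: inb_opp.
- by apply: inb_lin3 => //; [exact: inb_opp|exact: inb_sub..].
Qed.

Lemma den_gt0 : 0 < 2 * SA1 - SB1.
Proof.
have [_ _ a b] := inb_S; have /and4P[_ _ _ p] := denominators_check.
by apply: inb_gt0 p; apply: inb_sub => //; rewrite -ZR2; exact: inb_scale.
Qed.

Lemma inb_be : inb b_be be /\ inb b_K Kval.
Proof.
have [sa0 sb0 sa1 sb1] := inb_S; have [a b b' z] := inb_c; have [n0 _ _ _] := inb_M.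
have mb := inb_massB; have [E1 -> _] := solutionE.
have bb : inb b_be be.
  have /and4P[_ _ _ p] := denominators_check.
  rewrite E1; apply: (inb_div _ _ p).
    apply: inb_sub.
      apply: inb_add; first exact: sb0.
      by apply: inb_mul; [apply: inb_add; exact: inb_sqr|exact: mb].
    rewrite -ZR2; apply: inb_scale; apply: inb_add; first exact: sa0.
    by apply: inb_mul; [exact: inb_sqr|exact: n0].
  by apply: inb_sub; [rewrite -ZR2; exact: inb_scale|exact: sb1].
split; first exact: bb.
rewrite /Kval -ZR2; apply: inb_scale; apply: inb_add.
  by apply: inb_add; [exact: sa0|exact: inb_mul].
by apply: inb_mul; [exact: inb_sqr|exact: n0].
Qed.

Lemma inb_w : [/\ inb b_w0 w0, inb b_w1 w1, inb b_w2 w2 & inb (bcst kz) kk].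
Proof.
have [wa wb wc] := inb_w0x; have [b _] := inb_be; have [_ _ _ z] := inb_c.
have [_ _ [-> -> ->]] := solutionE; split; last exact: inb_cst.
- by apply: inb_sub; [exact: wa|exact: inb_mul].
- apply: inb_add; first exact: wb.
  by apply: inb_mul; [exact: b|apply: inb_sub; [exact: inb1|exact: z]].
- exact: inb_add.
Qed.

Lemma sqr_curve t : 4 * cos t ^+ 2 + sin t ^+ 2 = 5 / 2 + 3 / 2 * zc t.
Proof. by rewrite zc_cos; have := cos2Dsin2 t; lra. Qed.

Lemma wfun_q : wfun q = d2 - 1.
Proof.
have -> : wfun q = lin4 w0 w1 w2 kk 1 (-1) ((-1) ^+ 2) ((-1) ^+ 3).
  by rewrite /wfun /wpoly zc_cos cos_pihalf expr0n/= mulr0 sub0r.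
by rewrite /lin4 /w0 /w1 /w2 /w00 /w01 /w02; field.
Qed.

Lemma wfun_t0 : wfun t0 = vt - (4 * cos t0 ^+ 2 + sin t0 ^+ 2).
Proof.
have [_ [_ z]] := inb_al.
rewrite sqr_curve -/zt.
have -> : vt = al * (1 + zt) + d2 by rewrite /al divfK ?subrK// gt_eqF.
by rewrite /wfun /wpoly -/zt /lin4 /w0 /w1 /w2 /w00 /w01 /w02; field.
Qed.

Lemma gfun_q : gfun b1 b2 (b1 ^+ 2 + b2 ^+ 2) q = 0.
Proof. by rewrite /gfun /gpoly -/(wfun _) wfun_q cos_pihalf sin_pihalf /d2; ring. Qed.

Lemma gfun_A : gfun a1 0 (a1 ^+ 2) t0 = 0.
Proof. by rewrite /gfun /gpoly -/(wfun _) wfun_t0 /vt; ring. Qed.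

(** At [tcut] both contact points are equally far from the curve, by [gap_cut], so that the
    vanishing for the first point carries over to the second. *)
Lemma gfun_B : gfun b1 b2 (b1 ^+ 2 + b2 ^+ 2) t0 = 0.
Proof.
have := @gap_cut R; rewrite /gap -/a1 -/b1 -/b2 => g.
have := gfun_A; rewrite /gfun /gpoly; lra.
Qed.

Lemma massA_gt0 : 0 < massA.
Proof. by apply: moment0_gt0; have /andP[] := @tcut_itv R. Qed.
Lemma massB_gt0 : 0 < massB.
Proof. by have /andP[? ?] := @tcut_itv R; apply: moment0_lt => //; exact: ltW. Qed.
Lemma xmoment_A : xmoment t0 = a1 * massA.
Proof. by rewrite /a1 /cA divfK// gt_eqF// massA_gt0. Qed.
Lemma xmoment_B : xmoment q - xmoment t0 = b1 * massB.
Proof. by rewrite /b1 /cB1 divfK// gt_eqF// massB_gt0. Qed.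
Lemma ymoment_B : ymoment q - ymoment t0 = b2 * massB.
Proof. by rewrite /b2 /cB2 divfK// gt_eqF// massB_gt0. Qed.

(** The parameter [e] stays free because it will be the squared norm of a displaced point. *)
Lemma cell_A e : prim_g a1 0 e t0 = Kval / 2 + (a1 ^+ 2 - e) * massA.
Proof.
rewrite /prim_g /prim_gpoly xmoment_A -/massA /Kval /SA0 /SA1 -/massA /lin4 /lin3 /w0 /w1 /w2.
by field.
Qed.

Lemma cell_B e :
  prim_g b1 b2 e q - prim_g b1 b2 e t0 = Kval + (b1 ^+ 2 + b2 ^+ 2 - e) * massB.
Proof.
have : be * (2 * SA1 - SB1) =
  SB0 + (b1 ^+ 2 + b2 ^+ 2) * massB - 2 * (SA0 + a1 ^+ 2 * massA).
  by rewrite /be divfK// gt_eqF// den_gt0.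
have := xmoment_B; have := ymoment_B.
have -> : prim_g b1 b2 e q - prim_g b1 b2 e t0 =
  (SB0 + be * SB1) + 2 * b1 * (xmoment q - xmoment t0)
  + 2 * b2 * (ymoment q - ymoment t0) - e * massB.
  rewrite /prim_g /prim_gpoly /SB0 /SB1 /dm /massB /lin4 /lin3 /w0 /w1 /w2; ring.
move=> -> ->; rewrite /Kval; lra.
Qed.

End params.

(** * Integrals of positive parts, chords and concavity *)

Section positive_part.
Context {R : realType}.
Implicit Types (x y A B a b c : R) (f g : R -> R).

Definition posp x : R := (x + `|x|) / 2.

Lemma posp_pos x : 0 <= x -> posp x = x.
Proof. by move=> x0; rewrite /posp ger0_norm//; lra. Qed.
Lemma posp_neg x : x <= 0 -> posp x = 0.
Proof. by move=> x0; rewrite /posp ler0_norm//; lra. Qed.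
Lemma posp_ge0 x : 0 <= posp x.
Proof. by have [x0|/ltW x0] := leP 0 x; rewrite ?(posp_pos x0) ?(posp_neg x0). Qed.
Lemma posp_ge x : x <= posp x.
Proof. by have [x0|/ltW x0] := leP 0 x; rewrite ?(posp_pos x0) ?(posp_neg x0). Qed.
Lemma le_posp x y : x <= y -> posp x <= posp y.
Proof.
move=> xy; have [x0|/ltW x0] := leP 0 x; last by rewrite (posp_neg x0) posp_ge0.
by rewrite (posp_pos x0) (le_trans xy)// posp_ge.
Qed.
Lemma posp_le x y : x <= y -> 0 <= y -> posp x <= y.
Proof. by move=> xy y0; rewrite -(posp_pos y0) le_posp. Qed.
Lemma pospD x y : posp (x + y) <= posp x + posp y.
Proof. by apply: posp_le; [rewrite lerD ?posp_ge|rewrite addr_ge0 ?posp_ge0]. Qed.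
Lemma pospZ k x : 0 <= k -> posp (k * x) = k * posp x.
Proof. by move=> k0; rewrite /posp normrM (ger0_norm k0); lra. Qed.
Lemma pospB x : x = posp x - posp (- x).
Proof. by rewrite /posp normrN; lra. Qed.

Lemma continuous_posp f : continuous f -> continuous (fun t : R => posp (f t)).
Proof.
move=> cf; rewrite /posp; apply: continuous_M; last exact: continuous_k.
by apply: continuous_D => // t; apply: cvg_norm; exact: cf.
Qed.

(** The mean slopes on the two sides of [x] are values of [df], which decreases. *)
Lemma concave_chord f (df ddf : R -> R) a b x : a <= x <= b ->
  (forall u, a <= u <= b -> is_derive u 1 f (df u)) ->
  (forall u, a <= u <= b -> is_derive u 1 df (ddf u)) ->
  (forall u, a < u < b -> ddf u <= 0) ->
  f a * (b - x) + f b * (x - a) <= f x * (b - a).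
Proof.
move=> /andP[ax xb] d1 d2 neg.
move: ax; rewrite le_eqVlt => /predU1P[<-|ax]; first by rewrite subrr mulr0 addr0.
move: xb; rewrite le_eqVlt => /predU1P[->|xb]; first by rewrite subrr mulr0 add0r.
have M u v : a <= u -> u < v -> v <= b ->
    exists2 w, u < w < v & f v - f u = df w * (v - u).
  move=> au uv vb; have [||w] := @MVT R f df u v uv.
  - by move=> w; rewrite in_itv/= => /andP[uw wv]; apply: d1; lra.
  - apply: continuous_in_subspaceT => w; rewrite inE/= in_itv/= => /andP[uw wv].
    apply: differentiable_continuous; apply/derivable1_diffP.
    have wab : a <= w <= b by lra.
    by have := d1 w wab => ?; exact: ex_derive.
  by rewrite in_itv/= => uwv e; exists w.
have [w /andP[aw wx] ew] := M a x (lexx a) ax (ltW xb).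
have [v /andP[xv vb] ev] := M x b (ltW ax) xb (lexx b).
have wv : df v <= df w.
  rewrite -lerN2; apply: (@nondecreasing_is_derive _ (fun u => - df u) (fun u => - ddf u)).
  - lra.
  - move=> u /andP[wu uv]; have uab : a <= u <= b by lra.
    by have := d2 u uab => ?; apply: is_derive_eq.
  - by move=> u /andP[wu uv]; rewrite oppr_ge0; apply: neg; lra.
rewrite -subr_ge0.
have -> : f x * (b - a) - (f a * (b - x) + f b * (x - a)) =
  (f x - f a) * (b - x) - (f b - f x) * (x - a) by ring.
rewrite ew ev.
have -> : df w * (x - a) * (b - x) - df v * (b - x) * (x - a) =
  (df w - df v) * ((x - a) * (b - x)) by ring.
by rewrite mulr_ge0 ?subr_ge0// mulr_ge0// subr_ge0 ltW.
Qed.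

(** Subtracting [C / 2 u^2] from [f] or [- f] makes it concave. The chord of the parabola errs by
    [C / 2 (x - a) (b - x)], at most [C / 8 (b - a)^2]. The factor [b - a] is kept on both sides to
    avoid a division. *)
Lemma chord_error f (df ddf : R -> R) (C : R) a b x : a <= x <= b ->
  (forall u, a <= u <= b -> is_derive u 1 f (df u)) ->
  (forall u, a <= u <= b -> is_derive u 1 df (ddf u)) ->
  (forall u, a <= u <= b -> `|ddf u| <= C) ->
  `|f x * (b - a) - (f a * (b - x) + f b * (x - a))| <= C / 8 * (b - a) ^+ 2 * (b - a).
Proof.
move=> axb d1 d2 dC; have /andP[ax xb] := axb.
have C0 : 0 <= C by apply: le_trans (dC x axb).
have K (g dg ddg : R -> R) :
    (forall u, a <= u <= b -> is_derive u 1 g (dg u)) ->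
    (forall u, a <= u <= b -> is_derive u 1 dg (ddg u)) ->
    (forall u, a <= u <= b -> ddg u <= C) ->
    g a * (b - x) + g b * (x - a) - g x * (b - a) <= C / 8 * (b - a) ^+ 2 * (b - a).
  move=> e1 e2 e3.
  have := @concave_chord (fun u => g u - C / 2 * u ^+ 2) (fun u => dg u - C * u)
    (fun u => ddg u - C) a b x axb.
  have D1 u : a <= u <= b ->
      is_derive u 1 (fun u => g u - C / 2 * u ^+ 2) (dg u - C * u).
    move=> ab; have := e1 u ab => ?; apply: is_derive_eq.
    by rewrite /GRing.scale/= ?expr1 ?mulr1; lra.
  have D2 u : a <= u <= b -> is_derive u 1 (fun u => dg u - C * u) (ddg u - C).
    move=> ab; have := e2 u ab => ?; apply: is_derive_eq.
    by rewrite /GRing.scale/= ?mulr1; lra.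
  have D3 u : a < u < b -> ddg u - C <= 0.
    by move=> /andP[au ub]; rewrite subr_le0; apply: e3; rewrite !ltW.
  move=> /(_ D1 D2 D3) H; have : 0 <= C * ((b - a) * ((x - a) - (b - x)) ^+ 2).
    by rewrite mulr_ge0// mulr_ge0 ?sqr_ge0//; lra.
  move: H; move: (g a) (g b) (g x) => ga gb gx; clear => H1 H2; lra.
rewrite ler_norml; apply/andP; split.
- by rewrite lerNl opprB; apply: K d1 d2 _ => u /dC; apply: le_trans; exact: ler_norm.
- have := @K (fun u => - f u) (fun u => - df u) (fun u => - ddf u).
  have D1 u : a <= u <= b -> is_derive u 1 (fun u => - f u) (- df u).
    by move=> ab; have := d1 u ab => ?; apply: is_derive_eq.
  have D2 u : a <= u <= b -> is_derive u 1 (fun u => - df u) (- ddf u).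
    by move=> ab; have := d2 u ab => ?; apply: is_derive_eq.
  have D3 u : a <= u <= b -> - ddf u <= C.
    by move=> /dC; apply: le_trans; rewrite -normrN ler_norm.
  by move=> /(_ D1 D2 D3) h; lra.
Qed.

Lemma continuous_affine (al be : R) : continuous (fun x : R => al + be * x).
Proof.
apply: continuous_D; first exact: continuous_k.
by apply: continuous_M; [exact: continuous_k|move=> x; exact: cvg_id].
Qed.

Lemma itg_affine (al be : R) a b : a <= b ->
  itg (fun x => al + be * x) a b = al * (b - a) + be * (b ^+ 2 - a ^+ 2) / 2.
Proof.
move=> ab; have d x : a <= x <= b ->
    is_derive x 1 (fun x => al * x + be / 2 * x ^+ 2) (al + be * x).
  move=> _; apply: is_derive_eq.
  by rewrite /GRing.scale/= ?expr1 ?mulr1; lra.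
by rewrite (itg_FTC (@continuous_affine al be) ab d); field.
Qed.

(** The graph is a triangle of height [D] and base [D / gam], possibly cut off at [b]. *)
Lemma itg_posp_zone (D gam : R) a b : a <= b -> 0 < gam ->
  itg (fun x => posp (D - gam * (x - a))) a b <= posp D ^+ 2 / (2 * gam).
Proof.
move=> ab g0.
have E : (fun x => posp (D - gam * (x - a))) = (fun x => posp ((D + gam * a) + (- gam) * x)).
  by apply/funext => x; congr posp; ring.
have cf := continuous_posp (@continuous_affine (D + gam * a) (- gam)).
have [D0|/ltW D0] := leP D 0.
  rewrite (_ : itg _ _ _ = itg (fun=> 0) a b).
    by rewrite itg_cst// mul0r divr_ge0 ?sqr_ge0// mulr_ge0// ltW.
  apply: eq_itg => x; rewrite in_itv/= => /andP[ax _].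
  have : 0 <= gam * (x - a) by rewrite mulr_ge0 ?subr_ge0// ltW.
  by move=> h; apply: posp_neg; lra.
rewrite (posp_pos D0).
have Dg0 : 0 <= D / gam by rewrite divr_ge0// ltW.
have V c : a <= c -> gam * (c - a) <= D ->
    itg (fun x => posp (D + gam * a + - gam * x)) a c <= D ^+ 2 / (2 * gam).
  move=> ac cD.
  rewrite (_ : itg _ _ _ = itg (fun x => D + gam * a + - gam * x) a c); last first.
    apply: eq_itg => x; rewrite in_itv/= => /andP[ax xc]; apply: posp_pos.
    have : gam * (x - a) <= gam * (c - a) by rewrite ler_pM2l//; lra.
    lra.
  rewrite itg_affine// ler_pdivlMr ?mulr_gt0// -subr_ge0.
  rewrite (_ : _ - _ = (D - gam * (c - a)) ^+ 2) ?sqr_ge0//; by field.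
rewrite E; have [bc|/ltW bc] := leP b (a + D / gam).
  by apply: V => //; rewrite mulrC -ler_pdivlMr//; lra.
pose c := a + D / gam.
have ac : a <= c by rewrite lerDl.
have cD : gam * (c - a) = D by rewrite /c addrAC subrr add0r mulrC divfK// gt_eqF.
rewrite (itg_chasles cf ac bc) -/c.
rewrite [X in _ + X](_ : _ = 0) ?addr0; first by apply: V => //; rewrite cD.
rewrite (_ : itg _ _ _ = itg (fun=> 0) c b); first by rewrite itg_cst// mul0r.
apply: eq_itg => x; rewrite in_itv/= => /andP[cx xb]; apply: posp_neg.
have : gam * (c - a) <= gam * (x - a) by rewrite ler_pM2l//; lra.
lra.
Qed.

Lemma itg_posp_zone_weight g (s : R -> R) (S D gam : R) a b : continuous g ->
  continuous s -> a <= b -> 0 < gam ->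
  {in `[a, b], forall x, 0 <= s x <= S} ->
  {in `[a, b], forall x, g x <= D - gam * (x - a)} ->
  itg (fun x => posp (g x) * s x) a b <= S * (posp D ^+ 2 / (2 * gam)).
Proof.
move=> cg cs ab g0 sS gD.
have S0 : 0 <= S.
  have /sS/andP[] : a \in `[a, b] by rewrite in_itv/= lexx.
  exact: le_trans.
apply: le_trans (_ : itg (fun x => S * posp (D - gam * (x - a))) a b <= _).
  have ca : continuous (fun x : R => posp (D - gam * (x - a))).
    apply: continuous_posp; apply: continuous_B; first exact: continuous_k.
    apply: continuous_M; first exact: continuous_k.
    by apply: continuous_B; [move=> x; exact: cvg_id|exact: continuous_k].
  apply: le_itg.
  - by apply: continuous_M => //; exact: continuous_posp.
  - by apply: continuous_M => //; exact: continuous_k.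
  - move=> x xab; rewrite mulrC; have /andP[s0 s1] := sS x xab.
    by apply: ler_pM => //; [exact: posp_ge0|exact/le_posp/gD].
rewrite itgZ; last first.
  apply: continuous_posp; apply: continuous_B; first exact: continuous_k.
  apply: continuous_M; first exact: continuous_k.
  by apply: continuous_B; [move=> x; exact: cvg_id|exact: continuous_k].
by rewrite ler_wpM2l// itg_posp_zone.
Qed.

Lemma itg_posp_zone_left g (s : R -> R) (S D gam : R) a b : continuous g ->
  continuous s -> a <= b -> 0 < gam ->
  {in `[a, b], forall x, 0 <= s x <= S} ->
  {in `[a, b], forall x, g x <= D - gam * (b - x)} ->
  itg (fun x => posp (g x) * s x) a b <= S * (posp D ^+ 2 / (2 * gam)).
Proof.
move=> cg cs ab g0 sS gD.
have cgs : continuous (fun x => posp (g x) * s x).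
  by apply: continuous_M => //; exact: continuous_posp.
have cr (h : R -> R) : continuous h -> continuous (fun x => h (a + b - x)).
  move=> ch x; apply: (@continuous_comp _ _ _ (fun x => a + b - x) h); last exact: ch.
  by apply: cvgB; [exact: cvg_cst|exact: cvg_id].
have I x : x \in `[a, b] -> a + b - x \in `[a, b].
  by rewrite !in_itv/= => /andP[? ?]; lra.
have := itg_reflect (a + b) cgs ab.
have -> : a + b - b = a by ring.
have -> : a + b - a = b by ring.
move=> ->; apply: itg_posp_zone_weight => //; do ?exact: cr.
- by move=> x /I/sS.
- by move=> x /I/gD h; apply: le_trans h _; lra.
Qed.

(** [g] lies below the line with values [A] at [a] and [B] at [b]. According to the signs, the
    positive part of the line bounds nothing, a trapezoid, or a triangle of slope
    [(A - B) / (b - a)] in absolute value. *)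
Lemma itg_posp_chord g (s : R -> R) (S A B : R) a b : continuous g ->
  continuous s -> a < b ->
  {in `[a, b], forall x, 0 <= s x <= S} ->
  {in `[a, b], forall x, g x * (b - a) <= A * (b - x) + B * (x - a)} ->
  [/\ A <= 0 -> B <= 0 -> itg (fun x => posp (g x) * s x) a b <= 0,
      0 <= A -> 0 <= B -> itg (fun x => posp (g x) * s x) a b <= S * ((b - a) / 2 * (A + B)),
      0 < A -> B < 0 ->
        itg (fun x => posp (g x) * s x) a b <= S * ((b - a) / 2 * (A ^+ 2 / (A - B))) &
      A < 0 -> 0 < B ->
        itg (fun x => posp (g x) * s x) a b <= S * ((b - a) / 2 * (B ^+ 2 / (B - A)))].
Proof.
move=> cg cs ab sS gAB; have ba0 : 0 < b - a by lra.
have cgs : continuous (fun x => posp (g x) * s x).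
  by apply: continuous_M => //; exact: continuous_posp.
have S0 : 0 <= S.
  have /sS/andP[] : a \in `[a, b] by rewrite in_itv/= lexx ltW.
  exact: le_trans.
split=> A0 B0.
- rewrite (_ : itg _ _ _ = itg (fun=> 0) a b); first by rewrite itg_cst ?mul0r// ltW.
  apply: eq_itg => x xab; rewrite posp_neg ?mul0r//.
  have := gAB x xab; move: xab; rewrite in_itv/= => /andP[ax xb].
  have h1 : A * (b - x) <= 0 by rewrite mulr_le0_ge0// subr_ge0.
  have h2 : B * (x - a) <= 0 by rewrite mulr_le0_ge0// subr_ge0.
  by rewrite -(pmulr_lle0 (g x) ba0) mulrC => h; lra.
- apply: le_trans (_ : itg (fun x => S / (b - a) * ((A * b - B * a) + (B - A) * x)) a b <= _).
    apply: le_itg => //.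
      by apply: continuous_M; [exact: continuous_k|exact: continuous_affine].
    move=> x xab; have := gAB x xab; have /andP[s0 s1] := sS x xab.
    move: xab; rewrite in_itv/= => /andP[ax xb] h.
    have h0 : 0 <= A * (b - x) + B * (x - a) by rewrite addr_ge0// mulr_ge0// subr_ge0.
    rewrite -mulrA mulrC; apply: ler_pM => //; first exact: posp_ge0.
    rewrite mulrC; apply: posp_le.
      rewrite ler_pdivlMr//; apply: le_trans h _; lra.
    by rewrite divr_ge0 ?(ltW ba0)//; lra.
  rewrite itgZ; last exact: continuous_affine.
  rewrite (itg_affine _ _ (ltW ab)) le_eqVlt; apply/orP; left; apply/eqP; field.
  by rewrite gt_eqF.
- have g0 : 0 < (A - B) / (b - a) by rewrite divr_gt0//; lra.
  have := itg_posp_zone_weight (D := A) cg cs (ltW ab) g0 sS.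
  rewrite (posp_pos (ltW A0)) => H; apply: le_trans (H _) _.
    move=> x /gAB h; rewrite -(ler_pM2r ba0); apply: le_trans h _.
    rewrite mulrBl [_ / _ * _ * _]mulrAC divfK ?gt_eqF//; lra.
  rewrite ler_wpM2l// le_eqVlt; apply/orP; left; apply/eqP; field.
  by rewrite !gt_eqF//; lra.
- have g0 : 0 < (B - A) / (b - a) by rewrite divr_gt0//; lra.
  have := itg_posp_zone_left (D := B) cg cs (ltW ab) g0 sS.
  rewrite (posp_pos (ltW B0)) => H; apply: le_trans (H _) _.
    move=> x /gAB h; rewrite -(ler_pM2r ba0); apply: le_trans h _.
    rewrite mulrBl [_ / _ * _ * _]mulrAC divfK ?gt_eqF//; lra.
  rewrite ler_wpM2l// le_eqVlt; apply/orP; left; apply/eqP; field.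
  by rewrite !gt_eqF//; lra.
Qed.

End positive_part.

(** * The integer program that bounds [Lam] from above *)

Definition pow2 (k : Z) : Z := (2 ^ k)%ZZ.

(* The exact dyadic coefficients that replace those of [wfun]. *)
Definition wz : seq Z := [:: b_w0.1; b_w1.1; b_w2.1; kz].

(** The first three fields give [v - |x - c|^2] at the node for every [c]; the last four are the
    primitives from which its integral is obtained linearly in [c1], [c2] and [|c|^2]. So one table
    serves all vertices. *)
Record bdata := BData { bdW : zball; bdX : zball; bdY : zball;
  bd0 : zball; bdFX : zball; bdFY : zball; bd3 : zball }.
Definition bdata_of (n : node) : bdata :=
  let z := nzc n in let m0 := bmoment n z 0 in
  BData (hornerB wz z) (ncos n) (nsin n)
    (comb4 (bcst (nth 0%ZZ wz 0)) (bcst (nth 0%ZZ wz 1)) (bcst (nth 0%ZZ wz 2)) (bcst (nth 0%ZZ wz 3))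
       m0 (bmoment n z 1) (bmoment n z 2) (bmoment n z 3))
    (bxmoment n z) (bymoment n z) m0.

Inductive btree := BLeaf (hs : zball) | BNode (d : bdata) (l r : btree).
(** A leaf stores half the width times the speed at the right end, which is the maximum since the
    speed increases on [[0, pi / 2]]. *)
Fixpoint bbuild (fs : seq zball) (a b : node) : btree :=
  if fs is f :: fs' then
    let m := nmid f a b in BNode (bdata_of m) (bbuild fs' a m) (bbuild fs' m b)
  else BLeaf (bmul (bsqrt (bhalf (bsub (bint 5) (bscale 3 (nzc b)))))
                   (bhalf (bsub (nth_ b) (nth_ a)))).
Fixpoint bleaf_ok (fs : seq zball) (a b : node) : bool :=
  if fs is f :: fs' then
    let m := nmid f a b in bleaf_ok fs' a m && bleaf_ok fs' m b
  else let c := bhalf (bsub (bint 5) (bscale 3 (nzc b))) in Z.leb c.2 c.1.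

Definition depth : nat := 8.
Definition bdata0 : bdata := Eval vm_compute in bdata_of node0.
Definition bdataq : bdata := Eval vm_compute in bdata_of nodeq.
Definition btab : btree := Eval vm_compute in bbuild (take depth bisect_factors) node0 nodeq.

(* Rounded data: the dual function is scaled by [2 ^ 44], the coordinates by
   [2 ^ 32] and the integrals by [2 ^ 38]. *)
Record ndata := NData { dW : Z; dX : Z; dY : Z; dF0 : Z; dFX : Z; dFY : Z; dF3 : Z }.
Inductive tree := Leaf (hs : Z) | TNode (d : ndata) (l r : tree).
Definition rnd (k : Z) (b : zball) : Z := Z.shiftr b.1 (prec - k).
(** A vertex has coordinates scaled by [2^12], so that its products with the fields scaled by [2^32]
    match the scale [2^44] of [dW]. *)
Definition ndata_of (d : bdata) : ndata :=
  NData (rnd 44 (bdW d)) (rnd 32 (bscale 4 (bdX d))) (rnd 32 (bscale 2 (bdY d)))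
    (rnd 38 (bd0 d)) (rnd 38 (bdFX d)) (rnd 38 (bdFY d)) (rnd 38 (bd3 d)).
Definition rnd_ok (e k : Z) (b : zball) : bool := Z.leb b.2 (e * pow2 (prec - k)).
Definition bdata_ok (d : bdata) : bool :=
  [&& rnd_ok 16 44 (bdW d), rnd_ok 1 32 (bscale 4 (bdX d)), rnd_ok 1 32 (bscale 2 (bdY d)),
      rnd_ok 1 38 (bd0 d), rnd_ok 1 38 (bdFX d), rnd_ok 1 38 (bdFY d) & rnd_ok 1 38 (bd3 d)].
Fixpoint tree_of (t : btree) : tree :=
  match t with
  | BLeaf hs => Leaf (Z.shiftr (hs.1 + hs.2) (prec - 20) + 1)
  | BNode d l r => TNode (ndata_of d) (tree_of l) (tree_of r)
  end.
Fixpoint btree_ok (t : btree) : bool :=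
  match t with
  | BLeaf _ => true
  | BNode d l r => [&& bdata_ok d, btree_ok l & btree_ok r]
  end.
Definition tab : tree := Eval vm_compute in tree_of btab.
Definition data0 : ndata := Eval vm_compute in ndata_of bdata0.
Definition dataq : ndata := Eval vm_compute in ndata_of bdataq.

Lemma btabE : [/\ btab = bbuild (take depth bisect_factors) node0 nodeq,
  bdata0 = bdata_of node0 & bdataq = bdata_of nodeq].
Proof. by vm_compute. Qed.
Lemma tabE : [/\ tab = tree_of btab, data0 = ndata_of bdata0, dataq = ndata_of bdataq &
  [&& btree_ok btab, bdata_ok bdata0, bdata_ok bdataq &
      bleaf_ok (take depth bisect_factors) node0 nodeq]].
Proof. by vm_compute. Qed.

(* [kap0 / 2 ^ 44] bounds the chord error [C / 8 * (pi / 2) ^ 2] for [C = 15.5];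
   the added constant absorbs the rounding of the data. *)
Definition kap0 : Z := 84150000000000.
Definition kaps : seq Z :=
  [seq (Z.shiftr kap0 (2 * Z.of_nat l) + 25001)%ZZ | l <- iota 0 depth.+1].

Definition gval (d : ndata) (i j E : Z) : Z := (dW d + i * dX d + j * dY d - E)%ZZ.

(** Where the integrand is positive only differences of primitives are summed; the coordinates of
    the point multiply them once, in [acc_val]. The field [sC] collects the chord bounds of
    undecided leaves. *)
Record acc := Acc { s0 : Z; sX : Z; sY : Z; s3 : Z; sC : Z }.
Definition acc_cell (da db : ndata) (v : acc) : acc :=
  Acc (s0 v + (dF0 db - dF0 da)) (sX v + (dFX db - dFX da)) (sY v + (dFY db - dFY da))
      (s3 v + (dF3 db - dF3 da)) (sC v).
Definition acc_chord (c : Z) (v : acc) : acc :=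
  Acc (s0 v) (sX v) (sY v) (s3 v) (sC v + c).
(** Twice the mean of the positive part of the line from [a] to [b]; the [+ 1] rounds the quotient
    up. *)
Definition chordv (a b : Z) : Z :=
  if (a <=? 0)%ZZ then
    if (b <=? 0)%ZZ then 0%ZZ else (b * b / (b - a) + 1)%ZZ
  else if (b <? 0)%ZZ then (a * a / (a - b) + 1)%ZZ else (a + b)%ZZ.

(** [k] exceeds the chord error at the current depth plus the rounding. If both end values are
    beyond [k] on the same side, the sign on the whole interval is known and the subtree is skipped
    or summed in one piece. *)
Fixpoint go (t : tree) (ks : seq Z) (i j E : Z) (da : ndata) (ga : Z)
    (db : ndata) (gb : Z) (v : acc) : acc :=
  let k := head 0%ZZ ks in
  if (ga <=? - k)%ZZ && (gb <=? - k)%ZZ then v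
  else if (k <=? ga)%ZZ && (k <=? gb)%ZZ then acc_cell da db v
  else match t with
  | Leaf hs => acc_chord (hs * chordv (Z.shiftr (ga + k) 20 + 1) (Z.shiftr (gb + k) 20 + 1)) v
  | TNode d l r =>
    let gm := gval d i j E in
    go r (behead ks) i j E d gm db gb (go l (behead ks) i j E da ga d gm v)
  end.

Definition acc0 : acc := Acc 0 0 0 0 0.
(** All terms have the scale [2^82]. The exponent 33 instead of 32 contains the factor 2 of [2 c1]
    and [2 c2]; chord terms come with scale [2^20 * 2^24]. *)
Definition acc_val (i j E : Z) (v : acc) : Z :=
  (pow2 44 * s0 v + pow2 33 * (i * sX v + j * sY v) - E * s3 v + pow2 38 * sC v)%ZZ.
Definition quarter (i j E : Z) : Z :=
  acc_val i j E (go tab kaps i j E data0 (gval data0 i j E) dataq (gval dataq i j E) acc0).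
Definition total (i j E : Z) : Z :=
  (quarter i j E + quarter i (- j) E + (quarter (- i) j E + quarter (- i) (- j) E))%ZZ.

(* The errors of the four quarters, and those due to the rounding of [wfun]. *)
Definition err_w : Z := (b_w0.2 + b_w1.2 + b_w2.2)%ZZ.
Definition kbound : Z := Eval vm_compute in
  (pow2 30 * (b_K.1 - b_K.2 - 10 * err_w - 1) - pow2 44 * (4 * 256 * 64))%ZZ.

(** [E] is the tangent plane of [|c|^2] at the centre [(m, n)] of the box, evaluated at the vertex
    [(i, j)] and scaled by [2^44]. Lowering [|c|^2] to it can only raise the value to be bounded. *)
Definition vertex_ok (i j m n : Z) : bool :=
  let E := (pow2 20 * (2 * (m * i + n * j) - (m * m + n * n)))%ZZ in
  [&& (Z.abs i <=? 8192)%ZZ, (Z.abs j <=? 4096)%ZZ, (Z.abs E <=? 6 * pow2 44)%ZZ &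
      (total i j E <=? kbound)%ZZ].

Definition in_disc (x y i j : Z) : bool :=
  ((i - x) * (i - x) + (j - y) * (j - y) <=? 40 * 40)%ZZ.

Definition box_ok (x y hx hy : Z) : bool :=
  [&& vertex_ok (x + hx) (y + hy) x y, vertex_ok (x - hx) (y - hy) x y,
      vertex_ok (x + hx) (y - hy) x y & vertex_ok (x - hx) (y + hy) x y].
Definition box_disc (u w x y hx hy : Z) : bool :=
  [&& in_disc u w (x + hx) (y + hy), in_disc u w (x - hx) (y - hy),
      in_disc u w (x + hx) (y - hy) & in_disc u w (x - hx) (y + hy)].
(** [(7363, 0)] and [(3065, 3677)] are the contact points of the first quadrant, scaled by [2^12]
    and rounded; boxes inside the discs around them are left to the local analysis. *)
Fixpoint boxes (n : nat) (x y hx hy : Z) : bool :=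
  if n is n'.+1 then
    if box_disc 7363 0 x y hx hy then true
    else if box_disc 3065 3677 x y hx hy then true
    else if box_ok x y hx hy then true
    else if (hy <=? hx)%ZZ then
      let h := Z.div2 hx in boxes n' (x - h) y h hy && boxes n' (x + h) y h hy
    else
      let h := Z.div2 hy in boxes n' x (y - h) hx h && boxes n' x (y + h) hx h
  else false.

(** * Correctness of the integer program *)

HB.lock Definition rp2 {R : realType} (k : Z) : R := ZR (pow2 k).

Section rounding.
Context {R : realType}.
Implicit Types (x : R) (k n m : Z).
Local Notation U := (@scale R).
Local Notation ZR m := (@ZR R m%ZZ).
Local Notation rp2 k := (@rp2 R k%ZZ).

Lemma rp2E k : ZR (pow2 k) = rp2 k :> R. Proof. by rewrite rp2.unlock. Qed.
Lemma rp2_gt0 k : (0 <= k)%ZZ -> 0 < rp2 k :> R.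
Proof. by move=> k0; rewrite -rp2E -ZR0; apply: ltr_ZR; apply: Z.pow_pos_nonneg. Qed.
Lemma rp2D k n : (0 <= k)%ZZ -> (0 <= n)%ZZ -> rp2 (k + n) = rp2 k * rp2 n :> R.
Proof. by move=> k0 n0; rewrite -!rp2E -ZRM; congr (ZR _); exact: Z.pow_add_r. Qed.
Lemma scale_rp2 : U = rp2 prec. Proof. by rewrite UE -rp2E. Qed.

Lemma ZR_shiftr_rp2 m n : (0 <= n)%ZZ ->
  ZR (Z.shiftr m n) * rp2 n <= ZR m < (ZR (Z.shiftr m n) + 1) * rp2 n.
Proof.
move=> n0; rewrite -rp2E -ZR1 -ZRD -!ZRM (Z.shiftr_div_pow2 m n n0).
have := Z.pow_pos_nonneg 2 n ltac:(lia) n0; rewrite /pow2.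
move: (2 ^ n)%ZZ => p P.
have := Z.div_mod m p ltac:(lia); have := Z.mod_pos_bound m p P.
move: (m mod p)%ZZ (m / p)%ZZ => r d *.
by rewrite ler_ZR ?ltr_ZR//; lia.
Qed.

Lemma rndP e k (b : zball) x : (0 <= k)%ZZ -> (k <= prec)%ZZ -> inb b x ->
  rnd_ok e k b -> `|ZR (rnd k b) - x * rp2 k| <= ZR e + 1.
Proof.
move=> k0 kp; rewrite inbP scale_rp2 /rnd_ok /rnd => /andP[h1 h2] /Z.leb_le/(@ler_ZR R).
have n0 : (0 <= prec - k)%ZZ by lia.
have E : prec = (k + (prec - k))%ZZ by lia.
move: h1 h2; rewrite {1 2}E rp2D// (ZRM e) rp2E.
have /andP[] := ZR_shiftr_rp2 b.1 n0; have := rp2_gt0 n0.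
move: (rp2 (prec - k)) (rp2 k) (ZR (Z.shiftr _ _)) (ZR b.1) (ZR b.2) (ZR e).
move=> p pk s m r f p0 s1 s2 h1 h2 rf.
rewrite ler_norml -(ler_pM2r p0) -[X in _ && X](ler_pM2r p0); apply/andP; split.
- rewrite mulNr mulrBl mulrDl mul1r; move: h2 s2; rewrite mulrDl mul1r mulrA; lra.
- rewrite mulrBl mulrDl mul1r; move: h1 s1; rewrite mulrA; lra.
Qed.

End rounding.

Section derivatives.
Context {R : realType}.
Implicit Types (t : R).
Context (p0 p1 p2 p3 c1 c2 e : R).

Definition dgpoly t : R :=
  -2 * sin (2 * t) * (p1 + 2 * p2 * zc t + 3 * p3 * zc t ^+ 2) - 4 * c1 * sin t + 2 * c2 * cos t.
Definition ddwpoly (z : R) : R :=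
  8 * p2 + (24 * p3 - 4 * p1) * z - 16 * p2 * z ^+ 2 - 36 * p3 * z ^+ 3.
Definition ddgpoly t : R := ddwpoly (zc t) - 4 * c1 * cos t - 2 * c2 * sin t.

Lemma is_derive_gpoly t : is_derive t 1 (gpoly p0 p1 p2 p3 c1 c2 e) (dgpoly t).
Proof.
have dz := @is_derive_zc R t.
rewrite /gpoly /wpoly /lin4; apply: is_derive_eq.
rewrite /dgpoly /GRing.scale/= ?expr1; ring.
Qed.

Lemma is_derive_dgpoly t : is_derive t 1 dgpoly (ddgpoly t).
Proof.
have dz := @is_derive_zc R t; have ds := @is_derive_sin_double R t.
rewrite /dgpoly; apply: is_derive_eq.
rewrite /ddgpoly /ddwpoly /GRing.scale/= ?expr1.
have E : sin (2 * t) ^+ 2 = 1 - zc t ^+ 2.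
  by have := cos2Dsin2 (2 * t); rewrite -/(zc t); lra.
ring: E.
Qed.

End derivatives.

Section table.
Context {R : realType}.
Implicit Types (t x a b : R).
Local Notation U := (@scale R).
Local Notation q := (pi / 2 : R).
Local Notation s := (@ellipse_speed R).
Local Notation ZR m := (@ZR R m%ZZ).
Local Notation rp2 k := (@rp2 R k%ZZ).

Definition wr k : R := ZR (nth 0%ZZ wz k) / U.
Definition wt : R -> R := wpoly (wr 0) (wr 1) (wr 2) (wr 3).
Definition wint t : R :=
  lin4 (wr 0) (wr 1) (wr 2) (wr 3) (moment 0 t) (moment 1 t) (moment 2 t) (moment 3 t).

Definition data_at (d : ndata) t : Prop :=
  [/\ `|ZR (dW d) - wt t * rp2 44| <= 17, `|ZR (dX d) - 4 * cos t * rp2 32| <= 2,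
      `|ZR (dY d) - 2 * sin t * rp2 32| <= 2 &
   [/\ `|ZR (dF0 d) - wint t * rp2 38| <= 2, `|ZR (dFX d) - xmoment t * rp2 38| <= 2,
       `|ZR (dFY d) - ymoment t * rp2 38| <= 2 & `|ZR (dF3 d) - moment 0 t * rp2 38| <= 2]].

Lemma wt_hornerZ t : wt t = hornerZ wz (zc t) / U.
Proof. by rewrite /wt /wpoly /lin4 /wr /wz /=; field; rewrite gt_eqF// U_gt0. Qed.

Lemma data_ofP n t : node_at n t -> 0 <= t <= 2 -> bdata_ok (bdata_of n) ->
  data_at (ndata_of (bdata_of n)) t.
Proof.
move=> nt t02 /and5P[k1 k2 k3 k4 /and3P[k5 k6 k7]]; have [_ c s'] := nt.
have z := inb_nzc nt.
have m0 := @inb_bmoment R n t 0 isT t02 nt; have m1 := @inb_bmoment R n t 1 isT t02 nt.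
have m2 := @inb_bmoment R n t 2 isT t02 nt; have m3 := @inb_bmoment R n t 3 isT t02 nt.
have e2 : 2 = ZR 1 + 1 :> R by rewrite ZR1.
have e17 : 17 = ZR 16 + 1 :> R by rewrite -[ZR 16]/(ZR (Z.of_nat 16)) ZR_nat natr1.
have P44 : (0 <= 44)%ZZ /\ (44 <= prec)%ZZ by split; exact/Z.leb_le.
have P32 : (0 <= 32)%ZZ /\ (32 <= prec)%ZZ by split; exact/Z.leb_le.
have P38 : (0 <= 38)%ZZ /\ (38 <= prec)%ZZ by split; exact/Z.leb_le.
split; [|rewrite [leRHS]e2|rewrite [leRHS]e2|split; rewrite [leRHS]e2].
- rewrite e17; apply: (rndP P44.1 P44.2 _ k1).
  by rewrite wt_hornerZ; exact: inb_hornerB.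
- apply: (rndP P32.1 P32.2 _ k2).
  by rewrite -[4](ZR_nat 4); exact: (inb_scale 4).
- apply: (rndP P32.1 P32.2 _ k3).
  by rewrite -ZR2; exact: (inb_scale 2).
- apply: (rndP P38.1 P38.2 _ k4).
  have C k : inb (bcst (nth 0%ZZ wz k)) (wr k) by exact: inb_cst.
  exact: (inb_lin4 (C 0%N) (C 1%N) (C 2%N) (C 3%N) m0 m1 m2 m3).
- by apply: (rndP P38.1 P38.2 _ k5); exact: inb_bxmoment.
- by apply: (rndP P38.1 P38.2 _ k6); exact: inb_bymoment.
- by apply: (rndP P38.1 P38.2 _ k7).
Qed.

Fixpoint tree_at (t : tree) a b : Prop :=
  match t with
  | Leaf hs => exists2 S, {in `[a, b], forall x, 0 <= s x <= S} &
                 S * ((b - a) / 2) <= ZR hs / rp2 20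
  | TNode d l r => [/\ data_at d ((a + b) / 2), tree_at l a ((a + b) / 2) &
                       tree_at r ((a + b) / 2) b]
  end.

Lemma le_speed x y : 0 <= x -> x <= y -> y <= q -> s x <= s y.
Proof.
move=> x0 xy yq; rewrite !speedE; apply: ler_wsqrtr.
suff : zc y <= zc x by lra.
rewrite /zc leNgt ltr_cos -?leNgt ?in_itv/= ?ler_pM2l//; lra.
Qed.

Lemma bbuildP fs n m a b : node_at n a -> node_at m b -> 0 <= a -> a <= b -> b <= q ->
  (forall k, (k < size fs)%N -> cos ((b - a) / 2 ^+ k.+1) != 0 /\
     inb (nth (0, 0)%ZZ fs k) (2 * cos ((b - a) / 2 ^+ k.+1))^-1) ->
  btree_ok (bbuild fs n m) -> bleaf_ok fs n m -> tree_at (tree_of (bbuild fs n m)) a b.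
Proof.
elim: fs n m a b => [|f fs IH] n m a b na mb a0 ab bq hf.
  move=> _ k; have z := inb_nzc mb.
  change (is_true (Z.leb (bhalf (bsub (bint 5) (bscale 3 (nzc m)))).2 (bhalf (bsub (bint 5) (bscale 3 (nzc m)))).1)) in k.
  exists (s b).
    move=> x; rewrite in_itv/= => /andP[ax xb].
    by rewrite (le_trans _ (ellipse_speed_ge1 x))//= le_speed//; lra.
  have sb : inb (bsqrt (bhalf (bsub (bint 5) (bscale 3 (nzc m))))) (s b).
    rewrite speedE; apply: (inb_sqrt k); apply: inb_half; apply: inb_sub.
      exact: (inb_int5 5).
    by rewrite -[3](ZR_nat 3); exact: (inb_scale 3).
  have := inb_mul sb (inb_half (inb_sub (let: And3 x _ _ := mb in x) (let: And3 x _ _ := na in x))).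
  move/inbP => /andP[_]; rewrite -ZRD.
  move: (_ + _)%ZZ => h hle.
  have P20 : (0 <= 20)%ZZ by []. have P32 : (0 <= prec - 20)%ZZ by [].
  rewrite ler_pdivlMr ?rp2_gt0// -(ler_pM2r (rp2_gt0 P32)) -mulrA -rp2D//.
  rewrite ZRD ZR1; have /andP[_ /ltW] := @ZR_shiftr_rp2 R h _ P32.
  by apply: le_trans; rewrite -[(20 + _)%ZZ]/prec -scale_rp2.
case/and3P => k1 k2 k3 /andP[l1' l2'].
have [c0 f0] := hf 0%N isT; rewrite expr1 in c0 f0.
have nm := nmidP na mb c0 f0; have q2 := @q_lt2 R.
have hf' c d : d - c = (b - a) / 2 -> forall k, (k < size fs)%N ->
   cos ((d - c) / 2 ^+ k.+1) != 0 /\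
     inb (nth (0, 0)%ZZ fs k) (2 * cos ((d - c) / 2 ^+ k.+1))^-1.
  move=> -> k kf; have := hf k.+1 kf.
  by rewrite [2 ^+ k.+2]exprS invfM mulrA.
split.
- by apply: data_ofP => //; lra.
- by apply: IH => //; try lra; apply: hf'; lra.
- by apply: IH => //; try lra; apply: hf'; lra.
Qed.

Lemma tabP : [/\ tree_at tab 0 q, data_at data0 0 & data_at dataq q].
Proof.
have [E1 E2 E3] := btabE; have [F1 F2 F3 /and4P[k1 k2 k3 k4]] := tabE.
have q0 := @q_gt0 R; have q2 := @q_lt2 R.
rewrite F1 F2 F3; rewrite E1 in k1 *; rewrite E2 in k2 *; rewrite E3 in k3 *.
split.
- have H k : (k < size (take depth bisect_factors))%N ->
      cos ((q - 0) / 2 ^+ k.+1) != 0 /\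
      inb (nth (0, 0)%ZZ (take depth bisect_factors) k) (2 * cos ((q - 0) / 2 ^+ k.+1))^-1.
    move=> kd; have {}kd : (k < 8)%N by exact: kd.
    rewrite (subr0 q); split; first by apply: lt0r_neq0; exact: cos_dyadic_gt0.
    have -> : nth (0, 0)%ZZ (take depth bisect_factors) k = nth (0, 0)%ZZ bisect_factors k.
      exact: (nth_take _ kd).
    exact: (inb_factor (leq_trans kd (isT : (8 <= 34)%N))).
  exact: (bbuildP (@node0P R) (@nodeqP R) (lexx 0) (ltW q0) (lexx q) H k1 k4).
- have B : 0 <= (0 : R) <= 2 by rewrite lexx ler0n.
  exact: (data_ofP (@node0P R) B k2).
- have B : 0 <= q <= 2 by rewrite !ltW.
  exact: (data_ofP (@nodeqP R) B k3).
Qed.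

End table.

Fixpoint height (t : tree) : nat :=
  if t is TNode _ l r then (maxn (height l) (height r)).+1 else 0%N.
Fixpoint leaves (t : tree) : nat :=
  if t is TNode _ l r then (leaves l + leaves r)%N else 1%N.

Lemma wz_check :
  [&& Z.leb (1000 * - nth 0 wz 1) (1614 * bunit), Z.leb (1613 * bunit) (1000 * - nth 0 wz 1),
      Z.leb (1000 * nth 0 wz 2) (1 * bunit), Z.leb (1000 * - nth 0 wz 2) (1 * bunit),
      Z.leb (10000 * nth 0 wz 3) (1201 * bunit) & Z.leb (1199 * bunit) (10000 * nth 0 wz 3)]%ZZ.
Proof. by vm_compute. Qed.
Lemma kap0_check :
  Z.leb (31 * ((bsqr bhalfpi).1 + (bsqr bhalfpi).2)) (16 * pow2 8 * kap0) /\
  forall m, (m <= 8)%N -> nth 0%ZZ kaps m = (Z.shiftr kap0 (2 * Z.of_nat m) + 25001)%ZZ.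
Proof. by split; [vm_compute|do 9?case=> //]. Qed.
Lemma tab_check : height tab = 8%N /\ leaves tab = 256%N.
Proof. by vm_compute. Qed.

Section go.
Context {R : realType}.
Implicit Types (t x a b : R).
Local Notation U := (@scale R).
Local Notation q := (pi / 2 : R).
Local Notation s := (@ellipse_speed R).
Local Notation ZR m := (@ZR R m%ZZ).
Local Notation rp2 k := (@rp2 R k%ZZ).

Local Notation wr k := (@wr R k).

Lemma rp2_gt0_44 : 0 < rp2 44. Proof. by apply: rp2_gt0; apply/Z.leb_le. Qed.
Lemma rp2_gt0_38 : 0 < rp2 38. Proof. by apply: rp2_gt0; apply/Z.leb_le. Qed.
Lemma rp2_gt0_24 : 0 < rp2 24. Proof. by apply: rp2_gt0; apply/Z.leb_le. Qed.

Lemma ZR_div_le (n : Z) (c d : nat) : (0 < d)%N ->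
  Z.leb (Z.of_nat d * n) (Z.of_nat c * bunit) -> ZR n / U <= c%:R / d%:R.
Proof.
move=> d0 /Z.leb_le/(@ler_ZR R); rewrite (ZRM (Z.of_nat d)) (ZRM (Z.of_nat c)) -UE !ZR_nat => h.
by rewrite ler_pdivrMr ?U_gt0// mulrAC ler_pdivlMr ?ltr0n// mulrC.
Qed.
Lemma ZR_div_ge (n : Z) (c d : nat) : (0 < d)%N ->
  Z.leb (Z.of_nat c * bunit) (Z.of_nat d * n) -> c%:R / d%:R <= ZR n / U.
Proof.
move=> d0 /Z.leb_le/(@ler_ZR R); rewrite (ZRM (Z.of_nat d)) (ZRM (Z.of_nat c)) -UE !ZR_nat => h.
by rewrite ler_pdivlMr ?U_gt0// mulrAC ler_pdivrMr ?ltr0n// [leRHS]mulrC.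
Qed.

Lemma wr_bounds : [/\ -1614 / 1000 <= wr 1 <= -1613 / 1000,
  -1 / 1000 <= wr 2 <= 1 / 1000 & 1199 / 10000 <= wr 3 <= 1201 / 10000].
Proof.
have /and5P[k1 k2 k3 k4 /andP[k5 k6]] := wz_check.
have := @ZR_div_le _ 1614 1000 isT k1; have := @ZR_div_ge _ 1613 1000 isT k2.
have := @ZR_div_le _ 1 1000 isT k3; have := @ZR_div_le _ 1 1000 isT k4.
have := @ZR_div_le _ 1201 10000 isT k5; have := @ZR_div_ge _ 1199 10000 isT k6.
rewrite (ZRN (nth 0%ZZ wz 1)) (ZRN (nth 0%ZZ wz 2)) !mulNr -/(wr 1) -/(wr 2) -/(wr 3).
move: (wr 1) (wr 2) (wr 3) => x y z *; split; lra.
Qed.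

Lemma ddwpoly_le (p1 p2 p3 z : R) : -1614 / 1000 <= p1 <= -1613 / 1000 ->
  -1 / 1000 <= p2 <= 1 / 1000 -> 1199 / 10000 <= p3 <= 1201 / 10000 -> `|z| <= 1 ->
  `|ddwpoly p1 p2 p3 z| <= 545 / 100.
Proof.
move=> h1 h2 h3 z1.
have K (A B y : R) : 93 / 10 <= A <= 934 / 100 -> 4316 / 1000 <= B <= 433 / 100 ->
    0 <= y <= 1 -> 0 <= A * y - B * y ^+ 3 <= 54 / 10.
  move=> /andP[A1 A2] /andP[B1 B2] /andP[y0 y1].
  have y3 : 0 <= y ^+ 3 by rewrite exprn_ge0.
  have y31 : y ^+ 3 <= y by rewrite exprS ler_piMr// exprn_ile1.
  have e1 : A * y <= 934 / 100 * y by rewrite ler_wpM2r.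
  have e2 : 93 / 10 * y <= A * y by rewrite ler_wpM2r.
  have e3 : B * y ^+ 3 <= 433 / 100 * y ^+ 3 by rewrite ler_wpM2r.
  have e4 : 4316 / 1000 * y ^+ 3 <= B * y ^+ 3 by rewrite ler_wpM2r.
  (* 0.85 is close to the maximizer of [A y - B y^3]. Since 1.7 is twice 0.85, the product
     [(y + 1.7) (y - 0.85)^2] has no square term and bounds [y^3] from below by an affine
     function. *)
  have y17 : 0 <= y + 17 / 10 by lra.
  have := mulr_ge0 y17 (sqr_ge0 (y - 85 / 100)).
  move: (A * y) (B * y ^+ 3) e1 e2 e3 e4 => ? ? *.
  apply/andP; split; lra.
have -> : ddwpoly p1 p2 p3 z = 8 * p2 * (1 - 2 * z ^+ 2) +
  ((24 * p3 - 4 * p1) * z - 36 * p3 * z ^+ 3) by rewrite /ddwpoly; ring.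
have A : 93 / 10 <= 24 * p3 - 4 * p1 <= 934 / 100 by lra.
have B : 4316 / 1000 <= 36 * p3 <= 433 / 100 by lra.
have z2 : 0 <= z ^+ 2 <= 1 by rewrite sqr_ge0 -[z ^+ 2]real_normK ?num_real// exprn_ile1.
have : `|8 * p2 * (1 - 2 * z ^+ 2)| <= 1 / 100.
  rewrite normrM; apply: le_trans (_ : 1 / 100 * 1 <= _); last by rewrite mulr1.
  by apply: ler_pM => //; rewrite ler_norml; lra.
move: z1; rewrite !ler_norml => /andP[z1 z1'] /andP[e1 e2].
have [z0|/ltW z0] := leP 0 z.
  have zz : 0 <= z <= 1 by rewrite z0.
  have /andP[k1 k2] := K _ _ z A B zz; clear -k1 k2 e1 e2.
  by apply/andP; split; lra.
have zz : 0 <= - z <= 1 by rewrite oppr_ge0 z0 lerNl.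
have /andP[] := K _ _ (- z) A B zz; have -> : (- z) ^+ 3 = - z ^+ 3 by ring.
by move=> k1 k2; clear -k1 k2 e1 e2; apply/andP; split; lra.
Qed.

Lemma sgn24 x (n : Z) : x * rp2 24 = ZR n ->
   [/\ (n <= 0)%ZZ -> x <= 0, (0 <= n)%ZZ -> 0 <= x, (0 < n)%ZZ -> 0 < x & (n < 0)%ZZ -> x < 0].
Proof.
have P := rp2_gt0_24; move=> xn; split.
- by move/(@ler_ZR R); rewrite ZR0 -xn pmulr_lle0.
- by move/(@ler_ZR R); rewrite ZR0 -xn pmulr_lge0.
- by move/(@ltr_ZR R); rewrite ZR0 -xn pmulr_lgt0.
- by move/(@ltr_ZR R); rewrite ZR0 -xn pmulr_llt0.
Qed.

Lemma chord_div x y (m n : Z) : x * rp2 24 = ZR m -> y * rp2 24 = ZR n ->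
  (n < 0)%ZZ -> (0 < m)%ZZ -> x ^+ 2 / (x - y) * rp2 24 <= ZR (m * m / (m - n) + 1).
Proof.
have P := rp2_gt0_24; move=> xm yn n0 m0.
have mn : (0 < m - n)%ZZ by apply/Z.lt_0_sub; exact: Z.lt_trans n0 m0.
have [_ _ x0 _] := sgn24 xm; have [_ _ _ y0] := sgn24 yn.
have xy : 0 < x - y by rewrite subr_gt0 (lt_trans (y0 n0) (x0 m0)).
rewrite mulrAC ler_pdivrMr// -(ler_pM2r P).
have -> : x ^+ 2 * rp2 24 * rp2 24 = ZR (m * m) by rewrite ZRM -xm; ring.
have -> : ZR (m * m / (m - n) + 1) * (x - y) * rp2 24 = ZR ((m * m / (m - n) + 1) * (m - n)).
  by rewrite ZRM ZRB -xm -yn; ring.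
apply: ler_ZR; have := Z.mul_succ_div_gt (m * m) _ mn.
by rewrite -Z.add_1_r (Z.mul_comm (_ + 1)) => /Z.lt_le_incl.
Qed.

Context (i j E : Z) (c1 c2 e : R).
Context (ic : ZR i = c1 * rp2 12) (jc : ZR j = c2 * rp2 12) (Ee : ZR E = e * rp2 44).
Context (c1b : `|c1| <= 2) (c2b : `|c2| <= 1) (eb : `|e| <= 6).

Definition gt : R -> R := gpoly (wr 0) (wr 1) (wr 2) (wr 3) c1 c2 e.
Definition gts t : R := posp (gt t) * s t.

Lemma continuous_gt : continuous gt. Proof. exact: continuous_gpoly. Qed.
Lemma continuous_gts : continuous gts.
Proof.
apply: continuous_M; last exact: continuous_ellipse_speed.
by apply: continuous_posp; exact: continuous_gt.
Qed.

(** The second derivative is at most [5.45 + 4 * 2 + 2 * 1 <= 31 / 2], and [31 / 16] is an eighth of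
    this. *)
Lemma gt_chord a b x : a <= x <= b ->
  `|gt x * (b - a) - (gt a * (b - x) + gt b * (x - a))| <= 31 / 16 * (b - a) ^+ 2 * (b - a).
Proof.
move=> axb; have [w1' w2' w3'] := wr_bounds.
have := @chord_error R gt (dgpoly (wr 1) (wr 2) (wr 3) c1 c2)
  (ddgpoly (wr 1) (wr 2) (wr 3) c1 c2) (31 / 2) a b x axb.
rewrite (_ : 31 / 2 / 8 = 31 / 16); last by field.
apply.
- by move=> u _; exact: is_derive_gpoly.
- by move=> u _; exact: is_derive_dgpoly.
- move=> u _; rewrite /ddgpoly.
  have := ddwpoly_le w1' w2' w3' (zc_le1 u).
  have : `|c1 * cos u| <= 2 * 1.
    by rewrite normrM; apply: ler_pM => //; rewrite ler_norml cos_geN1 cos_le1.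
  have : `|c2 * sin u| <= 1 * 1.
    by rewrite normrM; apply: ler_pM => //; rewrite ler_norml sin_geN1 sin_le1.
  rewrite -[4 * c1 * cos u]mulrA -[2 * c2 * sin u]mulrA.
  move: (ddwpoly _ _ _ _) (c1 * cos u) (c2 * sin u) => y1 y2 y3.
  rewrite !ler_norml; clear w1' w2' w3' axb => /andP[? ?] /andP[? ?] /andP[? ?].
  by apply/andP; split; lra.
Qed.

(** 25000 exceeds [17 + 2 * 8192 + 2 * 4096], the rounding errors of [dW], [i * dX] and [j * dY]. *)
Definition near_g (g : Z) a : Prop := `|ZR g - gt a * rp2 44| <= ZR 25000.

Lemma norm_ij : `|ZR i| <= ZR 8192 /\ `|ZR j| <= ZR 4096.
Proof.
have P : 0 <= rp2 12 by apply/ltW/rp2_gt0.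
rewrite ic jc !normrM (ger0_norm P) -rp2E; split.
- apply: le_trans (ler_wpM2r _ c1b) _; first by rewrite rp2E.
  by rewrite -ZR2 -ZRM; apply: ler_ZR; apply/Z.leb_le.
- apply: le_trans (ler_wpM2r _ c2b) _; first by rewrite rp2E.
  by rewrite mul1r; apply: ler_ZR; apply/Z.leb_le.
Qed.

Lemma gvalP d a : data_at d a -> near_g (gval d i j E) a.
Proof.
move=> [h1 h2 h3 _]; have [ib jb] := norm_ij; rewrite /near_g /gval.
rewrite (ZRB (_ + _ + _)) (ZRD (_ + _)) (ZRD (dW d)) (ZRM i) (ZRM j) Ee.
have -> : ZR (dW d) + ZR i * ZR (dX d) + ZR j * ZR (dY d) - e * rp2 44 - gt a * rp2 44
   = (ZR (dW d) - wt a * rp2 44) + ZR i * (ZR (dX d) - 4 * cos a * rp2 32)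
     + ZR j * (ZR (dY d) - 2 * sin a * rp2 32).
  by rewrite ic jc (_ : 44 = 12 + 32)%ZZ// rp2D// /gt /gpoly -/(wt a); ring.
apply: le_trans (ler_normD _ _) _; apply: le_trans (lerD (ler_normD _ _) (lexx _)) _.
rewrite !normrM.
have m1 := ler_pM (normr_ge0 _) (normr_ge0 _) ib h2.
have m2 := ler_pM (normr_ge0 _) (normr_ge0 _) jb h3.
apply: le_trans (lerD (lerD h1 m1) m2) _.
have -> : 17 = ZR 17 by rewrite -[ZR 17]/(ZR (Z.of_nat 17)) ZR_nat.
rewrite -ZR2 -(ZRM 8192) -(ZRM 4096) -(ZRD 17) -(ZRD (17 + _)).
by apply: ler_ZR; apply/Z.leb_le.
Qed.

Lemma posg a b k ga gb : a <= b -> near_g ga a -> near_g gb b ->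
  31 / 16 * (b - a) ^+ 2 * rp2 44 + ZR 25000 <= ZR k -> ZR k <= ZR ga -> ZR k <= ZR gb ->
  {in `[a, b], forall x, 0 <= gt x}.
Proof.
move=> ab; rewrite /near_g !ler_norml => /andP[a1' a2'] /andP[b1' b2'] kk' ka kb x.
rewrite in_itv/= => /andP[ax xb].
move: ab; rewrite le_eqVlt => /predU1P[ab|ab].
  have xa : x = a by apply/le_anti; rewrite ax andbT ab.
  have P := rp2_gt0_44.
  rewrite xa -(pmulr_lge0 _ P); move: kk'; rewrite ab subrr expr0n/= mulr0 mul0r; lra.
have ba : 0 < b - a by lra.
have := @gt_chord a b x; rewrite ax xb => /(_ isT); rewrite ler_norml => /andP[h _].
have P := rp2_gt0_44.
rewrite -(pmulr_lge0 _ ba) -(pmulr_lge0 _ P).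
have m1 : (31 / 16 * (b - a) ^+ 2 * rp2 44) * (b - x) <= gt a * rp2 44 * (b - x).
  by rewrite ler_wpM2r//; lra.
have m2 : (31 / 16 * (b - a) ^+ 2 * rp2 44) * (x - a) <= gt b * rp2 44 * (x - a).
  by rewrite ler_wpM2r//; lra.
rewrite -(ler_pM2r P) in h; lra.
Qed.

Lemma negg a b k ga gb : a <= b -> near_g ga a -> near_g gb b ->
  31 / 16 * (b - a) ^+ 2 * rp2 44 + ZR 25000 <= ZR k -> ZR ga <= - ZR k -> ZR gb <= - ZR k ->
  {in `[a, b], forall x, gt x <= 0}.
Proof.
move=> ab; rewrite /near_g !ler_norml => /andP[a1' a2'] /andP[b1' b2'] kk' ka kb x.
rewrite in_itv/= => /andP[ax xb].
move: ab; rewrite le_eqVlt => /predU1P[ab|ab].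
  have xa : x = a by apply/le_anti; rewrite ax andbT ab.
  have P := rp2_gt0_44.
  rewrite xa -(pmulr_lle0 _ P); move: kk'; rewrite ab subrr expr0n/= mulr0 mul0r; lra.
have ba : 0 < b - a by lra.
have := @gt_chord a b x; rewrite ax xb => /(_ isT); rewrite ler_norml => /andP[_ h].
have P := rp2_gt0_44.
rewrite -(pmulr_lle0 _ ba) -(pmulr_lle0 _ P).
have m1 : (31 / 16 * (b - a) ^+ 2 * rp2 44) * (b - x) <= - (gt a * rp2 44) * (b - x).
  by rewrite ler_wpM2r//; lra.
have m2 : (31 / 16 * (b - a) ^+ 2 * rp2 44) * (x - a) <= - (gt b * rp2 44) * (x - a).
  by rewrite ler_wpM2r//; lra.
rewrite -(ler_pM2r P) in h; lra.
Qed.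

(** The rounding error of one cell: a difference of two table entries is off by at most 4, and the
    coefficients are bounded by 1, 4, 2 and 6, so that [4 * 13 = 52] units would occur at worst. *)
Definition eta : R := 64 / rp2 38.
Definition VA (v : acc) : R :=
  (ZR (s0 v) + 2 * c1 * ZR (sX v) + 2 * c2 * ZR (sY v) - e * ZR (s3 v)) / rp2 38
  + ZR (sC v) / rp2 44.

Lemma acc_cellP da db a b v : data_at da a -> data_at db b -> 0 <= a -> a <= b ->
  itg (fun t => gt t * s t) a b <= VA (acc_cell da db v) - VA v + eta.
Proof.
move=> [_ _ _ [a0' aX aY a3]] [_ _ _ [b0' bX bY b3]] a0 ab.
rewrite itg_gpoly//.
have P := rp2_gt0_38.
rewrite -(ler_pM2r P) /eta [leRHS]mulrDl divfK ?gt_eqF//.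
have -> : (VA (acc_cell da db v) - VA v) * rp2 38 =
  (ZR (dF0 db) - ZR (dF0 da)) + 2 * c1 * (ZR (dFX db) - ZR (dFX da))
  + 2 * c2 * (ZR (dFY db) - ZR (dFY da)) - e * (ZR (dF3 db) - ZR (dF3 da)).
  rewrite /VA /acc_cell /s0 /sX /sY /s3 /sC.
  case: v => v0 vX vY v3 vC; rewrite !(ZRD v0, ZRD vX, ZRD vY, ZRD v3, ZRB).
  by field; rewrite !gt_eqF// ?rp2_gt0_38 ?rp2_gt0_44.
rewrite /prim_gpoly -/(wint a) -/(wint b).
have T (k K x y : R) : `|k| <= K -> `|x| <= 2 -> `|y| <= 2 -> `|k * (x - y)| <= K * 4.
  move=> kK x2 y2; rewrite normrM; apply: ler_pM => //.
  by apply: le_trans (ler_normB _ _) _; lra.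
have n1 : `|1 : R| <= 1 by rewrite normr1.
have n2 : `|2 * c1| <= 4 by rewrite normrM ger0_norm//; move: c1b; lra.
have n3 : `|2 * c2| <= 2 by rewrite normrM ger0_norm//; move: c2b; lra.
have d1 := T 1 1 _ _ n1 b0' a0'; have d2' := T _ 4 _ _ n2 bX aX.
have d3' := T _ 2 _ _ n3 bY aY.
have d4' := T e 6 _ _ eb b3 a3.
move: d1 d2' d3' d4'; rewrite !ler_norml.
clear T a0' aX aY a3 b0' bX bY b3 a0 ab => /andP[? ?] /andP[? ?] /andP[? ?] /andP[? ?].
lra.
Qed.

Lemma chordvP (a' b' : Z) (S A B : R) a b : a < b ->
  {in `[a, b], forall x, 0 <= s x <= S} ->
  {in `[a, b], forall x, gt x * (b - a) <= A * (b - x) + B * (x - a)} ->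
  A * rp2 24 = ZR a' -> B * rp2 24 = ZR b' ->
  itg gts a b * rp2 24 <= S * ((b - a) / 2) * ZR (chordv a' b').
Proof.
move=> ab sS gAB Aa Bb.
have P := rp2_gt0_24.
have S0 : 0 <= S * ((b - a) / 2).
  have /sS/andP[s0' s1'] : a \in `[a, b] by rewrite in_itv/= lexx ltW.
  by apply: mulr_ge0; [exact: le_trans s1'|lra].
have [c1' c2' c3' c4'] := itg_posp_chord continuous_gt (@continuous_ellipse_speed R) ab sS gAB.
rewrite -/gts in c1' c2' c3' c4'.
have [A1 A2 A3 A4] := sgn24 Aa; have [B1 B2 B3 B4] := sgn24 Bb.
rewrite /chordv; case: (Z.leb_spec a' 0) => ha.
- case: (Z.leb_spec b' 0) => hb.
    by rewrite ZR0 mulr0 pmulr_lle0//; apply: c1'; [exact: A1|exact: B1].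
  have [{}ha|{}ha] := (Z.lt_eq_cases a' 0).1 ha.
    apply: le_trans (_ : S * ((b - a) / 2 * (B ^+ 2 / (B - A))) * rp2 24 <= _).
      by rewrite ler_pM2r//; apply: c4'; [exact: A4|exact: B3].
    rewrite mulrA -mulrA; apply: ler_wpM2l => //; exact: chord_div.
  (* The case [a' = 0] falls to the quotient branch of [chordv]; there [b' * b' / b'] is [b']
     itself, and the trapezoid bound applies. *)
  have A0 : A = 0 by apply/eqP; rewrite -(mulIr_eq0 _ (mulIf (lt0r_neq0 P))) Aa ha ZR0.
  apply: le_trans (_ : S * ((b - a) / 2 * (A + B)) * rp2 24 <= _).
    by rewrite ler_pM2r//; apply: c2'; [rewrite A0|apply/ltW/B3].
  rewrite mulrA -mulrA; apply: ler_wpM2l => //.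
  rewrite A0 add0r Bb; apply: ler_ZR; rewrite ha Z.sub_0_r Z.div_mul.
    by clear; move: b' => b'; lia.
  by move=> b0; rewrite b0 in hb; exact: (Z.lt_irrefl 0).
- case: (Z.ltb_spec b' 0) => hb.
    apply: le_trans (_ : S * ((b - a) / 2 * (A ^+ 2 / (A - B))) * rp2 24 <= _).
      by rewrite ler_pM2r//; apply: c3'; [exact: A3|exact: B4].
    rewrite mulrA -mulrA; apply: ler_wpM2l => //; exact: chord_div.
  apply: le_trans (_ : S * ((b - a) / 2 * (A + B)) * rp2 24 <= _).
    by rewrite ler_pM2r//; apply: c2'; [apply/ltW/A3|exact: B2].
  by rewrite mulrA -mulrA; apply: ler_wpM2l => //; rewrite mulrDl Aa Bb ZRD.
Qed.

End go.

Section go_spec.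
Context {R : realType}.
Implicit Types (t x a b : R).
Local Notation U := (@scale R).
Local Notation q := (pi / 2 : R).
Local Notation s := (@ellipse_speed R).
Local Notation ZR m := (@ZR R m%ZZ).
Local Notation rp2 k := (@rp2 R k%ZZ).
Local Notation wr k := (@wr R k).

Definition kap_at (ks : seq Z) (l n : nat) : Prop := forall m, (m <= n)%N ->
  31 / 16 * (q / 2 ^+ (l + m)) ^+ 2 * rp2 44 + ZR 25000 <= ZR (nth 0%ZZ ks m).

Lemma rp2_double m : rp2 (2 * Z.of_nat m) = (2 ^+ m) ^+ 2.
Proof.
elim: m => [|m IH]; first by rewrite !expr1n -rp2E ZR1.
have -> : (2 * Z.of_nat m.+1 = 2 + 2 * Z.of_nat m)%ZZ by lia.
rewrite rp2D; [|by []|lia].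
rewrite IH (exprS 2 m) exprMn; congr (_ * _).
by rewrite -rp2E -[pow2 2]/(2 * 2)%ZZ ZRM ZR2 expr2.
Qed.

(** Of 25001, the part 25000 covers [near_g] and the last unit the floor in [Z.shiftr]. Halving the
    interval divides the chord error by 4, hence the shift by [2 m]. *)
Lemma kapsP : kap_at kaps 0 8.
Proof.
move=> m m8; have [/Z.leb_le/(@ler_ZR R) k E] := kap0_check.
rewrite (E m m8) add0n ZRD.
have -> : ZR 25001 = ZR 25000 + 1 by rewrite -[in RHS]ZR1 -ZRD.
have h : 31 / 16 * q ^+ 2 * rp2 44 <= ZR kap0.
  have /inbP/andP[_] := inb_sqr (@inb_halfpi R).
  have P8 : 0 < rp2 8 by apply: rp2_gt0; apply/Z.leb_le.
  have -> : U = rp2 44 * rp2 8 by rewrite scale_rp2 -rp2D.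
  rewrite -ZRD => h; move: k; rewrite (ZRM 31) (ZRM (16 * _)) (ZRM 16) rp2E.
  have -> : ZR 31 = 31 by rewrite -[ZR 31]/(ZR (Z.of_nat 31)) ZR_nat.
  have -> : ZR 16 = 16 by rewrite -[ZR 16]/(ZR (Z.of_nat 16)) ZR_nat.
  move: (ZR (_ + _)) (ZR kap0) h => B K h k.
  rewrite -(ler_pM2r P8); lra.
have n0 : (0 <= 2 * Z.of_nat m)%ZZ by lia.
have /andP[_ /ltW] := @ZR_shiftr_rp2 R kap0 _ n0.
have M0 : 0 < (2 ^+ m) ^+ 2 :> R by rewrite !exprn_gt0.
rewrite rp2_double => h2.
rewrite addrA [leRHS]addrAC lerD2r;  rewrite -(ler_pM2r M0).
apply: le_trans h2; apply: le_trans h.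
have N : (2 ^+ m : R) != 0 by rewrite lt0r_neq0// exprn_gt0.
by rewrite le_eqVlt; apply/orP; left; apply/eqP; field.
Qed.

Lemma mid_bounds a b : 0 <= a -> a < b ->
  [/\ 0 <= (a + b) / 2, a <= (a + b) / 2 & (a + b) / 2 <= b].
Proof. by move=> a0 ab; split; lra. Qed.

Lemma add_le_chain (A B V V1 V2 x y : R) :
  A + V <= V1 + x -> B + V1 <= V2 + y -> A + B + V <= V2 + (x + y).
Proof. by move=> *; lra. Qed.

Context (i j E : Z) (c1 c2 e : R).
Context (ic : ZR i = c1 * rp2 12) (jc : ZR j = c2 * rp2 12) (Ee : ZR E = e * rp2 44).
Context (c1b : `|c1| <= 2) (c2b : `|c2| <= 1) (eb : `|e| <= 6).
Local Notation gt := (@gt R c1 c2 e).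
Local Notation gts := (@gts R c1 c2 e).
Local Notation VA := (@VA R c1 c2 e).
Local Notation near_g := (@near_g R c1 c2 e).

Lemma leaves_gt0 T : (0 < leaves T)%N.
Proof. by elim: T => //= _ l lp r rp; rewrite addn_gt0 lp. Qed.

Lemma eta_ge0 : 0 <= eta :> R. Proof. by rewrite divr_ge0// ltW// rp2_gt0_38. Qed.

Lemma rp2_44_24 : rp2 44 = rp2 20 * rp2 24.
Proof. by rewrite -rp2D//; apply/Z.leb_le. Qed.

Lemma itg_neg a b k ga gb : a <= b -> near_g ga a -> near_g gb b ->
  31 / 16 * (b - a) ^+ 2 * rp2 44 + ZR 25000 <= ZR k -> (ga <= - k)%ZZ -> (gb <= - k)%ZZ ->
  itg gts a b = 0.
Proof.
move=> ab na nb hk /(@ler_ZR R) ka /(@ler_ZR R) kb; rewrite ZRN in ka kb.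
have -> : itg gts a b = itg (fun=> 0) a b; last by rewrite itg_cst// mul0r.
apply: eq_itg => x xab; rewrite /gts posp_neg ?mul0r//.
exact: (negg c1b c2b ab na nb hk ka kb xab).
Qed.

Lemma itg_pos a b k ga gb da db v : a <= b -> near_g ga a -> near_g gb b ->
  31 / 16 * (b - a) ^+ 2 * rp2 44 + ZR 25000 <= ZR k -> (k <= ga)%ZZ -> (k <= gb)%ZZ ->
  data_at da a -> data_at db b -> 0 <= a ->
  itg gts a b + VA v <= VA (acc_cell da db v) + eta.
Proof.
move=> ab na nb hk /(@ler_ZR R) ka /(@ler_ZR R) kb dda ddb a0.
have -> : itg gts a b = itg (fun t => gt t * s t) a b.
  apply: eq_itg => x xab; rewrite /gts posp_pos//.
  exact: (posg c1b c2b ab na nb hk ka kb xab).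
by have := @acc_cellP R c1 c2 e c1b c2b eb da db a b v dda ddb a0 ab; lra.
Qed.

Lemma shift_near (k g : Z) x d : near_g g x -> d + ZR 25000 <= ZR k ->
  gt x * rp2 44 + d <= ZR (Z.shiftr (g + k) 20 + 1) * rp2 20.
Proof.
have P20 : (0 <= 20)%ZZ by apply/Z.leb_le.
rewrite /near_g ler_norml => /andP[h _] hk.
have /andP[_ /ltW] := @ZR_shiftr_rp2 R (g + k)%ZZ 20 P20.
by rewrite (ZRD (Z.shiftr _ _)) ZR1 (ZRD g); lra.
Qed.

Lemma itg_leaf a b k ga gb hs v S : a < b -> near_g ga a -> near_g gb b ->
  31 / 16 * (b - a) ^+ 2 * rp2 44 + ZR 25000 <= ZR k ->
  {in `[a, b], forall x, 0 <= s x <= S} -> S * ((b - a) / 2) <= ZR hs / rp2 20 ->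
  itg gts a b + VA v <=
  VA (acc_chord (hs * chordv (Z.shiftr (ga + k) 20 + 1) (Z.shiftr (gb + k) 20 + 1)) v).
Proof.
move=> ab na nb hk sS Shs.
have P24 := @rp2_gt0_24 R; have P44 := @rp2_gt0_44 R.
have P20 : 0 < rp2 20 by apply: rp2_gt0; apply/Z.leb_le.
have ha := shift_near na hk; have hb := shift_near nb hk.
move: ha hb; set a' := (Z.shiftr _ _ + 1)%ZZ; set b' := (Z.shiftr (gb + k) 20 + 1)%ZZ => ha hb.
have ba : 0 < b - a by rewrite subr_gt0.
have Aa : ZR a' / rp2 24 * rp2 24 = ZR a' by rewrite divfK// gt_eqF.
have Bb : ZR b' / rp2 24 * rp2 24 = ZR b' by rewrite divfK// gt_eqF.
set A := ZR a' / rp2 24 in Aa *; set B := ZR b' / rp2 24 in Bb *.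
have hA : gt a + 31 / 16 * (b - a) ^+ 2 <= A.
  by rewrite -(ler_pM2r P44) mulrDl; apply: le_trans ha _; rewrite -Aa rp2_44_24; lra.
have hB : gt b + 31 / 16 * (b - a) ^+ 2 <= B.
  by rewrite -(ler_pM2r P44) mulrDl; apply: le_trans hb _; rewrite -Bb rp2_44_24; lra.
have gAB : {in `[a, b], forall x, gt x * (b - a) <= A * (b - x) + B * (x - a)}.
  move=> x; rewrite in_itv/= => xab; have /andP[ax xb] := xab.
  have := @gt_chord R c1 c2 e c1b c2b a b x xab; rewrite ler_norml => /andP[_ h].
  have m1 : (gt a + 31 / 16 * (b - a) ^+ 2) * (b - x) <= A * (b - x).
    by apply: ler_wpM2r hA; rewrite subr_ge0.
  have m2 : (gt b + 31 / 16 * (b - a) ^+ 2) * (x - a) <= B * (x - a).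
    by apply: ler_wpM2r hB; rewrite subr_ge0.
  by clear -h m1 m2; lra.
have h := @chordvP R c1 c2 e a' b' S A B a b ab sS gAB Aa Bb.
(* Nonnegativity is read off from the bound [h] itself, whose left-hand side is nonnegative. *)
have C0 : 0 <= ZR (chordv a' b').
  have S0 : 0 < S * ((b - a) / 2).
    have /sS/andP[_] : a \in `[a, b] by rewrite in_itv/= lexx ltW.
    by have := @ellipse_speed_ge1 R a => s1 s2; apply: mulr_gt0; lra.
  have I0 : 0 <= itg gts a b * rp2 24.
    rewrite pmulr_lge0//; apply: itg_ge0.
    by move=> x xab; rewrite /gts mulr_ge0// ?posp_ge0//; have /andP[] := sS x xab.
  by rewrite -(pmulr_rge0 _ S0); exact: le_trans I0 h.
have h' : itg gts a b * rp2 24 <= ZR hs / rp2 20 * ZR (chordv a' b').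
  by apply: le_trans h _; exact: ler_wpM2r.
have -> : VA (acc_chord (hs * chordv a' b') v) = VA v + ZR hs * ZR (chordv a' b') / rp2 44.
  rewrite /VA /acc_chord /s0 /sX /sY /s3 /sC; case: v => v0 vX vY v3 vC.
  by rewrite (ZRD vC) (ZRM hs); ring.
rewrite addrC lerD2l -(ler_pM2r P24); apply: le_trans h' _.
by rewrite rp2_44_24 le_eqVlt; apply/orP; left; apply/eqP; field; rewrite !gt_eqF.
Qed.

Lemma goE T ks da ga db gb v (k := head 0%ZZ ks) : go T ks i j E da ga db gb v =
  if (ga <=? - k)%ZZ && (gb <=? - k)%ZZ then v
  else if (k <=? ga)%ZZ && (k <=? gb)%ZZ then acc_cell da db v
  else match T with
  | Leaf hs => acc_chord (hs * chordv (Z.shiftr (ga + k) 20 + 1) (Z.shiftr (gb + k) 20 + 1)) v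
  | TNode d l r =>
    let gm := gval d i j E in
    go r (behead ks) i j E d gm db gb (go l (behead ks) i j E da ga d gm v)
  end.
Proof. by case: T. Qed.

(** Each piece summed by primitives costs one [eta]. The pieces are disjoint subtrees, so the number
    of leaves bounds how many occur. *)
Lemma goP T a b l n ks da ga db gb v : tree_at T a b -> (height T <= n)%N ->
  kap_at ks l n -> 0 <= a -> b - a = q / 2 ^+ l -> data_at da a -> data_at db b ->
  near_g ga a -> near_g gb b ->
  itg gts a b + VA v <= VA (go T ks i j E da ga db gb v) + (leaves T)%:R * eta.
Proof.
elim: T a b l n ks da ga db gb v => [hs|d lt IHl rt IHr] a b l n ks da ga db gb v TT hT kk a0 ba dda ddb nga ngb.
- have ab : a < b by rewrite -subr_gt0 ba divr_gt0// ?q_gt0// exprn_gt0.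
  have k0 := kk 0%N (leq0n _); rewrite addn0 nth0 -ba in k0.
  have e0 := eta_ge0; rewrite goE; move: k0; set k := head 0%ZZ ks => k0.
  have L : VA v + itg gts a b + eta <= VA v + itg gts a b + (leaves (Leaf hs))%:R * eta.
    by rewrite lerD2l mul1r.
  case: ifP => [/andP[/Z.leb_le ka /Z.leb_le kb]|_].
    by rewrite (itg_neg (ltW ab) nga ngb k0 ka kb) add0r lerDl mulr_ge0.
  case: ifP => [/andP[/Z.leb_le ka /Z.leb_le kb]|_].
    by rewrite mul1r; exact: (itg_pos v (ltW ab) nga ngb k0 ka kb dda ddb a0).
  case: TT => S sS Shs.
  apply: le_trans (itg_leaf v ab nga ngb k0 sS Shs) _.
  by rewrite lerDl mulr_ge0.
- have ab : a < b by rewrite -subr_gt0 ba divr_gt0// ?q_gt0// exprn_gt0.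
  have k0 := kk 0%N (leq0n _); rewrite addn0 nth0 -ba in k0.
  have e0 := eta_ge0; rewrite goE; move: k0; set k := head 0%ZZ ks => k0.
  case: ifP => [/andP[/Z.leb_le ka /Z.leb_le kb]|_].
    by rewrite (itg_neg (ltW ab) nga ngb k0 ka kb) add0r lerDl mulr_ge0.
  case: ifP => [/andP[/Z.leb_le ka /Z.leb_le kb]|_].
    apply: le_trans (itg_pos v (ltW ab) nga ngb k0 ka kb dda ddb a0) _.
    by rewrite lerD2l ler_peMl// ler1n leaves_gt0.
  case: n hT kk => [|n] hT kk; first by [].
  have /andP[hl hr] : (height lt <= n)%N && (height rt <= n)%N by rewrite -geq_max.
  have [dd Tl Tr] := TT.
  have kk' : kap_at (behead ks) l.+1 n.
    by move=> m mn; rewrite nth_behead addSnnS; exact: kk.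
  have nm := @gvalP R i j E c1 c2 e ic jc Ee c1b c2b d _ dd.
  have [m0 am mb] := mid_bounds a0 ab.
  have l1 : (a + b) / 2 - a = q / 2 ^+ l.+1.
    by rewrite exprS invfM mulrCA -ba; field.
  have l2 : b - (a + b) / 2 = q / 2 ^+ l.+1.
    by rewrite exprS invfM mulrCA -ba; field.
  have := IHl a _ l.+1 n (behead ks) da ga d (gval d i j E) v Tl hl kk' a0 l1 dda dd nga nm.
  set v' := go lt _ _ _ _ _ _ _ _ _.
  have := IHr _ b l.+1 n (behead ks) d (gval d i j E) db gb v' Tr hr kk' m0 l2 dd ddb nm ngb.
  rewrite (@itg_chasles R gts a ((a + b) / 2) b).
  + move=> h1 h2; have := add_le_chain h2 h1.
    by rewrite -mulrDl -natrD.
  + exact: continuous_gts.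
  + exact: am.
  + exact: mb.
Qed.

Lemma quarterP : itg gts 0 q <= ZR (quarter i j E) / rp2 82 + 256 * eta.
Proof.
have [T0 D0 Dq] := @tabP R; have [ht lv] := tab_check.
have n0 := @gvalP R i j E c1 c2 e ic jc Ee c1b c2b _ _ D0.
have nq := @gvalP R i j E c1 c2 e ic jc Ee c1b c2b _ _ Dq.
have hh : (height tab <= 8)%N by rewrite ht.
have q0 : q - 0 = q / 2 ^+ 0 by rewrite subr0 expr0 divr1.
have := @goP tab 0 q 0 8 kaps data0 _ dataq _ acc0 T0 hh kapsP (lexx 0) q0 D0 Dq n0 nq.
have VA0 : VA acc0 = 0.
  by rewrite /VA /acc0 /s0 /sX /sY /s3 /sC ZR0 !mulr0 !addr0 subr0 !mul0r addr0.
rewrite lv VA0 addr0 => h; apply: le_trans h _; rewrite lerD2r.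
rewrite /quarter; move: (go _ _ _ _ _ _ _ _ _ _) => v.
rewrite /acc_val /VA; case: v => v0 vX vY v3 vC; rewrite /s0 /sX /sY /s3 /sC.
have P0 k : Z.leb 0 k -> (0 <= k)%ZZ by move/Z.leb_le.
have E82 : rp2 82 = rp2 44 * rp2 38 by rewrite -rp2D//; exact: P0.
have E44 : rp2 44 = rp2 33 * (rp2 12 / 2).
  have -> : rp2 12 / 2 = rp2 11.
    rewrite (_ : 12 = 1 + 11)%ZZ// rp2D; [|exact: P0|exact: P0].
    by rewrite -[rp2 1]rp2E -[pow2 1]/2%ZZ ZR2 mulrAC divff ?mul1r.
  by rewrite -rp2D//; exact: P0.
rewrite (ZRD (_ - _)) (ZRB (_ + _)) (ZRD (_ * v0)) (ZRM _ v0) (ZRM _ (_ + _)) (ZRD (_ * vX)).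
rewrite (ZRM i) (ZRM j) (ZRM E) (ZRM _ vC) !rp2E ic jc Ee E82.
have N44 := lt0r_neq0 (@rp2_gt0_44 R); have N38 := lt0r_neq0 (@rp2_gt0_38 R).
rewrite le_eqVlt; apply/orP; left; apply/eqP.
move: N44; rewrite E44; move: (rp2 33) (rp2 12) (rp2 38) N38 => P Q S N38 N44.
have [N33 N12] : P != 0 /\ Q != 0.
  by move: N44; rewrite !mulf_eq0 !negb_or => /andP[-> /andP[-> _]].
by field; rewrite N38 N33 N12.
Qed.
End go_spec.

(** * Convexity of the relaxed [Lam] and the subdivision into boxes *)

Lemma kboundE : kbound =
  (pow2 30 * (b_K.1 - b_K.2 - 10 * err_w - 1) - pow2 44 * (4 * 256 * 64))%ZZ.
Proof. by vm_compute. Qed.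
Lemma M0q_check : Z.leb (2 * (M0q.1 + M0q.2)) (5 * bunit).
Proof. by vm_compute. Qed.

Section lambda.
Context {R : realType}.
Implicit Types (t x c e l : R).
Local Notation U := (@scale R).
Local Notation q := (pi / 2 : R).
Local Notation s := (@ellipse_speed R).
Local Notation ZR m := (@ZR R m%ZZ).
Local Notation rp2 k := (@rp2 R k%ZZ).
Local Notation wr k := (@wr R k).

Lemma speed_ge0 t : 0 <= s t. Proof. exact: le_trans ler01 (ellipse_speed_ge1 t). Qed.

Lemma continuous_gfun c1 c2 e : continuous (@gfun R c1 c2 e).
Proof. exact: continuous_gpoly. Qed.

Definition gpos c1 c2 e t : R := posp (gfun c1 c2 e t) * s t.
Lemma continuous_gpos c1 c2 e : continuous (gpos c1 c2 e).
Proof.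
apply: continuous_M; last exact: continuous_ellipse_speed.
by apply: continuous_posp; exact: continuous_gfun.
Qed.
Lemma gpos_ge0 c1 c2 e t : 0 <= gpos c1 c2 e t.
Proof. by rewrite mulr_ge0 ?posp_ge0 ?speed_ge0. Qed.

Definition pint c1 c2 e : R := itg (gpos c1 c2 e) 0 q.
(** Separating [e] from [|c|^2] makes the integrand the positive part of an affine function of
    [(c1, c2, e)], hence [LamE] jointly convex and decreasing in [e]. The four terms are the
    quarters of the ellipse, reflected to the first. *)
Definition LamE c1 c2 e : R :=
  pint c1 c2 e + pint c1 (- c2) e + (pint (- c1) c2 e + pint (- c1) (- c2) e).
Definition Lam c1 c2 : R := LamE c1 c2 (c1 ^+ 2 + c2 ^+ 2).

Lemma pint_ge0 c1 c2 e : 0 <= pint c1 c2 e.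
Proof. by apply: itg_ge0 => x _; exact: gpos_ge0. Qed.

Lemma pint_anti c1 c2 e e' : e <= e' -> pint c1 c2 e' <= pint c1 c2 e.
Proof.
move=> ee; apply: le_itg; do ?exact: continuous_gpos.
move=> t _; rewrite ler_wpM2r ?speed_ge0// le_posp//.
by rewrite /gfun /gpoly lerD2l lerN2.
Qed.

Lemma LamE_anti c1 c2 e e' : e <= e' -> LamE c1 c2 e' <= LamE c1 c2 e.
Proof. by move=> ee; rewrite /LamE !lerD ?pint_anti. Qed.

Lemma pint_convex l c1 c2 e c1' c2' e' : 0 <= l <= 1 ->
  pint (l * c1 + (1 - l) * c1') (l * c2 + (1 - l) * c2') (l * e + (1 - l) * e')
  <= l * pint c1 c2 e + (1 - l) * pint c1' c2' e'.
Proof.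
move=> /andP[l0 l1]; have l1' : 0 <= 1 - l by rewrite subr_ge0.
have cg := continuous_gpos; rewrite /pint -!itgZ// -itgD.
- apply: le_itg; first exact: cg.
    by apply: continuous_D; apply: continuous_M; do ?exact: cg; exact: continuous_k.
  move=> t _; rewrite /gpos.
  set g := gfun _ _ _ t; set g1 := gfun _ _ _ t; set g2 := gfun _ _ _ t.
  have -> : l * (posp g1 * s t) + (1 - l) * (posp g2 * s t) =
    (l * posp g1 + (1 - l) * posp g2) * s t by ring.
  rewrite ler_wpM2r ?speed_ge0// -(pospZ g1 l0) -(pospZ g2 l1'). apply: le_trans (pospD _ _); rewrite le_eqVlt; apply/orP; left.
  by apply/eqP; congr posp; rewrite /g /g1 /g2 /gfun /gpoly; ring.
- by apply: continuous_M; [exact: continuous_k|exact: cg].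
- by apply: continuous_M; [exact: continuous_k|exact: cg].
Qed.

Lemma LamE_convex l c1 c2 e c1' c2' e' : 0 <= l <= 1 ->
  LamE (l * c1 + (1 - l) * c1') (l * c2 + (1 - l) * c2') (l * e + (1 - l) * e')
  <= l * LamE c1 c2 e + (1 - l) * LamE c1' c2' e'.
Proof.
move=> l01; rewrite /LamE.
have N x y : - (l * x + (1 - l) * y) = l * - x + (1 - l) * - y by ring.
rewrite !N; have p d d' f f' := @pint_convex l d f e d' f' e' l01.
have := p c1 c1' c2 c2'; have := p c1 c1' (- c2) (- c2').
have := p (- c1) (- c1') c2 c2'; have := p (- c1) (- c1') (- c2) (- c2').
by clear; lra.
Qed.

Lemma LamE_seg l c1 c2 e c1' c2' e' (K : R) : 0 <= l <= 1 ->
  LamE c1 c2 e < K -> LamE c1' c2' e' < K ->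
  LamE (l * c1 + (1 - l) * c1') (l * c2 + (1 - l) * c2') (l * e + (1 - l) * e') < K.
Proof.
move=> l01 h h'; apply: le_lt_trans (LamE_convex _ _ _ _ _ _ l01) _.
have /andP[l0 l1] := l01; have [l0'|l0'] := eqVneq l 0.
  by rewrite l0' mul0r add0r subr0 mul1r.
have lp : 0 < l by rewrite lt_neqAle eq_sym l0'.
have h1 : l * LamE c1 c2 e < l * K by rewrite ltr_pM2l.
have h2 : (1 - l) * LamE c1' c2' e' <= (1 - l) * K by rewrite ler_wpM2l ?subr_ge0// ltW.
by apply: lt_le_trans (ltr_leD h1 h2) _; rewrite -mulrDl addrC subrK mul1r.
Qed.

Lemma LamE_sign c1 c2 e : LamE `|c1| `|c2| e = LamE c1 c2 e.
Proof.
rewrite /LamE; have [c10|/ltW c10] := leP 0 c1; have [c20|/ltW c20] := leP 0 c2;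
  rewrite ?(ger0_norm c10) ?(ger0_norm c20) ?(ler0_norm c10) ?(ler0_norm c20) ?opprK; ring.
Qed.

Lemma moment0q_le : 2 * moment 0 q <= 5 :> R.
Proof.
have [m _ _ _ _] := @inb_moments_q R; move: m => /inbP/andP[_]; rewrite -ZRD.
have := M0q_check => /Z.leb_le/(@ler_ZR R); rewrite (ZRM 2) (ZRM 5) ZR2 -UE.
have -> : ZR 5 = 5 by rewrite -[ZR 5]/(ZR (Z.of_nat 5)) ZR_nat.
by move=> h1 h2; have U0 := @U_gt0 R; rewrite -(ler_pM2r U0); lra.
Qed.

Lemma wfun_wt t : `|wfun t - wt t| <= ZR err_w / U.
Proof.
have [h0 h1 h2 _] := @inb_w R; have U0 := @U_gt0 R.
have B (b : zball) x : inb b x -> `|x - ZR b.1 / U| <= ZR b.2 / U.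
  move/inbP/andP => [l1 l2]; rewrite -[x](mulfK (lt0r_neq0 U0)) -mulrBl.
  rewrite normrM (@gtr0_norm _ U^-1) ?invr_gt0// ler_pM2r ?invr_gt0//.
  by rewrite ler_norml; apply/andP; split; lra.
have {}h0 := B _ _ h0; have {}h1 := B _ _ h1; have {}h2 := B _ _ h2.
have -> : ZR err_w / U = ZR b_w0.2 / U + ZR b_w1.2 / U + ZR b_w2.2 / U.
  by rewrite /err_w (ZRD (_ + _)) (ZRD b_w0.2) !mulrDl.
have -> : wfun t - wt t = (w0 - wr 0) + (w1 - wr 1) * zc t + (w2 - wr 2) * zc t ^+ 2.
  by rewrite /wfun /wt /wpoly /lin4 -[kk]/(wr 3); ring.
have z1 := zc_le1 t; have z2 : `|zc t ^+ 2| <= 1 by rewrite normrX exprn_ile1.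
apply: le_trans (ler_normD _ _) _; apply: lerD.
  apply: le_trans (ler_normD _ _) _; apply: lerD; first exact: h0.
  by rewrite normrM -[leRHS]mulr1; apply: ler_pM => //; exact: h1.
by rewrite normrM -[leRHS]mulr1; apply: ler_pM => //; exact: h2.
Qed.

Lemma pint_gts c1 c2 e : pint c1 c2 e <= itg (@gts R c1 c2 e) 0 q + ZR err_w / U * (5 / 2).
Proof.
have cg := @continuous_gts R c1 c2 e; have cs := @continuous_ellipse_speed R.
have E0 : 0 <= ZR err_w / U by apply: le_trans (normr_ge0 _) (wfun_wt 0).
apply: le_trans (_ : itg (fun t => @gts R c1 c2 e t + ZR err_w / U * s t) 0 q <= _).
  apply: le_itg; first exact: continuous_gpos.
    by apply: continuous_D => //; apply: continuous_M => //; exact: continuous_k.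
  move=> t _; rewrite /gpos /gts -mulrDl ler_wpM2r ?speed_ge0//.
  rewrite -[ZR err_w / U]posp_pos//; apply: le_trans (pospD _ _); apply: le_posp.
  have := wfun_wt t; rewrite ler_norml => /andP[_].
  by rewrite /gfun /gt /gpoly -/(wfun t) -/(wt t); lra.
rewrite itgD//; last by apply: continuous_M => //; exact: continuous_k.
rewrite itgZ// -moment0E lerD2l ler_wpM2l//; have := moment0q_le; lra.
Qed.

End lambda.

Section boxes.
Context {R : realType}.
Implicit Types (t x c e l : R).
Local Notation U := (@scale R).
Local Notation q := (pi / 2 : R).
Local Notation s := (@ellipse_speed R).
Local Notation ZR m := (@ZR R m%ZZ).
Local Notation rp2 k := (@rp2 R k%ZZ).
Local Notation pt i := (ZR i / rp2 12).

Lemma rp2_gt0_12 : 0 < rp2 12. Proof. by apply: rp2_gt0; apply/Z.leb_le. Qed.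

Lemma sum4_le (p1 p2 p3 p4 i1 i2 i3 i4 q1 q2 q3 q4 P h w : R) :
  p1 <= i1 + w * (5 / 2) -> p2 <= i2 + w * (5 / 2) ->
  p3 <= i3 + w * (5 / 2) -> p4 <= i4 + w * (5 / 2) ->
  i1 <= q1 * P + 256 * h -> i2 <= q2 * P + 256 * h ->
  i3 <= q3 * P + 256 * h -> i4 <= q4 * P + 256 * h ->
  p1 + p2 + (p3 + p4) <= (q1 + q2 + (q3 + q4)) * P + 1024 * h + w * 10.
Proof. lra. Qed.

Lemma totalP (i j E : Z) (c1 c2 e : R) : ZR i = c1 * rp2 12 -> ZR j = c2 * rp2 12 ->
  ZR E = e * rp2 44 -> `|c1| <= 2 -> `|c2| <= 1 -> `|e| <= 6 ->
  LamE c1 c2 e <= ZR (total i j E) / rp2 82 + 1024 * eta + ZR err_w / U * 10.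
Proof.
move=> ic jc Ee c1b c2b eb.
have ic' : ZR (- i) = - c1 * rp2 12 by rewrite ZRN ic mulNr.
have jc' : ZR (- j) = - c2 * rp2 12 by rewrite ZRN jc mulNr.
have c1b' : `|- c1| <= 2 by rewrite normrN.
have c2b' : `|- c2| <= 1 by rewrite normrN.
have q1 := quarterP ic jc Ee c1b c2b eb; have q2 := quarterP ic jc' Ee c1b c2b' eb.
have q3 := quarterP ic' jc Ee c1b' c2b eb; have q4 := quarterP ic' jc' Ee c1b' c2b' eb.
have p1 := pint_gts c1 c2 e; have p2 := pint_gts c1 (- c2) e.
have p3 := pint_gts (- c1) c2 e; have p4 := pint_gts (- c1) (- c2) e.
rewrite /LamE /total (ZRD (_ + _)) (ZRD (quarter i j E)) (ZRD (quarter (- i) j E)).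
exact: (sum4_le p1 p2 p3 p4 q1 q2 q3 q4).
Qed.

(** 1024 counts four quarters of 256 leaves, and 10 is four times the bound [5 / 2] for the length
    of a quarter. The single unit subtracted in [kbound] makes the inequality strict. *)
Lemma kbound_Kval : ZR kbound / rp2 82 + 1024 * eta + ZR err_w / U * 10 < Kval.
Proof.
have P0 k : Z.leb 0 k -> (0 <= k)%ZZ by move/Z.leb_le.
have Pp k : Z.leb 0 k -> 0 < rp2 k by move/P0; exact: rp2_gt0.
have [_ /inbP/andP[h _]] := @inb_be R.
have U0 := @U_gt0 R.
have E82 : rp2 82 = rp2 30 * U by rewrite scale_rp2 -rp2D//; exact: P0.
have E82' : rp2 82 = rp2 44 * rp2 38 by rewrite -rp2D//; exact: P0.
rewrite kboundE (ZRB (_ * _)) (ZRM (pow2 30)) (ZRM (pow2 44)) !rp2E.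
rewrite (ZRB (b_K.1 - b_K.2 - _)) (ZRB (b_K.1 - _)) (ZRB b_K.1) (ZRM 10) ZR1.
have -> : ZR (4 * 256 * 64) = 1024 * 64.
  by rewrite (ZRM (_ * _)) (ZRM 4) -[ZR 4]/(ZR (Z.of_nat 4)) -[ZR 256]/(ZR (Z.of_nat 256))
    -[ZR 64]/(ZR (Z.of_nat 64)) !ZR_nat; lra.
have -> : ZR 10 = 10 by rewrite -[ZR 10]/(ZR (Z.of_nat 10)) ZR_nat.
rewrite /eta mulrBl {1}E82 E82' [_ / (_ * U)]mulrC.
move: h; move: (ZR b_K.1) (ZR b_K.2) (ZR err_w) => k1 k2 w h.
have N30 := lt0r_neq0 (Pp 30 isT); have N44 := lt0r_neq0 (@rp2_gt0_44 R).
have N38 := lt0r_neq0 (@rp2_gt0_38 R); have NU := lt0r_neq0 U0.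
move: (rp2 30) (rp2 44) (rp2 38) N30 N44 N38 => x y z N30 N44 N38.
have -> : (x * U)^-1 * (x * (k1 - k2 - 10 * w - 1)) - y * (1024 * 64) / (y * z) +
  1024 * (64 / z) + w / U * 10 = (k1 - k2 - 1) / U by field; rewrite N30 N44 N38 NU.
by rewrite ltr_pdivrMr//; lra.
Qed.

Lemma pt_norm (i : Z) (k : nat) : (Z.abs i <=? Z.of_nat k * pow2 12)%ZZ -> `|pt i| <= k%:R.
Proof.
move/Z.leb_le/(@ler_ZR R); rewrite ZR_abs (ZRM (Z.of_nat k)) ZR_nat rp2E => h.
by rewrite normrM (@gtr0_norm _ (rp2 12)^-1) ?invr_gt0 ?rp2_gt0_12// ler_pdivrMr ?rp2_gt0_12.
Qed.

Definition tangent (m1 m2 c1 c2 : R) : R := 2 * (m1 * c1 + m2 * c2) - (m1 ^+ 2 + m2 ^+ 2).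

Lemma tangent_le m1 m2 c1 c2 : tangent m1 m2 c1 c2 <= c1 ^+ 2 + c2 ^+ 2.
Proof. rewrite /tangent; have := sqr_ge0 (c1 - m1); have := sqr_ge0 (c2 - m2); lra. Qed.

Lemma vertexP (i j m n : Z) : vertex_ok i j m n ->
  LamE (pt i) (pt j) (tangent (pt m) (pt n) (pt i) (pt j)) < Kval.
Proof.
rewrite /vertex_ok; set E := (pow2 20 * _)%ZZ => /and4P[i2 j1 e6 tot].
have P12 := rp2_gt0_12; have N12 := lt0r_neq0 P12.
have d k : ZR k = ZR k / rp2 12 * rp2 12 by rewrite divfK.
have P0 k : Z.leb 0 k -> (0 <= k)%ZZ by move/Z.leb_le.
have EE : ZR E = tangent (pt m) (pt n) (pt i) (pt j) * rp2 44.
  have -> : rp2 44 = rp2 20 * (rp2 12 * rp2 12) by rewrite -!rp2D//; exact: P0.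
  rewrite /E (ZRM (pow2 20)) rp2E (ZRB (2 * _)) (ZRM 2) ZR2 !(ZRD (m * _)) !(ZRM m) !(ZRM n).
  by rewrite /tangent; field.
have e6' : `|tangent (pt m) (pt n) (pt i) (pt j)| <= 6.
  have P44 := @rp2_gt0_44 R.
  rewrite -(ler_pM2r P44) -{1}(gtr0_norm P44) -normrM -EE -ZR_abs.
  move/Z.leb_le/(@ler_ZR R): e6; rewrite (ZRM 6) rp2E.
  by rewrite -[ZR 6]/(ZR (Z.of_nat 6)) ZR_nat.
apply: le_lt_trans kbound_Kval.
apply: le_trans (totalP (d i) (d j) EE _ _ e6') _.
- exact: (@pt_norm i 2).
- exact: (@pt_norm j 1).
have P82 : 0 < rp2 82 by apply: rp2_gt0; exact: P0.
move/Z.leb_le/(@ler_ZR R): tot => tot.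
by rewrite lerD2r lerD2r ler_pM2r ?invr_gt0.
Qed.

Lemma seg_param (a b x : R) : a <= x <= b -> exists2 l, 0 <= l <= 1 & x = l * a + (1 - l) * b.
Proof.
move=> /andP[ax xb]; have [ab|ab] := eqVneq a b.
  by exists 0; [rewrite lexx ler01|rewrite mul0r add0r subr0 mul1r; lra].
have ba : 0 < b - a by rewrite subr_gt0 lt_neqAle ab (le_trans ax xb).
exists ((b - x) / (b - a)).
  by rewrite ler_pdivrMr// divr_ge0 ?(ltW ba)//; lra.
by field; rewrite gt_eqF.
Qed.

(* A function with convex strict sublevel sets is controlled on a box by its
   values at the vertices. *)
Lemma box_convex (P : R -> R -> Prop) (x1 x2 y1 y2 c1 c2 : R) :
  (forall l a b a' b', 0 <= l <= 1 -> P a b -> P a' b' ->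
     P (l * a + (1 - l) * a') (l * b + (1 - l) * b')) ->
  P x1 y1 -> P x1 y2 -> P x2 y1 -> P x2 y2 -> x1 <= c1 <= x2 -> y1 <= c2 <= y2 -> P c1 c2.
Proof.
move=> cP p11 p12 p21 p22 /seg_param[l l01 ->] /seg_param[k k01 ->].
have E (z m : R) : z = m * z + (1 - m) * z by ring.
set y := k * y1 + _.
have L a : P a y1 -> P a y2 -> P a y by move=> h1 h2; rewrite (E a k); exact: cP.
by rewrite (E y l); apply: cP => //; exact: L.
Qed.

Lemma box_okP (x y hx hy : Z) (c1 c2 : R) : box_ok x y hx hy ->
  pt (x - hx) <= c1 <= pt (x + hx) -> pt (y - hy) <= c2 <= pt (y + hy) -> Lam c1 c2 < Kval.
Proof.
move=> /and4P[/vertexP k1 /vertexP k2 /vertexP k3 /vertexP k4] bx by'.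
apply: le_lt_trans (LamE_anti _ _ (tangent_le (pt x) (pt y) c1 c2)) _.
apply: (@box_convex (fun a b => LamE a b (tangent (pt x) (pt y) a b) < Kval) _ _ _ _ c1 c2
  _ k2 k4 k3 k1 bx by').
move=> l a b a' b' l01 h h'.
have -> : tangent (pt x) (pt y) (l * a + (1 - l) * a') (l * b + (1 - l) * b') =
  l * tangent (pt x) (pt y) a b + (1 - l) * tangent (pt x) (pt y) a' b'.
  by rewrite /tangent; ring.
exact: LamE_seg.
Qed.

Definition disc (u w c1 c2 : R) : Prop := (c1 - u) ^+ 2 + (c2 - w) ^+ 2 <= (40 / rp2 12) ^+ 2.

Lemma in_discP (u w i j : Z) : in_disc u w i j -> disc (pt u) (pt w) (pt i) (pt j).
Proof.
rewrite /in_disc => /Z.leb_le/(@ler_ZR R).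
rewrite (ZRD ((i - u) * _)) (ZRM (i - u)) (ZRM (j - w)) (ZRM 40) (ZRB i) (ZRB j).
rewrite -[ZR 40]/(ZR (Z.of_nat 40)) ZR_nat /disc -!mulrBl !expr_div_n -!mulrDl.
by rewrite -!expr2 ler_pM2r// invr_gt0 exprn_gt0// rp2_gt0_12.
Qed.

Lemma disc_convex u w l a b a' b' : 0 <= l <= 1 -> disc u w a b -> disc u w a' b' ->
  disc u w (l * a + (1 - l) * a') (l * b + (1 - l) * b').
Proof.
rewrite /disc => /andP[l0 l1] h h'; set r := (_ / _) ^+ 2 in h h' *.
have m1 : l * ((a - u) ^+ 2 + (b - w) ^+ 2) <= l * r by rewrite ler_wpM2l.
have m2 : (1 - l) * ((a' - u) ^+ 2 + (b' - w) ^+ 2) <= (1 - l) * r.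
  by rewrite ler_wpM2l// subr_ge0.
have m3 : 0 <= (l * (1 - l)) * ((a - a') ^+ 2 + (b - b') ^+ 2).
  by rewrite mulr_ge0 ?addr_ge0 ?sqr_ge0// mulr_ge0// subr_ge0.
lra.
Qed.

Lemma box_discP (u w x y hx hy : Z) (c1 c2 : R) : box_disc u w x y hx hy ->
  pt (x - hx) <= c1 <= pt (x + hx) -> pt (y - hy) <= c2 <= pt (y + hy) ->
  disc (pt u) (pt w) c1 c2.
Proof.
move=> /and4P[/in_discP k1 /in_discP k2 /in_discP k3 /in_discP k4] bx by'.
apply: (box_convex _ k2 k4 k3 k1 bx by') => *; exact: disc_convex.
Qed.

Definition near_contact (c1 c2 : R) : Prop :=
  disc (pt 7363) (pt 0) c1 c2 \/ disc (pt 3065) (pt 3677) c1 c2.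

Lemma split_pt (x h : Z) (c : R) : pt (x - 2 * h) <= c <= pt (x + 2 * h) ->
  pt (x - h - h) <= c <= pt (x - h + h) \/ pt (x + h - h) <= c <= pt (x + h + h).
Proof.
have -> : (x - 2 * h = x - h - h)%ZZ by lia.
have -> : (x + 2 * h = x + h + h)%ZZ by lia.
have -> : (x - h + h = x + h - h)%ZZ by lia.
move=> /andP[-> ->]; have [h1|/ltW h1] := leP c (pt (x + h - h)).
  by left.
by right; rewrite h1.
Qed.

(** Half-widths are powers of 2 and the longer side is halved. The condition on [n] makes the fuel
    run out, with answer [false], before a half-width 1 would have to be halved. *)
Lemma boxesP n p r (x y : Z) (c1 c2 : R) :
  let hx := (2 ^ Z.of_nat p)%ZZ in let hy := (2 ^ Z.of_nat r)%ZZ in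
  (n <= p + r + 1)%N -> boxes n x y hx hy ->
  pt (x - hx) <= c1 <= pt (x + hx) -> pt (y - hy) <= c2 <= pt (y + hy) ->
  near_contact c1 c2 \/ Lam c1 c2 < Kval.
Proof.
elim: n p r x y => [//|n IH] p r x y hx hy npr; rewrite [boxes _ _ _ _ _]/=.
case: (boolP (box_disc 7363 _ _ _ _ _)) => [h _ bx by'|_].
  by left; left; exact: box_discP h bx by'.
case: (boolP (box_disc 3065 _ _ _ _ _)) => [h _ bx by'|_].
  by left; right; exact: box_discP h bx by'.
case: (boolP (box_ok _ _ _ _)) => [h _ bx by'|_].
  by right; exact: box_okP h bx by'.
have H k : (2 ^ Z.of_nat k.+1 = 2 * 2 ^ Z.of_nat k)%ZZ.
  by rewrite Nat2Z.inj_succ Z.pow_succ_r//; lia.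
have D k : Z.div2 (2 ^ Z.of_nat k.+1) = (2 ^ Z.of_nat k)%ZZ.
  by rewrite H Z.div2_div Z.mul_comm Z.div_mul.
case: (Z.leb_spec hy hx) => hyx.
- have rp : (r <= p)%N.
    rewrite leqNgt; apply/negP => pr; have : (2 ^ Z.of_nat p < 2 ^ Z.of_nat r)%ZZ.
      by apply: Z.pow_lt_mono_r; lia.
    by rewrite -/hx -/hy; lia.
  case: p @hx npr hyx rp => [|p] hx npr hyx rp.
    have -> : n = 0%N by lia.
    by [].
  rewrite /hx D; move=> /andP[h1 h2] + by'; rewrite H => /split_pt[] bx.
  + by apply: (IH p r _ _ _ h1 bx by'); lia.
  + by apply: (IH p r _ _ _ h2 bx by'); lia.
- have rp : (p < r)%N.
    rewrite ltnNge; apply/negP => pr; have : (2 ^ Z.of_nat r <= 2 ^ Z.of_nat p)%ZZ.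
      by apply: Z.pow_le_mono_r; lia.
    by rewrite -/hx -/hy; lia.
  case: r @hy npr hyx rp => [//|r] hy npr hyx rp.
  rewrite /hy D; move=> /andP[h1 h2] bx; rewrite H => /split_pt[] by'.
  + by apply: (IH p r _ _ _ h1 bx by'); lia.
  + by apply: (IH p r _ _ _ h2 bx by'); lia.
Qed.

End boxes.

(** The root box is [[0, 2] x [0, 1]] in units of [2^-12], with half-widths [2^12 / 1] and [2^11];
    24 is [12 + 11 + 1], the most that [boxesP] admits. *)
Lemma boxes_check : boxes 24 4096 2048 4096 2048.
Proof. by vm_compute. Qed.

Lemma far_from_contacts {R : realType} (c1 c2 : R) : 0 <= c1 <= 2 -> 0 <= c2 <= 1 ->
  near_contact c1 c2 \/ Lam c1 c2 < Kval.
Proof.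
have P := @rp2_gt0_12 R; have N := lt0r_neq0 P => b1 b2.
have E0 : ZR 0 / rp2 12 = 0 :> R by rewrite ZR0 mul0r.
have E1 : ZR 4096 / rp2 12 = 1 :> R by rewrite -[ZR 4096]/(ZR (pow2 12)) rp2E divff.
have E2 : ZR 8192 / rp2 12 = 2 :> R.
  by rewrite (_ : 8192 = 2 * pow2 12)%ZZ// (ZRM 2) ZR2 rp2E mulfK.
apply: (@boxesP R 24 12 11 4096 2048 c1 c2 _ boxes_check).
- by [].
- by rewrite (_ : 4096 - _ = 0)%ZZ// (_ : 4096 + _ = 8192)%ZZ// E0 E2.
- by rewrite (_ : 2048 - _ = 0)%ZZ// (_ : 2048 + _ = 4096)%ZZ// E0 E1.
Qed.

(** * Positive and negative parts of a concave function near a zero *)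

Section concave.
Context {R : realType}.
Implicit Types (x a b l r n S gam : R) (g dg ddg s : R -> R).

Section zones.
Context (g dg ddg s : R -> R) (l r : R).
Context (lr : l <= r) (cg : continuous g) (cs : continuous s).
Context (d1 : forall u, l <= u <= r -> is_derive u 1 g (dg u)).
Context (d2 : forall u, l <= u <= r -> is_derive u 1 dg (ddg u)).
Context (neg : forall u, l < u < r -> ddg u <= 0).
Context (s0 : forall u, 0 <= s u).

Lemma concave_deriv_anti x y : l <= x -> x <= y -> y <= r -> dg y <= dg x.
Proof.
move=> lx xy yr; rewrite -lerN2.
apply: (@nondecreasing_is_derive _ (fun u => - dg u) (fun u => - ddg u)) => // u /andP[xu uy].
- have uab : l <= u <= r by rewrite (le_trans lx xu) (le_trans uy yr).
  by have := d2 uab => ?; apply: is_derive_eq.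
- by rewrite oppr_ge0; apply: neg; rewrite (le_lt_trans lx xu) (lt_le_trans uy yr).
Qed.

Lemma slope_le k x y : l <= x -> x <= y -> y <= r -> (forall u, x <= u <= y -> dg u <= k) ->
  g y - g x <= k * (y - x).
Proof.
move=> lx xy yr h.
suff : k * x - g x <= k * y - g y by lra.
apply: (@nondecreasing_is_derive _ (fun u => k * u - g u) (fun u => k - dg u)) => // u /andP[xu uy].
- have uab : l <= u <= r by rewrite (le_trans lx xu) (le_trans uy yr).
  by have := d1 uab => ?; apply: is_derive_eq; rewrite /GRing.scale/= mulr1.
- by rewrite subr_ge0; apply: h; rewrite !ltW.
Qed.

Lemma slope_ge k x y : l <= x -> x <= y -> y <= r -> (forall u, x <= u <= y -> k <= dg u) ->
  k * (y - x) <= g y - g x.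
Proof.
move=> lx xy yr h.
suff : g x - k * x <= g y - k * y by lra.
apply: (@nondecreasing_is_derive _ (fun u => g u - k * u) (fun u => dg u - k)) => // u /andP[xu uy].
- have uab : l <= u <= r by rewrite (le_trans lx xu) (le_trans uy yr).
  by have := d1 uab => ?; apply: is_derive_eq; rewrite /GRing.scale/= mulr1.
- by rewrite subr_ge0; apply: h; rewrite !ltW.
Qed.

Lemma concave_chord_sub a x b : l <= a -> a <= x -> x <= b -> b <= r ->
  g a * (b - x) + g b * (x - a) <= g x * (b - a).
Proof.
move=> la ax xb br; apply: (@concave_chord R g dg ddg a b x).
- by rewrite ax.
- by move=> u /andP[au ub]; apply: d1; rewrite (le_trans la au) (le_trans ub br).
- by move=> u /andP[au ub]; apply: d2; rewrite (le_trans la au) (le_trans ub br).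
- by move=> u /andP[au ub]; apply: neg; rewrite (le_lt_trans la au) (lt_le_trans ub br).
Qed.

Lemma concave_ge0 x : l <= x <= r -> 0 <= g l -> 0 <= g r -> 0 <= g x.
Proof.
move=> /andP[lx xr] gl gr; have h := concave_chord_sub (lexx l) lx xr (lexx r).
move: lr; rewrite le_eqVlt => /predU1P[E|lr'].
  by rewrite (_ : x = l)//; apply/le_anti; rewrite lx andbT E.
rewrite -(@pmulr_lge0 _ (r - l)) ?subr_gt0//; apply: le_trans h.
by rewrite addr_ge0// mulr_ge0// subr_ge0.
Qed.

Local Notation posg x := (posp (g x) * s x).
Local Notation posNg x := (posp (- g x) * s x).

Lemma continuous_posg : continuous (fun x => posg x).
Proof. by apply: continuous_M => //; exact: continuous_posp. Qed.
Lemma continuous_posNg : continuous (fun x => posNg x).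
Proof.
by apply: continuous_M => //; apply: continuous_posp => x; apply: cvgN; exact: cg.
Qed.

Lemma itg_posp_vanish a b : a <= b -> {in `[a, b], forall x, g x <= 0} ->
  itg (fun x => posg x) a b = 0.
Proof.
move=> ab g0; have -> : itg (fun x => posg x) a b = itg (fun=> 0) a b.
  by apply: eq_itg => x /g0 gx; rewrite posp_neg// mul0r.
by rewrite itg_cst// mul0r.
Qed.

Lemma itg_pospN_vanish a b : a <= b -> {in `[a, b], forall x, 0 <= g x} ->
  itg (fun x => posNg x) a b = 0.
Proof.
move=> ab g0; have -> : itg (fun x => posNg x) a b = itg (fun=> 0) a b.
  by apply: eq_itg => x /g0 gx; rewrite posp_neg ?mul0r// oppr_le0.
by rewrite itg_cst// mul0r.
Qed.

Lemma itg_posp_split a b : itg (fun x => posg x) a b =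
  itg (fun x => g x * s x) a b + itg (fun x => posNg x) a b.
Proof.
rewrite -itgD; [|by apply: continuous_M|exact: continuous_posNg].
by apply: eq_itg => x _; rewrite {2}(pospB (g x)); ring.
Qed.

(** The tangent at [l] gives the triangle. Beyond [n] concavity keeps [g] nonpositive, so that the
    weight has to be bounded on [[l, n]] only. *)
Lemma pos_zone_right n S gam : l <= n <= r -> 0 < gam -> dg l <= - gam -> g n <= 0 ->
  {in `[l, n], forall x, s x <= S} ->
  itg (fun x => posg x) l r <= S * (posp (g l) ^+ 2 / (2 * gam)).
Proof.
move=> /andP[ln nr] gam0 dl gn sS.
have tan x : l <= x <= r -> g x <= g l - gam * (x - l).
  move=> /andP[lx xr]; have := slope_le (k := - gam) (lexx l) lx xr; rewrite mulNr => h.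
  suff : g x - g l <= - (gam * (x - l)) by lra.
  apply: h => u /andP[lu ux]; apply: le_trans dl.
  by apply: concave_deriv_anti => //; exact: le_trans xr.
rewrite (itg_chasles continuous_posg ln nr) (@itg_posp_vanish n r)// ?addr0.
  apply: itg_posp_zone_weight => //.
  - by move=> x /sS sx; rewrite s0.
  - by move=> x; rewrite in_itv/= => /andP[lx xn]; apply: tan; rewrite lx (le_trans xn).
move=> x; rewrite in_itv/= => /andP[nx xr].
have [gl|gl] := leP (g l) 0.
  apply: le_trans (tan x _) _; first by rewrite (le_trans ln).
  have : 0 <= gam * (x - l) by rewrite mulr_ge0 ?(ltW gam0)// subr_ge0 (le_trans ln).
  lra.
have ln' : 0 < n - l.
  rewrite subr_gt0 lt_neqAle ln andbT; apply: contraTneq gl => ->.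
  by rewrite -leNgt.
have h := concave_chord_sub (lexx l) ln nx xr.
rewrite -(@pmulr_lle0 _ (n - l))//.
have h1 : 0 <= g l * (x - n) by rewrite mulr_ge0 ?(ltW gl)// subr_ge0.
have h2 : g n * (x - l) <= 0 by rewrite mulr_le0_ge0// subr_ge0 (le_trans ln).
lra.
Qed.

Lemma pos_zone_left S gam : 0 < gam -> gam <= dg r -> {in `[l, r], forall x, s x <= S} ->
  itg (fun x => posg x) l r <= S * (posp (g r) ^+ 2 / (2 * gam)).
Proof.
move=> gam0 dr sS; apply: itg_posp_zone_left => //.
- by move=> x /sS sx; rewrite s0.
- move=> x; rewrite in_itv/= => /andP[lx xr].
  suff : gam * (r - x) <= g r - g x by lra.
  apply: slope_ge => // u /andP[xu ur]; apply: le_trans dr _.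
  by apply: concave_deriv_anti => //; exact: le_trans xu.
Qed.

(** For the negative part the slope is needed at the end where it is flattest, here [l]; seen from
    [r], [- g] then falls at least at the rate [gam]. *)
Lemma neg_zone_right S gam : 0 < gam -> dg l <= - gam -> {in `[l, r], forall x, s x <= S} ->
  itg (fun x => posNg x) l r <= S * (posp (- g r) ^+ 2 / (2 * gam)).
Proof.
move=> gam0 dl sS; apply: itg_posp_zone_left => //.
- by move=> x; apply: cvgN; exact: cg.
- by move=> x /sS sx; rewrite s0.
- move=> x; rewrite in_itv/= => /andP[lx xr].
  suff : g r - g x <= - gam * (r - x) by lra.
  apply: slope_le => // u /andP[xu ur]; apply: le_trans dl.
  by apply: concave_deriv_anti => //; exact: le_trans xu.
Qed.

Lemma neg_zone_left S gam : 0 < gam -> gam <= dg r -> {in `[l, r], forall x, s x <= S} ->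
  itg (fun x => posNg x) l r <= S * (posp (- g l) ^+ 2 / (2 * gam)).
Proof.
move=> gam0 dr sS; apply: itg_posp_zone_weight => //.
- by move=> x; apply: cvgN; exact: cg.
- by move=> x /sS sx; rewrite s0.
- move=> x; rewrite in_itv/= => /andP[lx xr].
  suff : gam * (x - l) <= g x - g l by lra.
  apply: slope_ge => // u /andP[lu ux]; apply: le_trans dr _.
  by apply: concave_deriv_anti => //; exact: le_trans xr.
Qed.

End zones.
End concave.

(* [dec4 b u v]: the ball [b] lies in [u / 100 + v / 100 ^ 2, u / 100 + (v + 1) / 100 ^ 2]. *)
Definition dec4 (b : zball) (u v : nat) : bool :=
  let m := (100 * Z.of_nat u + Z.of_nat v)%ZZ in
  Z.leb (m * bunit) (10000 * (b.1 - b.2)) && Z.leb (10000 * (b.1 + b.2)) ((m + 1) * bunit).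

Lemma dec4_check : [/\ dec4 b_cA 179 75, dec4 b_cB1 74 82, dec4 b_cB2 89 76,
   dec4 (ncos ncut) 73 46 & [/\ dec4 (nsin ncut) 67 84, dec4 bM0 90 35, dec4 b_mB 151 85,
   dec4 (bopp b_w0) 192 30 & [/\ dec4 (bopp b_w1) 161 33, dec4 b_w2 0 0 & dec4 (bcst kz) 12 0]]].
Proof. by vm_compute. Qed.

(** * Decimal bounds of the constants, and estimates common to both kinds of contact points *)

Section numerics.
Context {R : realType}.
Implicit Types (t x c e l : R).
Local Notation U := (@scale R).
Local Notation q := (pi / 2 : R).
Local Notation s := (@ellipse_speed R).
Local Notation ZR m := (@ZR R m%ZZ).
Local Notation t0 := (@tcut R).

Lemma dec4P (b : zball) (u v : nat) x : inb b x -> dec4 b u v ->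
  u%:R / 100 + v%:R / 100 / 100 <= x <= u%:R / 100 + (v%:R + 1) / 100 / 100.
Proof.
move=> /inbP/andP[h1 h2] /andP[/Z.leb_le/(@ler_ZR R) k1 /Z.leb_le/(@ler_ZR R) k2].
have U0 := @U_gt0 R.
have e4 : ZR 10000 = 100 * 100.
  by rewrite (_ : 10000 = Z.of_nat 100 * Z.of_nat 100)%ZZ// ZRM !ZR_nat.
have e10 : ZR 100 = 100 by rewrite -[ZR 100]/(ZR (Z.of_nat 100)) ZR_nat.
move: k1 k2; rewrite (ZRM (_ + _) bunit) (ZRM 10000) (ZRM 10000) (ZRM (_ + _ + _)).
rewrite (ZRD (_ + _) 1) ZR1 (ZRD (100 * _)) (ZRM 100) !ZR_nat e4 e10 -UE (ZRB b.1) (ZRD b.1).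
move: h1 h2; move: (ZR b.1) (ZR b.2) u%:R v%:R => m r y z h1 h2 k1 k2.
by apply/andP; split; rewrite -(ler_pM2r U0); lra.
Qed.

(** Decimals are written in groups of two digits so that all numerals stay small. *)
Lemma numbersP : [/\ 179 / 100 + 75 / 100 / 100 <= a1 :> R, a1 <= 179 / 100 + 76 / 100 / 100 :> R,
    74 / 100 + 82 / 100 / 100 <= b1 :> R, b1 <= 74 / 100 + 83 / 100 / 100 :> R &
  [/\ 89 / 100 + 76 / 100 / 100 <= b2 :> R, b2 <= 89 / 100 + 77 / 100 / 100 :> R,
    73 / 100 + 46 / 100 / 100 <= cos t0, cos t0 <= 73 / 100 + 47 / 100 / 100 &
  [/\ 67 / 100 + 84 / 100 / 100 <= sin t0, sin t0 <= 67 / 100 + 85 / 100 / 100,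
     90 / 100 + 35 / 100 / 100 <= massA :> R & 151 / 100 + 85 / 100 / 100 <= massB :> R]]].
Proof.
have [d1 d2 d3 d4 [d5 d6 d7 _ _]] := dec4_check.
have [ia ib1 ib2 _] := @inb_c R; have [_ ic is_] := @ncutP R; have im := @inb_massB R.
have [im0 _ _ _] := @inb_M R.
have /andP[A1 A2] := dec4P ia d1; have /andP[B1 B2] := dec4P ib1 d2.
have /andP[C1 C2] := dec4P ib2 d3; have /andP[D1 D2] := dec4P ic d4.
have /andP[E1 E2] := dec4P is_ d5; have /andP[F1 _] := dec4P im0 d6.
have /andP[G1 _] := dec4P im d7.
have S k : k%:R + 1 = k.+1%:R :> R by rewrite natr1.
rewrite !S in A2 B2 C2 D2 E2.
by split => //; split => //; split.
Qed.

Lemma weightsP : [/\ - (192 / 100 + 31 / 100 / 100) <= w0 :> R, w0 <= - (192 / 100 + 30 / 100 / 100) :> R,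
    - (161 / 100 + 34 / 100 / 100) <= w1 :> R, w1 <= - (161 / 100 + 33 / 100 / 100) :> R &
  [/\ 0 <= w2 :> R, w2 <= 1 / 100 / 100 :> R, 12 / 100 <= kk :> R & kk <= 12 / 100 + 1 / 100 / 100 :> R]].
Proof.
have [_ _ _ _ [_ _ _ d0 [d1 d2 d3]]] := dec4_check.
have [i0 i1 i2 i3] := @inb_w R.
have /andP[A1 A2] := dec4P (inb_opp i0) d0; have /andP[B1 B2] := dec4P (inb_opp i1) d1.
have /andP[C1 C2] := dec4P i2 d2; have /andP[D1 D2] := dec4P i3 d3.
have S k : k%:R + 1 = k.+1%:R :> R by rewrite natr1.
rewrite !S in A2 B2 C2 D2; rewrite !mul0r !add0r in C1 C2; rewrite !mul0r addr0 in D1.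
by split; [lra|lra|lra|lra|split].
Qed.
End numerics.

Section local_tools.
Context {R : realType}.
Implicit Types (t x y c e l r m C S : R).
Local Notation q := (pi / 2 : R).
Local Notation s := (@ellipse_speed R).
Local Notation t0 := (@tcut R).

Definition dgfun c1 c2 : R -> R := dgpoly w1 w2 kk c1 c2.
Definition ddgfun c1 c2 : R -> R := ddgpoly w1 w2 kk c1 c2.

Lemma is_derive_gfun c1 c2 e t : is_derive t 1 (gfun c1 c2 e) (dgfun c1 c2 t).
Proof. exact: is_derive_gpoly. Qed.
Lemma is_derive_dgfun c1 c2 t : is_derive t 1 (dgfun c1 c2) (ddgfun c1 c2 t).
Proof. exact: is_derive_dgpoly. Qed.

Lemma gfun_dist c1 c2 t : gfun c1 c2 (c1 ^+ 2 + c2 ^+ 2) t =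
  (wfun t + 5 / 2 + 3 / 2 * zc t) - ((2 * cos t - c1) ^+ 2 + (sin t - c2) ^+ 2).
Proof. by rewrite -[_ + _ + _ * _]addrA -sqr_curve /gfun /gpoly -/(wfun t); ring. Qed.

Lemma gfun_shift c1 c2 x y t :
  gfun (c1 + x) (c2 + y) ((c1 + x) ^+ 2 + (c2 + y) ^+ 2) t =
  gfun c1 c2 (c1 ^+ 2 + c2 ^+ 2) t + 2 * ((2 * cos t - c1) * x + (sin t - c2) * y)
  - (x ^+ 2 + y ^+ 2).
Proof. by rewrite !gfun_dist; ring. Qed.

Lemma dgfun_shift c1 c2 x y t :
  dgfun (c1 + x) (c2 + y) t = dgfun c1 c2 t + ((- 4 * sin t) * x + 2 * cos t * y).
Proof. by rewrite /dgfun /dgpoly; ring. Qed.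

(** Cauchy-Schwarz, by the identity of Lagrange. *)
Lemma lin_le a b m x y r : a ^+ 2 + b ^+ 2 <= m ^+ 2 -> x ^+ 2 + y ^+ 2 <= r ^+ 2 ->
  0 <= m -> 0 <= r -> - (m * r) <= a * x + b * y <= m * r.
Proof.
move=> h1 h2 m0 r0; rewrite -ler_norml -(@ler_pXn2r _ 2) ?nnegrE ?mulr_ge0//.
rewrite real_normK ?num_real// exprMn.
have h3 : (a ^+ 2 + b ^+ 2) * (x ^+ 2 + y ^+ 2) <= m ^+ 2 * r ^+ 2.
  by apply: ler_pM => //; rewrite addr_ge0 ?sqr_ge0.
have := sqr_ge0 (a * y - b * x); lra.
Qed.

(** Tangent below and secant above: squares become linear terms that [lra] can handle. *)
Lemma sqr_bounds lo hi x : lo <= x <= hi ->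
  2 * lo * x - lo ^+ 2 <= x ^+ 2 <= (lo + hi) * x - lo * hi.
Proof.
move=> /andP[h1 h2]; have := sqr_ge0 (x - lo).
have : 0 <= (x - lo) * (hi - x) by rewrite mulr_ge0 ?subr_ge0.
by move=> *; apply/andP; split; lra.
Qed.

Lemma sqr_le_sym B x : - B <= x <= B -> x ^+ 2 <= B ^+ 2.
Proof. by rewrite -ler_norml -[x ^+ 2]real_normK ?num_real// => h; rewrite ler_pXn2r ?nnegrE// (le_trans _ h). Qed.

Lemma cos_lt_inv x y : 0 <= x <= pi -> 0 <= y <= pi -> cos y < cos x -> x < y.
Proof. by move=> hx hy; rewrite ltr_cos ?in_itv//=. Qed.
Lemma cos_le_anti x y : 0 <= x <= pi -> 0 <= y <= pi -> x <= y -> cos y <= cos x.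
Proof. by move=> hx hy xy; rewrite leNgt ltr_cos ?in_itv//= -leNgt. Qed.

Lemma acos_point C : 0 <= C < 1 ->
  [/\ 0 < acos C, acos C <= q, cos (acos C) = C, 0 <= sin (acos C) &
      sin (acos C) ^+ 2 = 1 - C ^+ 2].
Proof.
move=> /andP[C0 C1]; have CI : -1 <= C <= 1 by lra.
have cC : cos (acos C) = C by rewrite acosK ?in_itv.
have a0 := acos_ge0 CI; have api := acos_lepi CI; have q0 := @q_gt0 R.
have a1 : 0 < acos C.
  by apply: cos_lt_inv; rewrite ?lexx ?a0 ?pi_ge0// cos0 cC.
have aq : acos C <= q.
  rewrite leNgt; apply/negP => h; have := C0; rewrite leNgt => /negP; apply.
  by rewrite -cC -cos_pihalf ltr_cos// in_itv/= ?a0// (ltW q0)/=; lra.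
split=> //; first by rewrite sin_acos// sqrtr_ge0.
by have := cos2Dsin2 (acos C); rewrite cC; lra.
Qed.

Lemma speed_le t S : 1 + 3 * sin t ^+ 2 <= S ^+ 2 -> 0 <= S -> s t <= S.
Proof.
move=> h S0; rewrite -(ger0_norm S0) -sqrtr_sqr; apply: ler_wsqrtr.
by have := cos2Dsin2 t; lra.
Qed.

Lemma posp_sqr x : posp x ^+ 2 + posp (- x) ^+ 2 = x ^+ 2.
Proof.
have [x0|/ltW x0] := leP 0 x.
  by rewrite (posp_pos x0) posp_neg ?oppr_le0// expr0n addr0.
by rewrite (posp_neg x0) posp_pos ?oppr_ge0// expr0n add0r sqrrN.
Qed.

Lemma zone_coef S gam K X : S <= K * (2 * gam) -> 0 < gam -> 0 <= X ->
  S * (X / (2 * gam)) <= K * X.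
Proof.
move=> h g0 X0; rewrite mulrCA mulrC ler_wpM2r// ler_pdivrMr// mulr_gt0//.
Qed.

Lemma ddwpoly_bounds (z : R) : -1 <= z <= 1 ->
  (z <= 0 -> ddwpoly w1 w2 kk z <= 5 * z + (10 / 100 / 100)) /\
  (0 <= z -> ddwpoly w1 w2 kk z <= (104 / 100 + 26 / 100 / 100) * z + (442 / 100 + 50 / 100 / 100) /\
             ddwpoly w1 w2 kk z <= (933 / 100 + 70 / 100 / 100) * z + (10 / 100 / 100)).
Proof.
move=> z1; have [_ _ h1 h2 [h3 h4 h5 h6]] := @weightsP R.
have z2 : 0 <= z ^+ 2 <= 1.
  by rewrite sqr_ge0/= -[z ^+ 2]real_normK ?num_real// exprn_ile1// ler_norml.
have -> : ddwpoly w1 w2 kk z = 8 * (w2 * (1 - 2 * z ^+ 2)) +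
  ((24 * kk - 4 * w1) * z - 36 * kk * z ^+ 3) by rewrite /ddwpoly; ring.
have e2 : w2 * (1 - 2 * z ^+ 2) <= (1 / 100 / 100).
  rewrite -[leRHS]mulr1; apply: le_trans (_ : w2 * 1 <= _); last by rewrite ler_wpM2r//.
  by rewrite ler_wpM2l//; lra.
move: e2; move: (w2 * _) => e e2.
set A := 24 * kk - 4 * w1; set B := 36 * kk.
have [A1 A2] : (933 / 100 + 30 / 100 / 100) <= A /\ A <= (933 / 100 + 70 / 100 / 100) by rewrite /A; lra.
have [B1 B2] : 432 / 100 <= B /\ B <= (432 / 100 + 40 / 100 / 100) by rewrite /B; lra.
clearbody A B; clear h1 h2 h3 h4 h5 h6; move: z1 => /andP[z1 z1'].
split=> z0; last first.
  have z3 : 0 <= z ^+ 3 by rewrite exprn_ge0.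
  have m1 : A * z <= (933 / 100 + 70 / 100 / 100) * z by rewrite ler_wpM2r.
  have m2 : 432 / 100 * z ^+ 3 <= B * z ^+ 3 by rewrite ler_wpM2r.
  (* The tangent of [z^3] at 0.8: since 1.6 is twice 0.8 the square term drops out. *)
  have m3 : 0 <= (z - 8 / 10) ^+ 2 * (z + 16 / 10).
    by rewrite mulr_ge0 ?sqr_ge0//; lra.
  move: (A * z) (B * z ^+ 3) m1 m2 => Az Bz m1 m2; clear B1 B2 A1 A2 z2.
  by split; lra.
have -> : A * z - B * z ^+ 3 = (A - B * z ^+ 2) * z by ring.
have m1 : 5 <= A - B * z ^+ 2.
  have : B * z ^+ 2 <= (432 / 100 + 40 / 100 / 100) * 1.
    by case/andP: z2 => za zb; apply: ler_pM => //; lra.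
  lra.
have : (A - B * z ^+ 2) * z <= 5 * z by rewrite ler_wnM2r.
move: (_ * z) => Y; clear z2 m1; lra.
Qed.

Lemma ddwpoly_neg t : zc t <= 0 -> ddwpoly w1 w2 kk (zc t) <= 5 * zc t + (10 / 100 / 100).
Proof. by have := zc_le1 t; rewrite ler_norml => /ddwpoly_bounds[h _]. Qed.
Lemma ddwpoly_pos t : 0 <= zc t ->
  ddwpoly w1 w2 kk (zc t) <= (104 / 100 + 26 / 100 / 100) * zc t + (442 / 100 + 50 / 100 / 100) /\
  ddwpoly w1 w2 kk (zc t) <= (933 / 100 + 70 / 100 / 100) * zc t + (10 / 100 / 100).
Proof. by have := zc_le1 t; rewrite ler_norml => /ddwpoly_bounds[_ h]. Qed.

Lemma sqr_ge_half x : 0 <= x -> 0 <= 2 * x ^+ 2 - 1 -> 7 / 10 <= x.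
Proof.
move=> x0 h; rewrite leNgt; apply/negP => hx.
have : 0 <= x * (7 / 10 - x) by rewrite mulr_ge0// subr_ge0 ltW.
lra.
Qed.

Lemma concave_A c1 c2 t : (178 / 100 + 70 / 100 / 100) <= c1 -> - (1 / 100) <= c2 <= 1 / 100 -> 0 <= t <= q ->
  ddgfun c1 c2 t <= 0.
Proof.
move=> h1 h2 t0q; have x0 := cos_ge0q t0q; have y0 := sin_ge0q t0q.
have x1 := cos_le1 t; have y1 := sin_le1 t.
rewrite /ddgfun /ddgpoly.
have m1 : 4 * ((178 / 100 + 70 / 100 / 100)) * cos t <= 4 * c1 * cos t by rewrite ler_wpM2r//; lra.
have m2 : - (2 / 100) <= 2 * c2 * sin t.
  have : 0 <= (c2 + 1 / 100) * sin t by rewrite mulr_ge0//; lra.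
  move: (sin t) y1 {m1 x0 x1 t0q y0} => y y1; lra.
move: (4 * c1 * cos t) (2 * c2 * sin t) m1 m2 {h1 h2 y0 y1 t0q} => C1 C2 m1 m2.
have [z0|/ltW z0] := leP (zc t) 0.
  have := ddwpoly_neg z0; move: z0; rewrite zc_cos.
  move: (cos t) (ddwpoly _ _ _ _) x0 x1 m1 => x d x0 x1 m1 z0 hd.
  have h : x <= (70 / 100 + 80 / 100 / 100).
    rewrite leNgt; apply/negP => h.
    have : 0 <= (x - (70 / 100 + 80 / 100 / 100)) * (x + (70 / 100 + 80 / 100 / 100)) by rewrite mulr_ge0//; lra.
    lra.
  have : 0 <= x * ((70 / 100 + 80 / 100 / 100) - x) by rewrite mulr_ge0//; lra.
  lra.
have [b3 _] := ddwpoly_pos z0; move: b3 z0; rewrite zc_cos.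
move: (cos t) (ddwpoly _ _ _ _) x0 x1 m1 => x d x0 x1 m1 hd z0.
have h := sqr_ge_half x0 z0.
have : 0 <= (x - 7 / 10) * (1 - x) by rewrite mulr_ge0//; lra.
lra.
Qed.

(** Concavity fails near [t = 0], where [ddwpoly] is about 5 against [4 c1], about 3; hence the
    upper bound on [cos t]. The negative values of [cos t] serve the part of a displaced cell that
    crosses the minor axis. *)
Lemma concave_B c1 c2 t : (73 / 100 + 80 / 100 / 100) <= c1 <= 76 / 100 -> (88 / 100 + 70 / 100 / 100) <= c2 ->
  - (6 / 100) <= cos t <= (80 / 100 + 70 / 100 / 100) -> 0 <= sin t -> ddgfun c1 c2 t <= 0.
Proof.
move=> h1 h2 hx y0; have yE := cos2Dsin2 t.
rewrite /ddgfun /ddgpoly.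
have m2 : 2 * ((88 / 100 + 70 / 100 / 100)) * sin t <= 2 * c2 * sin t by rewrite ler_wpM2r//; lra.
move: (2 * c2 * sin t) m2 {h2} => C2 m2.
have [z0|/ltW z0] := leP (zc t) 0.
  have := ddwpoly_neg z0; move: z0; rewrite zc_cos.
  move: (cos t) (sin t) (ddwpoly _ _ _ _) hx y0 yE m2 => x y d hx y0 yE m2 z0 hd.
  have h : 7 / 10 <= y by apply: sqr_ge_half => //; lra.
  have m1 : - (1 / 5) <= 4 * c1 * x.
    have [c0|/ltW c0] := leP 0 x.
      have : 0 <= c1 * x by rewrite mulr_ge0//; lra.
      lra.
    have : 0 <= (76 / 100 - c1) * - x by rewrite mulr_ge0//; lra.
    lra.
  lra.
have [_ b3] := ddwpoly_pos z0; move: b3 z0; rewrite zc_cos.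
move: (cos t) (sin t) (ddwpoly _ _ _ _) hx y0 yE m2 => x y d hx y0 yE m2 hd z0.
have [c0|/ltW c0] := leP 0 x; last first.
  have : 0 <= (6 / 100 + x) * - x by rewrite mulr_ge0//; lra.
  lra.
have hx7 := sqr_ge_half c0 z0.
have x2 : x ^+ 2 <= ((80 / 100 + 70 / 100 / 100)) ^+ 2 by apply: sqr_le_sym; lra.
have h : 59 / 100 <= y.
  rewrite leNgt; apply/negP => h.
  have : 0 <= (59 / 100 - y) * (59 / 100 + y) by rewrite mulr_ge0//; lra.
  lra.
have m1 : 4 * ((73 / 100 + 80 / 100 / 100)) * (7 / 10) <= 4 * c1 * x by apply: ler_pM; lra.
lra.
Qed.

(** Curve points at distance at least 0.85 from [c] contribute nothing to [Lam c], because
    [0.85^2 > 0.7]. This disposes of whole quarters and of the far part of the others. *)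
Lemma v_le t : wfun t + 5 / 2 + 3 / 2 * zc t <= 7 / 10.
Proof.
have [h7 h8 h1 h2 [h3 h4 h5 h6]] := @weightsP R.
have z1 := zc_le1 t.
have -> : wfun t = w0 + w2 * zc t ^+ 2 + (kk * zc t ^+ 2 + w1) * zc t.
  by rewrite /wfun /wpoly /lin4; ring.
move: (zc t) z1 => z z1.
have z2 : 0 <= z ^+ 2 <= 1.
  by rewrite sqr_ge0/= -[z ^+ 2]real_normK ?num_real// exprn_ile1.
have e2 : w2 * z ^+ 2 <= (1 / 100 / 100).
  rewrite -[leRHS]mulr1; case/andP: z2 => za zb; apply: ler_pM => //.
have : `|(kk * z ^+ 2 + w1 + 3 / 2) * z| <= (11 / 100 + 40 / 100 / 100) * 1.
  rewrite normrM; apply: ler_pM => //; rewrite ler_norml.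
  have : 0 <= kk * z ^+ 2 by case/andP: z2 => za zb; rewrite mulr_ge0//; lra.
  have : kk * z ^+ 2 <= ((12 / 100 + 0 / 100 / 100) + (1 / 100 / 100)) * 1.
    by case/andP: z2 => za zb; apply: ler_pM => //; lra.
  by move: (kk * z ^+ 2) => Y *; apply/andP; split; lra.
rewrite ler_norml => /andP[_].
move: (w2 * z ^+ 2) (kk * z ^+ 2) e2 => Y X e2; clear z2; lra.
Qed.
End local_tools.

Section zones.
Context {R : realType}.
Implicit Types (t x y c e l r m C S K gam : R).
Local Notation q := (pi / 2 : R).
Local Notation s := (@ellipse_speed R).
Local Notation t0 := (@tcut R).

Definition gneg c1 c2 e t : R := posp (- gfun c1 c2 e t) * s t.

Lemma continuous_gneg c1 c2 e : continuous (gneg c1 c2 e).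
Proof. exact: continuous_posNg (@continuous_gfun R c1 c2 e) (@continuous_ellipse_speed R). Qed.

Lemma gpos_split c1 c2 e a b : 0 <= a -> a <= b -> itg (gpos c1 c2 e) a b =
  (prim_g c1 c2 e b - prim_g c1 c2 e a) + itg (gneg c1 c2 e) a b.
Proof.
move=> a0 ab; rewrite -(itg_gpoly w0 w1 w2 kk c1 c2 e a0 ab).
exact: itg_posp_split (@continuous_gfun R c1 c2 e) (@continuous_ellipse_speed R) _ _.
Qed.

Lemma gpos_vanish c1 c2 e a b : a <= b ->
  (forall t, a <= t <= b -> gfun c1 c2 e t <= 0) -> itg (gpos c1 c2 e) a b = 0.
Proof. by move=> ab h; apply: itg_posp_vanish => // t; rewrite in_itv; exact: h. Qed.

Lemma gneg_vanish c1 c2 e a b : a <= b ->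
  (forall t, a <= t <= b -> 0 <= gfun c1 c2 e t) -> itg (gneg c1 c2 e) a b = 0.
Proof. by move=> ab h; apply: itg_pospN_vanish => // t; rewrite in_itv; exact: h. Qed.

Section one_zone.
Context (c1 c2 e l r : R).
Context (l0 : 0 <= l) (lr : l <= r) (rq : r <= q).
Context (conc : forall u, l < u < r -> ddgfun c1 c2 u <= 0).
Local Notation g := (gfun c1 c2 e).
Let cg := @continuous_gfun R c1 c2 e.
Let cs := @continuous_ellipse_speed R.
Let d1 u (_ : l <= u <= r) := @is_derive_gfun R c1 c2 e u.
Let d2 u (_ : l <= u <= r) := @is_derive_dgfun R c1 c2 u.

Lemma gfun_concave_ge0 x : l <= x <= r -> 0 <= g l -> 0 <= g r -> 0 <= g x.
Proof. exact: (@concave_ge0 R g (dgfun c1 c2) (ddgfun c1 c2)). Qed.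

Let sle n S : n <= r -> s n <= S -> {in `[l, n], forall x, s x <= S}.
Proof.
move=> nr sS x; rewrite in_itv/= => /andP[lx xn]; apply: le_trans sS.
by apply: le_speed; [exact: le_trans lx|exact: xn|exact: le_trans rq].
Qed.

Lemma gpos_zone_right n S gam K : l <= n <= r -> 0 < gam -> dgfun c1 c2 l <= - gam ->
  g n <= 0 -> s n <= S -> S <= K * (2 * gam) ->
  itg (gpos c1 c2 e) l r <= K * posp (g l) ^+ 2.
Proof.
move=> lnr gam0 dl gn sn SK; have /andP[ln nr] := lnr.
apply: le_trans (pos_zone_right cg cs d1 d2 conc speed_ge0 lnr gam0 dl gn (sle nr sn)) _.
by apply: zone_coef => //; exact: sqr_ge0.
Qed.

Lemma gpos_zone_left S gam K : 0 < gam -> gam <= dgfun c1 c2 r ->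
  s r <= S -> S <= K * (2 * gam) -> itg (gpos c1 c2 e) l r <= K * posp (g r) ^+ 2.
Proof.
move=> gam0 dl sn SK.
apply: le_trans (pos_zone_left lr cg cs d1 d2 conc speed_ge0 gam0 dl (sle (lexx r) sn)) _.
by apply: zone_coef => //; exact: sqr_ge0.
Qed.

Lemma gneg_zone_right S gam K : 0 < gam -> dgfun c1 c2 l <= - gam ->
  s r <= S -> S <= K * (2 * gam) -> itg (gneg c1 c2 e) l r <= K * posp (- g r) ^+ 2.
Proof.
move=> gam0 dl sn SK.
apply: le_trans (neg_zone_right lr cg cs d1 d2 conc speed_ge0 gam0 dl (sle (lexx r) sn)) _.
by apply: zone_coef => //; exact: sqr_ge0.
Qed.

Lemma gneg_zone_left S gam K : 0 < gam -> gam <= dgfun c1 c2 r ->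
  s r <= S -> S <= K * (2 * gam) -> itg (gneg c1 c2 e) l r <= K * posp (- g l) ^+ 2.
Proof.
move=> gam0 dl sn SK.
apply: le_trans (neg_zone_left lr cg cs d1 d2 conc speed_ge0 gam0 dl (sle (lexx r) sn)) _.
by apply: zone_coef => //; exact: sqr_ge0.
Qed.
End one_zone.

Lemma sin_acos_pyth C S : 0 <= C < 1 -> 0 <= S -> C ^+ 2 + S ^+ 2 = 1 -> sin (acos C) = S.
Proof.
move=> C01 S0 CS; have [_ _ _ s0 s2] := acos_point C01.
by apply/eqP; rewrite -(@eqrXn2 _ 2)//; apply/eqP; lra.
Qed.

Lemma gfunE c1 c2 e t : gfun c1 c2 e t = w0 + w1 * zc t + w2 * zc t ^+ 2 + kk * zc t ^+ 3
  + 4 * c1 * cos t + 2 * c2 * sin t - e.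
Proof. by rewrite /gfun /gpoly /wpoly /lin4; ring. Qed.

Lemma dgfunE c1 c2 t : dgfun c1 c2 t = - (4 * (sin t * cos t) * (w1 + 2 * w2 * zc t + 3 * kk * zc t ^+ 2))
  - 4 * c1 * sin t + 2 * c2 * cos t.
Proof. by rewrite /dgfun /dgpoly sin_double; ring. Qed.

(** Slightly more than [40 / 2^12], the radius of the discs left out by the boxes; the difference
    absorbs the rounding of their centres. *)
Definition rad : R := 99 / 100 / 100.
Lemma rad0 : 0 <= rad. Proof. by rewrite /rad; lra. Qed.

Lemma gfun_near c1 c2 x y t m : x ^+ 2 + y ^+ 2 <= rad ^+ 2 -> 0 <= m ->
  (2 * cos t - c1) ^+ 2 + (sin t - c2) ^+ 2 <= m ^+ 2 ->
  `|gfun (c1 + x) (c2 + y) ((c1 + x) ^+ 2 + (c2 + y) ^+ 2) t -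
    gfun c1 c2 (c1 ^+ 2 + c2 ^+ 2) t| <= 2 * (m * rad) + rad ^+ 2.
Proof.
move=> hr m0 hm; rewrite gfun_shift.
have := lin_le hm hr m0 rad0 => /andP[h1 h2].
have h3 : 0 <= x ^+ 2 + y ^+ 2 by rewrite addr_ge0 ?sqr_ge0.
by rewrite ler_norml; apply/andP; split; lra.
Qed.

Lemma dgfun_near c1 c2 x y t m : x ^+ 2 + y ^+ 2 <= rad ^+ 2 -> 0 <= m ->
  16 * sin t ^+ 2 + 4 * cos t ^+ 2 <= m ^+ 2 ->
  `|dgfun (c1 + x) (c2 + y) t - dgfun c1 c2 t| <= m * rad.
Proof.
move=> hr m0 hm; rewrite dgfun_shift addrAC subrr add0r ler_norml.
by apply: lin_le => //; [lra|exact: rad0].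
Qed.

End zones.

(** * Near the contact point on the major axis *)

Section local_A.
Context {R : realType}.
Implicit Types (t c e l r m C S K gam : R).
Local Notation q := (pi / 2 : R).
Local Notation s := (@ellipse_speed R).
Local Notation t0 := (@tcut R).
Local Notation n0 := (acos (72 / 97) : R).
Local Notation n1 := (acos (21 / 29) : R).

(** The Pythagorean triples [(65, 72, 97)] and [(20, 21, 29)] give angles just below and just above
    [tcut] whose sine and cosine are both rational. *)
Lemma n0_trig : [/\ 0 < n0, n0 <= q, cos n0 = 72 / 97, sin n0 = 65 / 97 &
  zc n0 = 2 * (72 / 97) ^+ 2 - 1].
Proof.
have C : 0 <= (72 / 97 : R) < 1 by apply/andP; split; lra.
have [h1 h2 h3 _ _] := acos_point C.
have h4 : sin n0 = 65 / 97 by apply: sin_acos_pyth => //; lra.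
by rewrite zc_cos h3.
Qed.

Lemma n1_trig : [/\ 0 < n1, n1 <= q, cos n1 = 21 / 29, sin n1 = 20 / 29 &
  zc n1 = 2 * (21 / 29) ^+ 2 - 1].
Proof.
have C : 0 <= (21 / 29 : R) < 1 by apply/andP; split; lra.
have [h1 h2 h3 _ _] := acos_point C.
have h4 : sin n1 = 20 / 29 by apply: sin_acos_pyth => //; lra.
by rewrite zc_cos h3.
Qed.

Lemma t0_pi : 0 <= t0 <= pi.
Proof. by have /andP[h1 h2] := @tcut_itv R; have := @q_gt0 R; rewrite (ltW h1)/=; lra. Qed.
Lemma q_pi x : 0 < x -> x <= q -> 0 <= x <= pi.
Proof. by move=> x0 xq; have := @q_gt0 R; rewrite (ltW x0)/=; lra. Qed.

Lemma order_A : n0 <= t0 /\ t0 <= n1.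
Proof.
have [_ _ _ _ [_ _ c1' c2' _]] := @numbersP R.
have [h1 h2 h3 _ _] := n0_trig; have [k1 k2 k3 _ _] := n1_trig.
split; apply/ltW/cos_lt_inv.
- exact: q_pi.
- exact: t0_pi.
- by rewrite h3; lra.
- exact: t0_pi.
- exact: q_pi.
- by rewrite k3; lra.
Qed.

Lemma a1_sqr : (179 / 100 + 75 / 100 / 100) ^+ 2 <= a1 ^+ 2 :> R /\
  a1 ^+ 2 <= ((179 / 100 + 75 / 100 / 100) + (179 / 100 + 76 / 100 / 100)) * a1
     - (179 / 100 + 75 / 100 / 100) * (179 / 100 + 76 / 100 / 100) :> R.
Proof.
have [la ua _ _ _] := @numbersP R.
have h : 179 / 100 + 75 / 100 / 100 <= (a1 : R) <= 179 / 100 + 76 / 100 / 100 by rewrite la.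
have /andP[h1 h2] := sqr_bounds h; split => //.
by apply: le_trans h1; rewrite -subr_ge0; have : 0 <= (a1 : R) - (179 / 100 + 75 / 100 / 100); lra.
Qed.

Lemma baseA_n0 : 18 / 100 / 10 <= gfun a1 0 (a1 ^+ 2 + 0 ^+ 2) n0.
Proof.
have [la ua _ _ _] := @numbersP R; have [lw0 uw0 lw1 uw1 [lw2 uw2 lk uk]] := @weightsP R.
have [_ _ c s' z] := n0_trig; rewrite gfunE c s' z.
have [_ a2] := a1_sqr; clear c s' z; lra.
Qed.

Lemma baseA_n1 : gfun a1 0 (a1 ^+ 2 + 0 ^+ 2) n1 <= - (2 / 100).
Proof.
have [la ua _ _ _] := @numbersP R; have [lw0 uw0 lw1 uw1 [lw2 uw2 lk uk]] := @weightsP R.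
have [_ _ c s' z] := n1_trig; rewrite gfunE c s' z.
have [a2 _] := a1_sqr; clear c s' z; lra.
Qed.

Lemma baseA_0 : 5 / 10 <= gfun a1 0 (a1 ^+ 2 + 0 ^+ 2) (0 : R).
Proof.
have [la ua _ _ _] := @numbersP R; have [lw0 uw0 lw1 uw1 [lw2 uw2 lk uk]] := @weightsP R.
rewrite gfunE zc_cos cos0 sin0.
have [_ a2] := a1_sqr; lra.
Qed.

Lemma dbaseA_n0 : dgfun a1 0 n0 <= - (161 / 100 + 50 / 100 / 100).
Proof.
have [la ua _ _ _] := @numbersP R; have [lw0 uw0 lw1 uw1 [lw2 uw2 lk uk]] := @weightsP R.
have [_ _ c s' z] := n0_trig; rewrite dgfunE c s' z.
clear c s' z; lra.
Qed.

Lemma mul_itv (a b c d x y : R) : 0 <= a -> 0 <= c -> a <= x -> x <= b -> c <= y -> y <= d ->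
  a * c <= x * y /\ x * y <= b * d.
Proof.
move=> a0 c0 ax xb cy yd; split; apply: ler_pM => //; [exact: le_trans ax|exact: le_trans cy].
Qed.

Lemma zc_t0 : 79 / 100 / 10 <= zc t0 :> R /\ zc t0 <= 80 / 100 / 10 :> R.
Proof.
have [_ _ _ _ [_ _ lc uc _]] := @numbersP R.
have h0 : 0 <= 73 / 100 + 46 / 100 / 100 :> R by lra.
have [h1 h2] := mul_itv h0 h0 lc uc lc uc.
by rewrite zc_cos expr2; move: (cos t0 * cos t0) h1 h2 {h0 lc uc} => *; split; lra.
Qed.

Lemma slope_t0 : [/\ 49 / 100 + 83 / 100 / 100 <= sin t0 * cos t0, sin t0 * cos t0 <= 49 / 100 + 85 / 100 / 100,
   w1 + 2 * w2 * zc t0 + 3 * kk * zc t0 ^+ 2 <= - (161 / 100 + 9 / 100 / 100) &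
   - (161 / 100 + 34 / 100 / 100) <= w1 + 2 * w2 * zc t0 + 3 * kk * zc t0 ^+ 2 ].
Proof.
have [_ _ _ _ [_ _ lc uc [ls us _ _]]] := @numbersP R.
have [_ _ lw1 uw1 [lw2 uw2 lk uk]] := @weightsP R.
have [lz uz] := zc_t0.
have h0 : 0 <= 73 / 100 + 46 / 100 / 100 :> R by lra.
have h1 : 0 <= 67 / 100 + 84 / 100 / 100 :> R by lra.
have h2 : 0 <= 79 / 100 / 10 :> R by lra.
have h3 : 0 <= 79 / 100 / 10 * (79 / 100 / 10) :> R by lra.
have h4 : 0 <= 12 / 100 :> R by lra.
have [k1 k2] := mul_itv h1 h0 ls us lc uc.
have [k3 k4] := mul_itv h2 h2 lz uz lz uz.
have [k5 k6] := mul_itv h4 h3 lk uk k3 k4.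
have [k7 k8] := mul_itv (lexx 0) h2 lw2 uw2 lz uz.
have -> : w1 + 2 * w2 * zc t0 + 3 * kk * zc t0 ^+ 2 =
  w1 + 2 * (w2 * zc t0) + 3 * (kk * (zc t0 * zc t0)) :> R by ring.
move: (kk * (zc t0 * zc t0)) (w2 * zc t0) (sin t0 * cos t0) k1 k2 k5 k6 k7 k8 {k3 k4 h0 h1 h2 h3 h4 lk uk lz uz lc uc ls us lw2 uw2}.
by move=> X Y Z *; split; lra.
Qed.

Lemma dbaseA_t0 : dgfun a1 0 t0 <= - (166 / 100).
Proof.
have [la _ _ _ [_ _ _ _ [ls _ _ _]]] := @numbersP R.
have [_ h2 h3 h4] := slope_t0; rewrite dgfunE.
move: slope_t0 => [h1 _ _ _]; move: h1 h2 h3 h4; move: (sin t0 * cos t0) (w1 + _ + _) => S P h1 h2 h3 h4.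
have m1 : S * - P <= (49 / 100 + 85 / 100 / 100) * (161 / 100 + 34 / 100 / 100) by apply: ler_pM; lra.
have m2 : (179 / 100 + 75 / 100 / 100) * (67 / 100 + 84 / 100 / 100) <= a1 * sin t0.
  by apply: ler_pM; lra.
lra.
Qed.
End local_A.

Section local_A2.
Context {R : realType}.
Implicit Types (t c e l r m C S K gam : R).
Local Notation q := (pi / 2 : R).
Local Notation s := (@ellipse_speed R).
Local Notation t0 := (@tcut R).
Local Notation n0 := (acos (72 / 97) : R).
Local Notation n1 := (acos (21 / 29) : R).

Lemma lerB_norm (u v d : R) : `|u - v| <= d -> v - d <= u /\ u <= v + d.
Proof. by rewrite ler_norml => /andP[h1 h2]; split; lra. Qed.

Lemma small_coord (x y r : R) : 0 <= r -> x ^+ 2 + y ^+ 2 <= r ^+ 2 ->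
  [/\ - r <= x, x <= r, - r <= y & y <= r].
Proof.
move=> r0 h; have n (z : R) : z ^+ 2 <= r ^+ 2 -> - r <= z /\ z <= r.
  move=> hz; suff /andP[] : - r <= z <= r by [].
  by rewrite -ler_norml -(@ler_pXn2r _ 2) ?nnegrE// real_normK ?num_real.
have [] := n x; first by have := sqr_ge0 y; lra.
have [] := n y; first by have := sqr_ge0 x; lra.
by [].
Qed.

Lemma s_t0 : s t0 <= 154 / 100 + 32 / 100 / 100.
Proof.
have [_ _ _ _ [_ _ _ _ [ls us _ _]]] := @numbersP R.
apply: speed_le; last lra.
have h0 : 0 <= 67 / 100 + 84 / 100 / 100 :> R by lra.
have [_ h] := mul_itv h0 h0 ls us ls us.
by rewrite expr2; move: (sin t0 * sin t0) h {ls us h0} => z h; lra.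
Qed.

Lemma s_n1 : s n1 <= 155 / 100 + 80 / 100 / 100.
Proof.
by apply: speed_le; [have [_ _ _ -> _] := @n1_trig R; lra|lra].
Qed.

Section copy.
Context (x y : R) (hr : x ^+ 2 + y ^+ 2 <= (@rad R) ^+ 2).
Local Notation c1 := (a1 + x).
Local Notation e := ((a1 + x) ^+ 2 + (0 + y) ^+ 2).
Local Notation g := (gfun (a1 + x) (0 + y) ((a1 + x) ^+ 2 + (0 + y) ^+ 2)).
Local Notation dg := (dgfun (a1 + x) (0 + y)).

Lemma near_a1 : 178 / 100 + 70 / 100 / 100 <= c1.
Proof.
have [la _ _ _ _] := @numbersP R.
have [h _ _ _] := small_coord (@rad0 R) hr; move: h; rewrite /rad.
by move: (a1 : R) la => a la h; lra.
Qed.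

Lemma copyA_conc u : 0 <= u <= q -> ddgfun c1 (0 + y) u <= 0.
Proof.
apply: concave_A; first exact: near_a1.
have [_ _ h1 h2] := small_coord (@rad0 R) hr; move: h1 h2; rewrite /rad add0r.
by move=> *; apply/andP; split; lra.
Qed.

Lemma copyA_n0 : 0 <= g n0.
Proof.
have [_ _ C S _] := @n0_trig R; have [la ua _ _ _] := @numbersP R.
have m0 : 0 <= 74 / 100 + 50 / 100 / 100 :> R by lra.
have h : (2 * cos n0 - a1) ^+ 2 + (sin n0 - 0) ^+ 2 <= (74 / 100 + 50 / 100 / 100) ^+ 2.
  have h1 : (2 * cos n0 - a1) ^+ 2 <= (31 / 100 + 32 / 100 / 100) ^+ 2.
    by apply: sqr_le_sym; rewrite C; apply/andP; split; lra.
  by rewrite S; move: (_ ^+ 2) h1 => z h1; lra.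
have [h1 _] := lerB_norm (gfun_near hr m0 h).
apply: le_trans h1; have := @baseA_n0 R; rewrite /rad.
by move: (gfun _ _ _ _) => z hz; clear h la ua C S; lra.
Qed.

Lemma copyA_0 : 0 <= g 0.
Proof.
have [la ua _ _ _] := @numbersP R.
have m0 : 0 <= 1 / 2 :> R by lra.
have h : (2 * cos (0 : R) - a1) ^+ 2 + (sin (0 : R) - 0) ^+ 2 <= (1 / 2) ^+ 2.
  rewrite sin0 subr0 expr0n addr0; apply: sqr_le_sym; rewrite cos0.
  by apply/andP; split; lra.
have [h1 _] := lerB_norm (gfun_near hr m0 h).
apply: le_trans h1; have := @baseA_0 R; rewrite /rad.
by move: (gfun _ _ _ _) => z hz; clear h la ua; lra.
Qed.

Lemma copyA_n1 : g n1 <= 0.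
Proof.
have [_ _ C S _] := @n1_trig R; have [la ua _ _ _] := @numbersP R.
have m0 : 0 <= 78 / 100 :> R by lra.
have h : (2 * cos n1 - a1) ^+ 2 + (sin n1 - 0) ^+ 2 <= (78 / 100) ^+ 2.
  have h1 : (2 * cos n1 - a1) ^+ 2 <= (35 / 100) ^+ 2.
    by apply: sqr_le_sym; rewrite C; apply/andP; split; lra.
  by rewrite S; move: (_ ^+ 2) h1 => z h1; lra.
have [_ h1] := lerB_norm (gfun_near hr m0 h).
apply: le_trans h1 _; have := @baseA_n1 R; rewrite /rad.
by move: (gfun _ _ _ _) => z hz; clear h la ua C S; lra.
Qed.

Lemma copyA_dn0 : dg n0 <= - (158 / 100 + 40 / 100 / 100).
Proof.
have [_ _ C S _] := @n0_trig R.
have m0 : 0 <= 307 / 100 :> R by lra.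
have h : 16 * sin n0 ^+ 2 + 4 * cos n0 ^+ 2 <= (307 / 100) ^+ 2 by rewrite C S; lra.
have [_ h1] := lerB_norm (dgfun_near a1 0 hr m0 h).
apply: le_trans h1 _; have := @dbaseA_n0 R; rewrite /rad.
by move: (dgfun _ _ _) => z hz; clear h C S; lra.
Qed.

Lemma md_t0 : 16 * sin t0 ^+ 2 + 4 * cos t0 ^+ 2 <= (309 / 100) ^+ 2.
Proof.
have [_ _ _ _ [_ _ _ _ [ls us _ _]]] := @numbersP R.
have h0 : 0 <= 67 / 100 + 84 / 100 / 100 :> R by lra.
have [_] := mul_itv h0 h0 ls us ls us; have := cos2Dsin2 t0; rewrite expr2 [sin _ ^+ 2]expr2.
by move: (sin t0 * sin t0) (cos t0 * cos t0) {ls us h0} => z w h h'; lra.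
Qed.

Lemma copyA_dt0 : dg t0 <= - (162 / 100 + 90 / 100 / 100).
Proof.
have m0 : 0 <= 309 / 100 :> R by lra.
have [_ h1] := lerB_norm (dgfun_near a1 0 hr m0 md_t0).
apply: le_trans h1 _; have := @dbaseA_t0 R; rewrite /rad.
by move: (dgfun _ _ _) => z hz; lra.
Qed.

(** The integral over the undisplaced half cell [[0, tcut]] errs by the positive part beyond [tcut]
    and the negative part on [[n0, tcut]]; on [[0, n0]] concavity keeps [g] nonnegative. Only one of
    the two parts of [g t0] is nonzero, so the two triangles combine into one square. *)
Lemma copyA : pint c1 (0 + y) e <=
  prim_g c1 (0 + y) e t0 + (48 / 100 + 72 / 100 / 100) * g t0 ^+ 2.
Proof.
have [p0 p1 _ _ _] := @n0_trig R; have [p2 p3 _ _ _] := @n1_trig R.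
have [r1 r2] := @order_A R; have /andP[t00 t0q] := @tcut_itv R.
have K0 : 0 < 162 / 100 + 90 / 100 / 100 :> R by lra.
have K1 : 0 < 158 / 100 + 40 / 100 / 100 :> R by lra.
have k0 : 155 / 100 + 80 / 100 / 100 <=
  (48 / 100 + 72 / 100 / 100) * (2 * (162 / 100 + 90 / 100 / 100)) :> R by lra.
have k1 : 154 / 100 + 32 / 100 / 100 <=
  (48 / 100 + 72 / 100 / 100) * (2 * (158 / 100 + 40 / 100 / 100)) :> R by lra.
rewrite /pint (itg_chasles (@continuous_gpos R _ _ _) (ltW t00) (ltW t0q)).
rewrite gpos_split// ?(ltW t00)//.
have -> : prim_g c1 (0 + y) e 0 = 0 by rewrite /prim_g -itg_gpoly0 itgxx.
rewrite subr0 -addrA lerD2l -(posp_sqr (g t0)) mulrDr addrC; apply: lerD.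
- have cc u : t0 < u < q -> ddgfun c1 (0 + y) u <= 0.
    by move=> /andP[u1 u2]; apply: copyA_conc; rewrite (ltW (lt_trans t00 u1)) ltW.
  apply: (gpos_zone_right (ltW t00) (lexx q) cc _ K0 copyA_dt0 copyA_n1 s_n1 k0).
  by rewrite r2 p3.
- rewrite (itg_chasles (@continuous_gneg R _ _ _) (ltW p0) r1).
  rewrite gneg_vanish ?(add0r (itg _ _ _)).
  + have cc u : n0 < u < t0 -> ddgfun c1 (0 + y) u <= 0.
      move=> /andP[u1 u2]; apply: copyA_conc.
      by rewrite (ltW (lt_trans p0 u1)) (ltW (lt_trans u2 t0q)).
    exact: (gneg_zone_right _ (ltW p0) r1 (ltW t0q) cc K1 copyA_dn0 s_t0 k1).
  + exact: ltW.
  + move=> t ht; apply: (gfun_concave_ge0 (ltW p0) _ ht copyA_0 copyA_n0).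
    move=> u /andP[u1 u2]; apply: copyA_conc.
    by rewrite (ltW u1) (le_trans (ltW u2) p1).
Qed.

End copy.

Lemma pint_vanish (c1 c2 e : R) : (forall t, 0 <= t <= q -> gfun c1 c2 e t <= 0) ->
  pint c1 c2 e = 0.
Proof. by move=> h; apply: gpos_vanish => //; exact/ltW/q_gt0. Qed.

Lemma pint_opposite (c1 c2 : R) : 1 <= c1 -> pint (- c1) c2 (c1 ^+ 2 + c2 ^+ 2) = 0.
Proof.
move=> h; apply: pint_vanish => t tq; rewrite -(sqrrN c1) gfun_dist.
have x0 := cos_ge0q tq; have := @v_le R t; have := sqr_ge0 (sin t - c2).
have : 1 <= (2 * cos t - - c1) ^+ 2 by rewrite expr2 -[leLHS]mulr1; apply: ler_pM; lra.
by move: (_ ^+ 2) (_ ^+ 2) => a b; lra.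
Qed.

(** The term linear in [y] survives because this is only half of the cell; it cancels against the
    half reflected in the major axis. *)
Lemma prim_A (x y : R) : prim_g (a1 + x) y ((a1 + x) ^+ 2 + y ^+ 2) t0 =
  Kval / 2 - (x ^+ 2 + y ^+ 2) * massA + 2 * y * ymoment t0.
Proof.
have := @cell_A R ((a1 + x) ^+ 2 + y ^+ 2); have := @xmoment_A R.
rewrite /prim_g /prim_gpoly -/massA => ->; lra.
Qed.

(** The gain is twice [massA], at least 1.807. The critical direction is [y], where the ends of the
    cell cost [0.4872 * 8 * 0.6785^2], about 1.794. *)
Lemma Lam_A (x y : R) : x ^+ 2 + y ^+ 2 <= rad ^+ 2 ->
  Lam (a1 + x) y <= Kval - 1 / 100 * (x ^+ 2 + y ^+ 2).
Proof.
move=> hr; have hr' : x ^+ 2 + (- y) ^+ 2 <= rad ^+ 2 by rewrite sqrrN.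
have c1b : 1 <= a1 + x by have := near_a1 hr; lra.
have e1 := pint_opposite y c1b; have e2 := pint_opposite (- y) c1b; rewrite sqrrN in e2.
rewrite /Lam /LamE e1 e2 !addr0.
have := copyA hr; have := copyA hr'; rewrite !add0r !sqrrN prim_A.
have := prim_A x (- y); rewrite sqrrN => ->.
have g0 : gfun a1 0 (a1 ^+ 2 + 0 ^+ 2) t0 = 0 by rewrite expr0n addr0 gfun_A.
have gE z : gfun (a1 + x) z ((a1 + x) ^+ 2 + z ^+ 2) t0 =
    2 * ((2 * cos t0 - a1) * x + sin t0 * z) - (x ^+ 2 + z ^+ 2).
  by have := gfun_shift a1 0 x z t0; rewrite g0 !add0r subr0.
rewrite gE; have := gE (- y); rewrite sqrrN => ->.
have [la ua _ _ [_ _ lc uc [ls us lm _]]] := @numbersP R.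
have h1 : (2 * cos t0 - a1) ^+ 2 <= (32 / 100 + 84 / 100 / 100) ^+ 2.
  by apply: sqr_le_sym; apply/andP; split; lra.
have h2 : sin t0 ^+ 2 <= (67 / 100 + 85 / 100 / 100) ^+ 2.
  by apply: sqr_le_sym; apply/andP; split; lra.
move: (2 * cos t0 - a1) (sin t0) h1 h2 lm (ymoment t0) hr {hr' la ua lc uc ls us g0 gE e1 e2 c1b}.
move: (massA : R) (Kval : R) (pint _ _ _) (pint _ _ _) => M K p p' al be h1 h2 lm Y hr k1 k2.
set E := x ^+ 2 + y ^+ 2 in hr k1 k2 *.
have E0 : 0 <= E by rewrite addr_ge0 ?sqr_ge0.
have m1 : al ^+ 2 * x ^+ 2 <= (32 / 100 + 84 / 100 / 100) ^+ 2 * x ^+ 2.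
  by rewrite ler_wpM2r ?sqr_ge0.
have m2 : be ^+ 2 * y ^+ 2 <= (67 / 100 + 85 / 100 / 100) ^+ 2 * y ^+ 2.
  by rewrite ler_wpM2r ?sqr_ge0.
have m3 : E * E <= (1 / 100) ^+ 2 * E.
  by rewrite ler_wpM2r//; apply: le_trans hr _; rewrite /rad; lra.
have m4 : (90 / 100 + 35 / 100 / 100) * E <= M * E by rewrite ler_wpM2r.
have m5 := sqr_ge0 (2 * al * x + E).
have x0 := sqr_ge0 x; have y0 := sqr_ge0 y.
have EE : E = x ^+ 2 + y ^+ 2 by [].
clearbody E.
(* The sum is [2 (2 al x - E)^2 + 8 be^2 y^2], the mixed terms in [y] having cancelled; [m5] then
   bounds its first part by [16 al^2 x^2 + 4 E^2]. *)
have : (2 * (al * x + be * y) - E) ^+ 2 + (2 * (al * x + be * - y) - E) ^+ 2 <=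
  16 * (al ^+ 2 * x ^+ 2) + 4 * (E * E) + 8 * (be ^+ 2 * y ^+ 2).
  by clear -m5; lra.
move: ((2 * (al * x + be * y) - E) ^+ 2) ((2 * (al * x + be * - y) - E) ^+ 2) k1 k2 => D D'.
move: (E * E) (al ^+ 2 * x ^+ 2) (be ^+ 2 * y ^+ 2) m1 m2 m3 => EE' X Y' m1 m2 m3 k1 k2 k3.
move: (x ^+ 2) (y ^+ 2) x0 y0 EE m1 m2 => x2 y2 x0 y0 EE m1 m2.
clear m5 hr h1 h2 lm.
lra.
Qed.
End local_A2.

(** * Near the contact point inside the quadrant *)

Section local_B.
Context {R : realType}.
Implicit Types (t c e l r m C S K gam : R).
Local Notation q := (pi / 2 : R).
Local Notation s := (@ellipse_speed R).
Local Notation t0 := (@tcut R).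
Local Notation th := (acos (80 / 100 + 70 / 100 / 100) : R).
Local Notation nt := (acos (780 / 1069) : R).
Local Notation nq := (acos (60 / 100 / 100) : R).
Local Notation ph := (acos (6 / 100) : R).

Lemma th_trig : [/\ 0 < th, th <= q & cos th = 80 / 100 + 70 / 100 / 100].
Proof.
have C : 0 <= (80 / 100 + 70 / 100 / 100 : R) < 1 by apply/andP; split; lra.
by have [h1 h2 h3 _ _] := acos_point C.
Qed.
Lemma ph_trig : [/\ 0 < ph, ph <= q & cos ph = 6 / 100].
Proof.
have C : 0 <= (6 / 100 : R) < 1 by apply/andP; split; lra.
by have [h1 h2 h3 _ _] := acos_point C.
Qed.
(** Again a Pythagorean triple, [(731, 780, 1069)], for an angle just above [tcut]. *)
Lemma nt_trig : [/\ 0 < nt, nt <= q, cos nt = 780 / 1069, sin nt = 731 / 1069 &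
  zc nt = 2 * (780 / 1069) ^+ 2 - 1].
Proof.
have C : 0 <= (780 / 1069 : R) < 1 by apply/andP; split; lra.
have [h1 h2 h3 _ _] := acos_point C.
have h4 : sin nt = 731 / 1069 by apply: (sin_acos_pyth C); lra.
by rewrite zc_cos h3.
Qed.
Lemma nq_trig : [/\ 0 < nq, nq <= q, cos nq = 60 / 100 / 100,
  1 - (60 / 100 / 100) ^+ 2 <= sin nq /\ sin nq <= 1 &
  zc nq = 2 * (60 / 100 / 100) ^+ 2 - 1].
Proof.
have C : 0 <= (60 / 100 / 100 : R) < 1 by apply/andP; split; lra.
have [h1 h2 h3 h4 h5] := acos_point C.
rewrite zc_cos h3; split=> //; split; last exact: sin_le1.
have s1 := sin_le1 nq; have h : 0 <= sin nq * (1 - sin nq) by rewrite mulr_ge0 ?subr_ge0.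
by rewrite -h5; lra.
Qed.

Lemma order_B : [/\ th <= t0, t0 <= nt, nt <= nq & ph <= nq].
Proof.
have [_ _ _ _ [_ _ lc uc _]] := @numbersP R.
have [a0 a1 a2] := th_trig; have [b0 b1 b2] := ph_trig.
have [c0 c1 c2 _ _] := nt_trig; have [d0 d1 d2 _ _] := nq_trig.
have e1 : cos t0 < cos th by rewrite a2; clear -uc; lra.
have e2 : cos nt < cos t0 by rewrite c2; clear -lc; lra.
have e3 : cos nq < cos nt by rewrite c2 d2; clear; lra.
have e4 : cos nq < cos ph by rewrite b2 d2; clear; lra.
by split; apply/ltW/cos_lt_inv => //; do ?exact: q_pi; exact: t0_pi.
Qed.

Lemma b_sqr : [/\ (74 / 100 + 82 / 100 / 100) * b1 <= b1 ^+ 2 :> R,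
   b1 ^+ 2 <= (74 / 100 + 83 / 100 / 100) * b1 :> R,
   (89 / 100 + 76 / 100 / 100) * b2 <= b2 ^+ 2 :> R &
   b2 ^+ 2 <= (89 / 100 + 77 / 100 / 100) * b2 :> R].
Proof.
have [_ _ l1 u1 [l2 u2 _ _ _]] := @numbersP R.
have p1 : 0 <= b1 :> R by lra. have p2 : 0 <= b2 :> R by lra.
by rewrite !expr2; split; rewrite ler_wpM2r.
Qed.

Lemma baseB_nt : 17 / 100 / 10 <= gfun b1 b2 (b1 ^+ 2 + b2 ^+ 2) nt.
Proof.
have [_ _ l1 u1 [l2 u2 _ _ _]] := @numbersP R; have [lw0 uw0 lw1 uw1 [lw2 uw2 lk uk]] := @weightsP R.
have [_ _ c s' z] := nt_trig; rewrite gfunE c s' z.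
have [_ h1 _ h2] := b_sqr; clear c s' z; lra.
Qed.

Lemma baseB_nq : 165 / 100 / 100 <= gfun b1 b2 (b1 ^+ 2 + b2 ^+ 2) nq.
Proof.
have [_ _ l1 u1 [l2 u2 _ _ _]] := @numbersP R; have [lw0 uw0 lw1 uw1 [lw2 uw2 lk uk]] := @weightsP R.
have [_ _ c [s1 s2] z] := nq_trig; rewrite gfunE c z.
have h3 : (1 - (60 / 100 / 100) ^+ 2) * b2 <= sin nq * b2 by rewrite ler_wpM2r//; lra.
have [_ h1 _ h2] := b_sqr; move: (sin nq * b2) (mulrC (sin nq) b2) h3 => S E h3.
rewrite -[2 * b2 * _]mulrA -E.
move: (b1 ^+ 2) (b2 ^+ 2) h1 h2 => B1 B2 h1 h2; clear c s1 s2 z E; lra.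
Qed.

Lemma dbaseB_nt : 247 / 100 + 80 / 100 / 100 <= dgfun b1 b2 nt.
Proof.
have [_ _ l1 u1 [l2 u2 _ _ _]] := @numbersP R; have [lw0 uw0 lw1 uw1 [lw2 uw2 lk uk]] := @weightsP R.
have [_ _ c s' z] := nt_trig; rewrite dgfunE c s' z.
clear c s' z lw0 uw0; lra.
Qed.

Lemma dbaseB_nq : dgfun b1 b2 nq <= - (295 / 100 + 10 / 100 / 100).
Proof.
have [_ _ l1 u1 [l2 u2 _ _ _]] := @numbersP R; have [lw0 uw0 lw1 uw1 [lw2 uw2 lk uk]] := @weightsP R.
have [_ _ c [s1 s2] z] := nq_trig; rewrite dgfunE c z.
have h0 : 0 <= 1 - (60 / 100 / 100) ^+ 2 :> R by lra.
have p1 : 0 <= 74 / 100 + 82 / 100 / 100 :> R by lra.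
have [h1 _] := mul_itv p1 h0 l1 u1 s1 s2.
set P := w1 + _ + _.
have h2 : sin nq * - P <= 1 * (125 / 100 + 50 / 100 / 100).
  by apply: ler_pM; rewrite /P; clear c z h1 l1 u1 l2 u2 lw0 uw0; lra.
have -> : 4 * (sin nq * (60 / 100 / 100)) * P = - (4 * (60 / 100 / 100)) * (sin nq * - P) by ring.
rewrite -[4 * b1 * _]mulrA; move: (sin nq * - P) (b1 * sin nq) h1 h2 => X Y h1 h2.
clear c s1 s2 z h0 p1 lw0 uw0 lw1 uw1 lw2 uw2 lk uk l1 u1; lra.
Qed.

Lemma dbaseB_t0 : 249 / 100 + 80 / 100 / 100 <= dgfun b1 b2 t0.
Proof.
have [_ _ l1 u1 [l2 u2 lc uc [ls us _ _]]] := @numbersP R.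
have [h1 _ h3 h4] := @slope_t0 R; rewrite dgfunE.
move: (sin t0 * cos t0) (w1 + _ + _) h1 h3 h4 => S P h1 h3 h4.
have m1 : (49 / 100 + 83 / 100 / 100) * (161 / 100 + 9 / 100 / 100) <= S * - P.
  by apply: ler_pM; clear l1 u1 l2 u2 lc uc ls us h4; lra.
have p1 : 0 <= 74 / 100 + 82 / 100 / 100 :> R by lra.
have p2 : 0 <= 89 / 100 + 76 / 100 / 100 :> R by lra.
have p3 : 0 <= 67 / 100 + 84 / 100 / 100 :> R by lra.
have p4 : 0 <= 73 / 100 + 46 / 100 / 100 :> R by lra.
have [_ m2] := mul_itv p1 p3 l1 u1 ls us; have [m3 _] := mul_itv p2 p4 l2 u2 lc uc.
rewrite -[4 * S * P]mulrA -[4 * b1 * _]mulrA -[2 * b2 * _]mulrA.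
have -> : S * P = - (S * - P) by ring.
move: (S * - P) (b1 * _) (b2 * _) m1 m2 m3 => X Y Z m1 m2 m3.
clear p1 p2 p3 p4 l1 u1 l2 u2 lc uc ls us h1 h3 h4; lra.
Qed.
End local_B.

Section local_B2.
Context {R : realType}.
Implicit Types (t c e l r m C S K gam : R).
Local Notation q := (pi / 2 : R).
Local Notation s := (@ellipse_speed R).
Local Notation t0 := (@tcut R).
Local Notation th := (acos (80 / 100 + 70 / 100 / 100) : R).
Local Notation nt := (acos (780 / 1069) : R).
Local Notation nq := (acos (60 / 100 / 100) : R).
Local Notation ph := (acos (6 / 100) : R).
Local Notation Kt := (31 / 100 + 68 / 100 / 100 : R).
Local Notation Kq := (34 / 100 + 36 / 100 / 100 : R).

Lemma s_nt : s nt <= 155 / 100 + 2 / 100 / 100.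
Proof.
by apply: speed_le; [have [_ _ _ -> _] := @nt_trig R; lra|lra].
Qed.
Lemma s_q : s q <= 2.
Proof. by apply: speed_le; [rewrite sin_pihalf; lra|lra]. Qed.

Lemma cos_pi_sub (u : R) : cos (pi - u) = - cos u.
Proof. by rewrite cosB cospi sinpi; ring. Qed.
Lemma sin_pi_sub (u : R) : sin (pi - u) = sin u.
Proof. by rewrite sinB cospi sinpi; ring. Qed.

Section copy.
Context (x y : R) (hr : x ^+ 2 + y ^+ 2 <= (@rad R) ^+ 2).
Local Notation c1 := (b1 + x).
Local Notation c2 := (b2 + y).
Local Notation e := ((b1 + x) ^+ 2 + (b2 + y) ^+ 2).
Local Notation g := (gfun (b1 + x) (b2 + y) ((b1 + x) ^+ 2 + (b2 + y) ^+ 2)).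
Local Notation dg := (dgfun (b1 + x) (b2 + y)).

Lemma near_b : [/\ 73 / 100 + 80 / 100 / 100 <= c1, c1 <= 76 / 100 &
   88 / 100 + 70 / 100 / 100 <= c2].
Proof.
have [_ _ l1 u1 [l2 _ _ _ _]] := @numbersP R.
have [h1 h2 h3 h4] := small_coord (@rad0 R) hr; move: h1 h2 h3 h4; rewrite /rad.
by move: (b1 : R) (b2 : R) l1 u1 l2 => a b *; split; lra.
Qed.

Lemma copyB_conc u : - (6 / 100) <= cos u <= 80 / 100 + 70 / 100 / 100 -> 0 <= sin u ->
  ddgfun c1 c2 u <= 0.
Proof.
by have [h1 h2 h3] := near_b; move=> hc hs; apply: concave_B => //; rewrite h1.
Qed.

Lemma copyB_conc_itv u : th <= u <= q -> ddgfun c1 c2 u <= 0.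
Proof.
have [p0 p1 p2] := @th_trig R; move=> /andP[u0 uq]; have u1 := lt_le_trans p0 u0.
have uq' : 0 <= u <= q by rewrite (ltW u1).
apply: copyB_conc; last exact: sin_ge0q.
rewrite -p2 (cos_le_anti (q_pi p0 p1) (q_pi u1 uq) u0) andbT.
by apply: le_trans (cos_ge0q uq'); rewrite oppr_le0; lra.
Qed.

Lemma copyB_nt : 0 <= g nt.
Proof.
have [_ _ C S _] := @nt_trig R; have [_ _ l1 u1 [l2 u2 _ _ _]] := @numbersP R.
have m0 : 0 <= 74 / 100 + 30 / 100 / 100 :> R by lra.
have h : (2 * cos nt - b1) ^+ 2 + (sin nt - b2) ^+ 2 <= (74 / 100 + 30 / 100 / 100) ^+ 2.
  have h1 : (2 * cos nt - b1) ^+ 2 <= (71 / 100 + 13 / 100 / 100) ^+ 2.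
    by apply: sqr_le_sym; rewrite C; apply/andP; split; lra.
  have h2 : (sin nt - b2) ^+ 2 <= (21 / 100 + 39 / 100 / 100) ^+ 2.
    by apply: sqr_le_sym; rewrite S; apply/andP; split; lra.
  by move: ((2 * cos nt - b1) ^+ 2) ((sin nt - b2) ^+ 2) h1 h2 => z z' h1 h2; clear C S l1 u1 l2 u2; lra.
have [h1 _] := lerB_norm (gfun_near hr m0 h).
apply: le_trans h1; have := @baseB_nt R; rewrite /rad.
by move: (gfun _ _ _ _) => z hz; clear h C S l1 u1 l2 u2; lra.
Qed.

Lemma copyB_nq : 0 <= g nq.
Proof.
have [_ _ C [S1 S2] _] := @nq_trig R; have [_ _ l1 u1 [l2 u2 _ _ _]] := @numbersP R.
have m0 : 0 <= 74 / 100 + 40 / 100 / 100 :> R by lra.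
have h : (2 * cos nq - b1) ^+ 2 + (sin nq - b2) ^+ 2 <= (74 / 100 + 40 / 100 / 100) ^+ 2.
  have h1 : (2 * cos nq - b1) ^+ 2 <= (73 / 100 + 63 / 100 / 100) ^+ 2.
    by apply: sqr_le_sym; rewrite C; apply/andP; split; lra.
  have h2 : (sin nq - b2) ^+ 2 <= (10 / 100 + 24 / 100 / 100) ^+ 2.
    by apply: sqr_le_sym; apply/andP; split; lra.
  by move: ((2 * cos nq - b1) ^+ 2) ((sin nq - b2) ^+ 2) h1 h2 => z z' h1 h2; clear C S1 S2 l1 u1 l2 u2; lra.
have [h1 _] := lerB_norm (gfun_near hr m0 h).
apply: le_trans h1; have := @baseB_nq R; rewrite /rad.
by move: (gfun _ _ _ _) => z hz; clear h C S1 S2 l1 u1 l2 u2; lra.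
Qed.

Lemma copyB_dnt : 244 / 100 + 70 / 100 / 100 <= dg nt.
Proof.
have [_ _ C S _] := @nt_trig R.
have m0 : 0 <= 310 / 100 + 20 / 100 / 100 :> R by lra.
have h : 16 * sin nt ^+ 2 + 4 * cos nt ^+ 2 <= (310 / 100 + 20 / 100 / 100) ^+ 2 by rewrite C S; lra.
have [h1 _] := lerB_norm (dgfun_near b1 b2 hr m0 h).
apply: le_trans h1; have := @dbaseB_nt R; rewrite /rad.
by move: (dgfun _ _ _) => z hz; clear h C S; lra.
Qed.

Lemma copyB_dnq : dg nq <= - (291 / 100 + 10 / 100 / 100).
Proof.
have m0 : 0 <= 4 :> R by lra.
have h : 16 * sin nq ^+ 2 + 4 * cos nq ^+ 2 <= 4 ^+ 2.
  by have := cos2Dsin2 nq; have := sqr_ge0 (cos nq); move: (cos nq ^+ 2) (sin nq ^+ 2) => z w; lra.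
have [_ h1] := lerB_norm (dgfun_near b1 b2 hr m0 h).
apply: le_trans h1 _; have := @dbaseB_nq R; rewrite /rad.
by move: (dgfun _ _ _) => z hz; clear h; lra.
Qed.

Lemma copyB_dt0 : 246 / 100 + 70 / 100 / 100 <= dg t0.
Proof.
have m0 : 0 <= 309 / 100 :> R by lra.
have [h1 _] := lerB_norm (dgfun_near b1 b2 hr m0 (@md_t0 R)).
apply: le_trans h1; have := @dbaseB_t0 R; rewrite /rad.
by move: (dgfun _ _ _) => z hz; lra.
Qed.

Lemma copyB_far t : 0 <= t <= th -> g t <= 0.
Proof.
move=> /andP[t1 t2]; have [p0 p1 p2] := @th_trig R; have [h1 h2 _] := near_b.
have tpi : 0 <= t <= pi by have /andP[_ h] := q_pi p0 p1; rewrite t1 (le_trans t2).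
have := cos_le_anti tpi (q_pi p0 p1) t2; rewrite p2 => ct.
rewrite gfun_dist; have := @v_le R t; have := sqr_ge0 (sin t - (b2 + y)).
have : (85 / 100) * (85 / 100) <= (2 * cos t - c1) ^+ 2.
  by rewrite expr2; apply: ler_pM; lra.
by move: ((2 * cos t - c1) ^+ 2) ((sin t - (b2 + y)) ^+ 2) => a b; lra.
Qed.

(** At [tcut] both signs of [g t0] are accounted for on this quarter and combine into a square. At
    [pi / 2] only the negative part appears here: a positive value means that the cell crosses the
    minor axis, which [copyB_mirror] charges to the neighbouring quarter. *)
Lemma copyB : pint c1 c2 e <= (prim_g c1 c2 e q - prim_g c1 c2 e t0) +
  Kt * g t0 ^+ 2 + Kq * posp (- g q) ^+ 2.
Proof.
have [p0 p1 _] := @th_trig R; have [n1 n2 _ _ _] := @nt_trig R.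
have [m1 m2 _ _ _] := @nq_trig R.
have [r1 r2 r3 _] := @order_B R; have /andP[t00 t0q] := @tcut_itv R.
have K1 : 0 < 246 / 100 + 70 / 100 / 100 :> R by lra.
have K2 : 0 < 244 / 100 + 70 / 100 / 100 :> R by lra.
have K3 : 0 < 291 / 100 + 10 / 100 / 100 :> R by lra.
have k1 : 154 / 100 + 32 / 100 / 100 <= Kt * (2 * (246 / 100 + 70 / 100 / 100)) by lra.
have k2 : 155 / 100 + 2 / 100 / 100 <= Kt * (2 * (244 / 100 + 70 / 100 / 100)) by lra.
have k3 : 2 <= Kq * (2 * (291 / 100 + 10 / 100 / 100)) by lra.
have cg := @continuous_gpos R c1 c2 e; have cn := @continuous_gneg R c1 c2 e.
have cc a b : th <= a -> b <= q -> forall u, a < u < b -> ddgfun c1 c2 u <= 0.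
  move=> ha hb u /andP[u1 u2]; apply: copyB_conc_itv.
  by rewrite (le_trans ha (ltW u1)) (le_trans (ltW u2) hb).
have tn := le_trans r1 r2.
rewrite /pint (itg_chasles cg (ltW p0) p1) (gpos_vanish (ltW p0) copyB_far) (add0r (itg _ _ _)).
rewrite (itg_chasles cg r1 (ltW t0q)) (gpos_split c1 c2 e (ltW t00) (ltW t0q)).
rewrite (itg_chasles cn r2 n2) (itg_chasles cn r3 m2).
have z1 := gpos_zone_left e (ltW p0) r1 (ltW t0q) (cc th t0 (lexx _) (ltW t0q)) K1 copyB_dt0 (@s_t0 R) k1.
have z2 := gneg_zone_left e (ltW t00) r2 n2 (cc t0 nt r1 n2) K2 copyB_dnt s_nt k2.
have z3 := gneg_zone_right e (ltW m1) m2 (lexx q) (cc nq q (le_trans tn r3) (lexx q)) K3 copyB_dnq s_q k3.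
rewrite (gneg_vanish r3); last first.
  move=> t ht.
  exact: (gfun_concave_ge0 r3 (cc nt nq tn m2) ht copyB_nt copyB_nq).
rewrite -(posp_sqr (g t0)).
rewrite mulrDr; apply: le_trans (lerD z1 (lerD (lexx _) (lerD z2 (lerD (lexx 0) z3)))) _.
by rewrite le_eqVlt; apply/orP; left; apply/eqP; ring.
Qed.

Lemma copyB_mirror_dist t : gfun (- c1) c2 e t = gfun (- c1) c2 ((- c1) ^+ 2 + c2 ^+ 2) t.
Proof. by rewrite sqrrN. Qed.

(** The reflected point sees the curve past the minor axis: [g] at [pi - u] becomes a function of
    [u], and its concavity is that of [copyB_conc] with [cos] slightly negative. Before the angle
    with cosine 0.06 the point is too far away. *)
Lemma copyB_mirror : pint (- c1) c2 e <= Kq * posp (g q) ^+ 2.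
Proof.
have [p0 p1 p2] := @ph_trig R; have [h1 h2 h3] := near_b.
have cg := @continuous_gpos R (- c1) c2 e.
have gq : g q = gfun (- c1) c2 e q by rewrite !gfunE cos_pihalf; ring.
rewrite /pint (itg_chasles cg (ltW p0) p1) gpos_vanish; first 1 last.
- exact: ltW.
- move=> t /andP[t1 t2].
  have tpi : 0 <= t <= pi by have /andP[_ h] := q_pi p0 p1; rewrite t1 (le_trans t2).
  have := cos_le_anti tpi (q_pi p0 p1) t2; rewrite p2 => ct.
  rewrite copyB_mirror_dist gfun_dist; have := @v_le R t; have := sqr_ge0 (sin t - (b2 + y)).
  have : (85 / 100) * (85 / 100) <= (2 * cos t - - c1) ^+ 2.
    by rewrite expr2; apply: ler_pM; lra.
  by move: ((2 * cos t - - c1) ^+ 2) ((sin t - (b2 + y)) ^+ 2) => a b; lra.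
rewrite (add0r (itg _ _ _)) gq.
have K3 : 0 < 295 / 100 + 20 / 100 / 100 :> R by lra.
have k3 : 2 <= Kq * (2 * (295 / 100 + 20 / 100 / 100)) by lra.
apply: (gpos_zone_left e (ltW p0) p1 (lexx q) _ K3 _ s_q k3).
- move=> u /andP[u1 u2]; have u0 := lt_trans p0 u1.
  have -> : ddgfun (- c1) c2 u = ddgfun c1 c2 (pi - u).
    by rewrite /ddgfun /ddgpoly !zc_cos cos_pi_sub sin_pi_sub sqrrN; ring.
  have su : 0 <= sin u by apply: sin_ge0q; rewrite (ltW u0) ltW.
  have cu : 0 <= cos u by apply: cos_ge0q; rewrite (ltW u0) ltW.
  have := cos_le_anti (q_pi p0 p1) (q_pi u0 (ltW u2)) (ltW u1); rewrite p2 => ct.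
  apply: copyB_conc; rewrite ?cos_pi_sub ?sin_pi_sub//.
  by apply/andP; split; lra.
- rewrite dgfunE cos_pihalf sin_pihalf.
  by have [_ _ l1 _ _] := @numbersP R; have [h _ _ _] := small_coord (@rad0 R) hr;
    move: h; rewrite /rad; move: (b1 : R) l1 {h1 h2 h3 gq cg} => b l1 h; lra.
Qed.

Lemma copyB_zero : pint c1 (- c2) e = 0 /\ pint (- c1) (- c2) e = 0.
Proof.
have [h1 h2 h3] := near_b.
have V d t : 0 <= t <= q -> d ^+ 2 = c1 ^+ 2 -> gfun d (- c2) e t <= 0.
  move=> tq dE; rewrite -dE -(sqrrN c2) gfun_dist.
  have := sin_ge0q tq; have := @v_le R t; have := sqr_ge0 (2 * cos t - d) => a b c.
  have : (85 / 100) * (85 / 100) <= (sin t - - c2) ^+ 2.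
    by rewrite expr2; apply: ler_pM; lra.
  by move: ((2 * cos t - d) ^+ 2) ((sin t - - c2) ^+ 2) a => *; lra.
by split; apply: pint_vanish => t tq; apply: V => //; rewrite sqrrN.
Qed.

End copy.

Lemma sqr_lin_le (a b M x y : R) : `|a * x + b * y| <= M -> forall E, 0 <= E ->
  (2 * (a * x + b * y) - E) ^+ 2 <= 4 * M ^+ 2 + 4 * M * E + E ^+ 2.
Proof.
move=> h E E0; have M0 := le_trans (normr_ge0 _) h.
have -> : 4 * M ^+ 2 + 4 * M * E + E ^+ 2 = (2 * M + E) ^+ 2 by ring.
apply: sqr_le_sym; move: h; rewrite ler_norml; move: (a * x + b * y) => L /andP[h1 h2].
by apply/andP; split; lra.
Qed.

Lemma lin_abs (a b A B x y : R) : `|a| <= A -> `|b| <= B ->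
  `|a * x + b * y| <= A * `|x| + B * `|y|.
Proof.
move=> ha hb; apply: le_trans (ler_normD _ _) _; rewrite !normrM.
by apply: lerD; apply: ler_wpM2r.
Qed.

Lemma prim_B (x y : R) :
  prim_g (b1 + x) (b2 + y) ((b1 + x) ^+ 2 + (b2 + y) ^+ 2) q -
  prim_g (b1 + x) (b2 + y) ((b1 + x) ^+ 2 + (b2 + y) ^+ 2) t0 =
  Kval - (x ^+ 2 + y ^+ 2) * massB.
Proof.
have := @cell_B R ((b1 + x) ^+ 2 + (b2 + y) ^+ 2); have := @xmoment_B R; have := @ymoment_B R.
rewrite /prim_g /prim_gpoly /massB; set M := moment 0 q; set M' := moment 0 t0.
set X := xmoment q; set X' := xmoment t0; set Y := ymoment q; set Y' := ymoment t0 => h1 h2 h3.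
have hx : x * (X - X') = x * (b1 * (M - M')) by rewrite h2.
have hy : y * (Y - Y') = y * (b2 * (M - M')) by rewrite h1.
lra.
Qed.

(* The quadratic form of the boundary terms, with [X = |x|] and [Y = |y|]. *)
Lemma form_B (X Y : R) : 0 <= X -> 0 <= Y ->
  Kt * (4 * ((72 / 100 + 12 / 100 / 100) * X + (21 / 100 + 93 / 100 / 100) * Y) ^+ 2) +
  Kq * (4 * ((74 / 100 + 83 / 100 / 100) * X + (10 / 100 + 24 / 100 / 100) * Y) ^+ 2)
  <= (149 / 100 + 76 / 100 / 100) * (X ^+ 2 + Y ^+ 2).
Proof.
(* 0.2150 completes the square in [Y] of the difference of the two sides. *)
by move=> X0 Y0; have h := sqr_ge0 (Y - (21 / 100 + 50 / 100 / 100) * X);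
  have := sqr_ge0 X; have := mulr_ge0 X0 Y0; lra.
Qed.

Lemma abs_form_le (A B m : R) (x y : R) : A ^+ 2 + B ^+ 2 <= m ^+ 2 -> 0 <= m ->
  x ^+ 2 + y ^+ 2 <= rad ^+ 2 -> A * `|x| + B * `|y| <= m * rad.
Proof.
move=> h m0; rewrite -(real_normK (num_real x)) -(real_normK (num_real y)) => hr.
by have /andP[] := lin_le h hr m0 (@rad0 R).
Qed.

(** The balance is narrow: the quadratic form costs 1.4976 and the higher-order terms about 0.0198
    within the radius [rad], against a mass of at least 1.5185; about 0.001 remains. *)
Lemma sum_B (p p' K m A B E Mq Mt Dq Dt : R) : A + B = Dq ^+ 2 ->
  Mq <= (75 / 100 + 60 / 100 / 100) * rad -> Mt <= (75 / 100 + 60 / 100 / 100) * rad ->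
  Kt * (4 * Mt ^+ 2) + Kq * (4 * Mq ^+ 2) <= (149 / 100 + 76 / 100 / 100) * E ->
  Dq ^+ 2 <= 4 * Mq ^+ 2 + 4 * Mq * E + E ^+ 2 ->
  Dt ^+ 2 <= 4 * Mt ^+ 2 + 4 * Mt * E + E ^+ 2 ->
  0 <= E -> E <= rad ^+ 2 -> 151 / 100 + 85 / 100 / 100 <= m ->
  p' <= Kq * A -> p <= K - E * m + Kt * Dt ^+ 2 + Kq * B ->
  p + p' <= K - 1 / 1000 * E.
Proof.
move=> hAB hq ht form hDq hDt E0 Er hm hp' hp.
have n1 : Mq * E <= (75 / 100 + 60 / 100 / 100) * rad * E by rewrite ler_wpM2r.
have n2 : Mt * E <= (75 / 100 + 60 / 100 / 100) * rad * E by rewrite ler_wpM2r.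
have n3 : E ^+ 2 <= rad ^+ 2 * E by rewrite expr2 ler_wpM2r.
have n4 : E * (151 / 100 + 85 / 100 / 100) <= E * m by rewrite ler_wpM2l.
rewrite -[4 * Mq * E]mulrA in hDq; rewrite -[4 * Mt * E]mulrA in hDt.
move: n1 n2 n3; rewrite /rad.
move: (Mq * E) (Mt * E) (E ^+ 2) (E * m) (Mq ^+ 2) (Mt ^+ 2) (Dq ^+ 2) (Dt ^+ 2)
  hDq hDt form hp hAB n4 {hq ht Er hm} => a b c d f g' h k hDq hDt form hp hAB n4 n1 n2 n3.
lra.
Qed.

Lemma Lam_B (x y : R) : x ^+ 2 + y ^+ 2 <= rad ^+ 2 ->
  Lam (b1 + x) (b2 + y) <= Kval - 1 / 1000 * (x ^+ 2 + y ^+ 2).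
Proof.
move=> hr; have [e1 e2] := copyB_zero hr.
have := copyB hr; have := copyB_mirror hr; rewrite /Lam /LamE e1 e2 !addr0 prim_B.
have [_ _ l1 u1 [l2 u2 lc uc [ls us _ lm]]] := @numbersP R.
set Dq := gfun _ _ _ q; set Dt := gfun _ _ _ t0; set E := x ^+ 2 + y ^+ 2.
have E0 : 0 <= E by rewrite addr_ge0 ?sqr_ge0.
have Er : E <= rad ^+ 2 by [].
have DtE : Dt = 2 * ((2 * cos t0 - b1) * x + (sin t0 - b2) * y) - E.
  by rewrite /Dt gfun_shift gfun_B add0r.
have DqE : Dq = 2 * (- b1 * x + (1 - b2) * y) - E.
  by rewrite /Dq gfun_shift gfun_q cos_pihalf sin_pihalf add0r mulr0 sub0r.
have h1 : `|2 * cos t0 - b1| <= 72 / 100 + 12 / 100 / 100.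
  by rewrite ler_norml; apply/andP; split; lra.
have h2 : `|sin t0 - b2| <= 21 / 100 + 93 / 100 / 100.
  by rewrite ler_norml; apply/andP; split; lra.
have h3 : `|- b1 : R| <= 74 / 100 + 83 / 100 / 100.
  by rewrite ler_norml; apply/andP; split; lra.
have h4 : `|1 - b2 : R| <= 10 / 100 + 24 / 100 / 100.
  by rewrite ler_norml; apply/andP; split; lra.
have gt := sqr_lin_le (lin_abs x y h1 h2) E0; have gq := sqr_lin_le (lin_abs x y h3 h4) E0.
rewrite -DtE in gt; rewrite -DqE in gq.
have := form_B (normr_ge0 x) (normr_ge0 y); rewrite !(real_normK (num_real _)) -/E => form.
have m0 : 0 <= 75 / 100 + 60 / 100 / 100 :> R by lra.
have f1 : (72 / 100 + 12 / 100 / 100) ^+ 2 + (21 / 100 + 93 / 100 / 100) ^+ 2 <=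
  (75 / 100 + 60 / 100 / 100) ^+ 2 :> R by lra.
have f2 : (74 / 100 + 83 / 100 / 100) ^+ 2 + (10 / 100 + 24 / 100 / 100) ^+ 2 <=
  (75 / 100 + 60 / 100 / 100) ^+ 2 :> R by lra.
have M1 := abs_form_le f1 m0 hr; have M2 := abs_form_le f2 m0 hr.
move=> hp' hp; exact: (sum_B (posp_sqr Dq) M2 M1 form gq gt E0 Er lm hp' hp).
Qed.
End local_B2.

(* [dec8 b u v w z k]: the ball [b] lies between [u v w z] and [u v w (z + k)] read in base 100,
   with [u] counting hundredths. *)
Definition dec8 (b : zball) (u v w z k : nat) : bool :=
  let m := (100 * (100 * (100 * Z.of_nat u + Z.of_nat v) + Z.of_nat w) + Z.of_nat z)%ZZ in
  Z.leb (m * bunit) (100000000 * (b.1 - b.2)) && Z.leb (100000000 * (b.1 + b.2)) ((m + Z.of_nat k) * bunit).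

Lemma dec8_check : [/\ dec8 b_cA 179 75 2 52 2, dec8 b_cB1 74 82 4 73 2 & dec8 b_cB2 89 76 9 21 2].
Proof. by vm_compute. Qed.

(** * The global bound: [Lam] is largest exactly at the contact points *)

Section Lam_bound.
Context {R : realType}.
Implicit Types (t c e l r m C S K gam : R).
Local Notation q := (pi / 2 : R).
Local Notation U := (@scale R).
Local Notation ZR m := (@ZR R m%ZZ).
Local Notation rp2 k := (@rp2 R k%ZZ).
Local Notation pt i := (ZR i / rp2 12).

Definition dec (u v w z : nat) : R :=
  u%:R / 100 + v%:R / 100 / 100 + w%:R / 100 / 100 / 100 + z%:R / 100 / 100 / 100 / 100.

Lemma dec8P (b : zball) (u v w z k : nat) (x : R) : inb b x -> dec8 b u v w z k ->
  dec u v w z <= x <= dec u v w z + k%:R / 100 / 100 / 100 / 100.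
Proof.
move=> /inbP/andP[h1 h2] /andP[/Z.leb_le/(@ler_ZR R) k1 /Z.leb_le/(@ler_ZR R) k2].
have U0 := @U_gt0 R.
have e8 : ZR 100000000 = 100 * 100 * 100 * 100.
  by rewrite (_ : 100000000 = Z.of_nat 100 * Z.of_nat 100 * Z.of_nat 100 * Z.of_nat 100)%ZZ//
    !(ZRM (_ * Z.of_nat 100)) (ZRM (Z.of_nat 100)) !ZR_nat.
have e2 : ZR 100 = 100 by rewrite -[ZR 100]/(ZR (Z.of_nat 100)) ZR_nat.
move: k1 k2; rewrite (ZRM (_ + _) bunit) (ZRM 100000000) (ZRM 100000000) (ZRM (_ + _ + _)).
rewrite (ZRD (_ + _) (Z.of_nat k)) (ZRD (100 * _)) (ZRM 100 (_ + _)) (ZRD (100 * _) (Z.of_nat w)).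
rewrite (ZRM 100 (_ + _)) (ZRD (100 * _) (Z.of_nat v)) (ZRM 100) !ZR_nat e8 e2 -UE (ZRB b.1) (ZRD b.1).
rewrite /dec; move: h1 h2; move: (ZR b.1) (ZR b.2) u%:R v%:R w%:R z%:R k%:R => m r a1 a2 a3 a4 a5 h1 h2 k1 k2.
by clear e8 e2; apply/andP; split; rewrite -(ler_pM2r U0); lra.
Qed.

Lemma contact_bounds : [/\ dec 179 75 2 52 <= a1 <= dec 179 75 2 52 + 2 / 100 / 100 / 100 / 100,
  dec 74 82 4 73 <= b1 <= dec 74 82 4 73 + 2 / 100 / 100 / 100 / 100 &
  dec 89 76 9 21 <= b2 <= dec 89 76 9 21 + 2 / 100 / 100 / 100 / 100].
Proof.
have [ia ib1 ib2 _] := @inb_c R; have [d1 d2 d3] := dec8_check.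
by split; [exact: dec8P ia d1|exact: dec8P ib1 d2|exact: dec8P ib2 d3].
Qed.

Lemma rp2_12 : rp2 12 = 64 * 64.
Proof. by rewrite -rp2E (_ : pow2 12 = Z.of_nat 64 * Z.of_nat 64)%ZZ// ZRM !ZR_nat. Qed.

Lemma pt_base (i : Z) (u v : nat) : i = (Z.of_nat 100 * Z.of_nat u + Z.of_nat v)%ZZ ->
  pt i = (100 * u%:R + v%:R) / (64 * 64).
Proof. by move=> ->; rewrite ZRD ZRM !ZR_nat rp2_12. Qed.

(** Triangle inequality: the radius [40 / 2^12] plus a shift of at most 0.000132 stays below
    [rad]. *)
Lemma disc_shift (u w u' w' c1 c2 d1 d2 : R) : disc u w c1 c2 ->
  - d1 <= u - u' <= d1 -> - d2 <= w - w' <= d2 ->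
  d1 ^+ 2 + d2 ^+ 2 <= (13 / 100 / 100 / 100 * 10 + 2 / 100 / 100 / 100) ^+ 2 ->
  (c1 - u') ^+ 2 + (c2 - w') ^+ 2 <= rad ^+ 2.
Proof.
rewrite /disc rp2_12 => h1 h2 h3 h4.
have k2 := sqr_le_sym h2; have k3 := sqr_le_sym h3.
have r0 : 0 <= 40 / (64 * 64) :> R by lra.
have m0 : 0 <= 13 / 100 / 100 / 100 * 10 + 2 / 100 / 100 / 100 :> R by lra.
have h5 := le_trans (lerD k2 k3) h4.
have /andP[_ h6] := lin_le h1 h5 r0 m0.
have -> : (c1 - u') ^+ 2 + (c2 - w') ^+ 2 = ((c1 - u) ^+ 2 + (c2 - w) ^+ 2) +
  2 * ((c1 - u) * (u - u') + (c2 - w) * (w - w')) + ((u - u') ^+ 2 + (w - w') ^+ 2) by ring.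
move: ((c1 - u) ^+ 2 + (c2 - w) ^+ 2) ((c1 - u) * (u - u') + (c2 - w) * (w - w'))
  ((u - u') ^+ 2 + (w - w') ^+ 2) h1 h5 h6 {k2 k3 h2 h3 h4 r0 m0} => X Y Z h1 h5 h6.
rewrite /rad; lra.
Qed.

Lemma near_contactP (c1 c2 : R) : near_contact c1 c2 ->
  (c1 - a1) ^+ 2 + c2 ^+ 2 <= rad ^+ 2 \/ (c1 - b1) ^+ 2 + (c2 - b2) ^+ 2 <= rad ^+ 2.
Proof.
have [/andP[la ua] /andP[lb ub] /andP[lc uc]] := contact_bounds.
rewrite /dec in la ua lb ub lc uc.
case=> h; [left|right].
- rewrite -[c2 in leLHS]subr0.
  apply: (disc_shift (d1 := 11 / 100 / 100 / 100 * 10) (d2 := 0) h).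
  + by rewrite (@pt_base 7363 73 63)//; clear lb ub lc uc h; apply/andP; split; lra.
  + by rewrite ZR0 mul0r subr0 oppr0 lexx.
  + by clear la ua lb ub lc uc h; lra.
- apply: (disc_shift (d1 := 87 / 100 / 100 / 100) (d2 := 97 / 100 / 100 / 100) h).
  + by rewrite (@pt_base 3065 30 65)//; clear la ua lc uc h; apply/andP; split; lra.
  + by rewrite (@pt_base 3677 36 77)//; clear la ua lb ub h; apply/andP; split; lra.
  + by clear la ua lb ub lc uc h; lra.
Qed.

Definition contact (c1 c2 : R) : Prop :=
  (`|c1| = a1 /\ c2 = 0) \/ (`|c1| = b1 /\ `|c2| = b2).

Lemma Lam_sign c1 c2 : Lam `|c1| `|c2| = Lam c1 c2.
Proof. by rewrite /Lam LamE_sign !real_normK ?num_real. Qed.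

Lemma Lam_lt_K (c1 c2 : R) : `|c1| <= 2 -> `|c2| <= 1 -> ~ contact c1 c2 -> Lam c1 c2 < Kval.
Proof.
move=> h1 h2 nc; rewrite -Lam_sign.
have h1' : 0 <= `|c1| <= 2 by rewrite normr_ge0.
have h2' : 0 <= `|c2| <= 1 by rewrite normr_ge0.
have [/near_contactP[] h|//] := far_from_contacts h1' h2'.
- have := Lam_A h; rewrite [a1 + _]addrC subrK => /le_lt_trans; apply.
  rewrite ltrBlDr ltrDl mulr_gt0// lt_neqAle addr_ge0 ?sqr_ge0// andbT eq_sym.
  rewrite paddr_eq0 ?sqr_ge0// !sqrf_eq0 subr_eq0 normr_eq0.
  by apply/negP => /andP[/eqP e1 /eqP e2]; apply: nc; left.
- have E (a b : R) : a + (b - a) = b by rewrite addrC subrK.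
  have := Lam_B h; rewrite (E b1) (E b2) => /le_lt_trans; apply.
  have k : 0 < 1 / 1000 :> R by rewrite divr_gt0 ?ltr0n.
  rewrite ltrBlDr ltrDl (pmulr_rgt0 _ k) lt_neqAle addr_ge0 ?sqr_ge0// andbT eq_sym.
  rewrite paddr_eq0 ?sqr_ge0// !sqrf_eq0 !subr_eq0.
  by apply/negP => /andP[/eqP e1 /eqP e2]; apply: nc; right.
Qed.

Lemma Lam_le_K (c1 c2 : R) : `|c1| <= 2 -> `|c2| <= 1 -> Lam c1 c2 <= Kval.
Proof.
move=> h1 h2; have [[]|nc] := pselect (contact c1 c2); last exact/ltW/Lam_lt_K.
- move=> [e1 ->]; rewrite -Lam_sign normr0 e1.
  have := @Lam_A R 0 0; rewrite !expr0n addr0 mulr0 subr0 addr0; apply.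
  exact: sqr_ge0.
- move=> [e1 e2]; rewrite -Lam_sign e1 e2.
  have := @Lam_B R 0 0; rewrite !expr0n addr0 mulr0 subr0 !addr0; apply.
  exact: sqr_ge0.
Qed.

End Lam_bound.

(** * Integration against the law of the angle *)

Section angle_integral.
Context {R : realType}.
Local Notation mu := (@lebesgue_measure R).
Local Notation s := (@ellipse_speed R).
Local Notation D := (`[0, 2 * pi]%classic : set R).
Local Notation A := (@ellipse_length R).
Local Notation rho := (fun t : R => s t / A).

Lemma rho_ge0 t : 0 <= rho t.
Proof. by rewrite divr_ge0// ?sqrtr_ge0// ltW// ellipse_length_gt0. Qed.

Lemma measurable_rho : measurable_fun setT rho.
Proof. by apply: measurable_funM => //; exact: measurable_ellipse_speed. Qed.

Let measurable_rho_EFin (E : set R) : measurable_fun E (EFin \o rho).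
Proof. by apply: measurable_funTS; apply/measurable_EFinP; exact: measurable_rho. Qed.

Let integral_angle_indic (E : set R) : measurable E ->
  (\int[ellipse_angle_prob]_x (\1_E x)%:E = \int[mu]_(x in D) ((\1_E x)%:E * (rho x)%:E))%E.
Proof.
move=> mE; rewrite integral_indic//= setIT /ellipse_angle_prob setIC.
by rewrite integral_mkcondr; apply: eq_integral => x _; rewrite epatch_indic muleC.
Qed.

Import HBNNSimple.

Let measurable_fiber (f : {nnsfun R >-> R}) r : measurable_fun [set: R] (\1_(f @^-1` [set r]) : R -> R).
Proof.
have m1 : measurable (f @^-1` [set r]) by apply: measurable_funPTI; exact: measurable_set1.
exact: measurable_indic m1.
Qed.

Let integral_angle_nnsfun (f : {nnsfun R >-> R}) :
  (\int[ellipse_angle_prob]_x (f x)%:E = \int[mu]_(x in D) ((f x)%:E * (rho x)%:E))%E.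
Proof.
under [LHS]eq_integral do rewrite fimfunE -fsumEFin//.
rewrite [LHS]ge0_integral_fsum//; last 2 first.
  - by move=> r; exact/measurable_EFinP/measurableT_comp.
  - by move=> n x _; rewrite EFinM nnfun_muleindic_ge0.
under [RHS]eq_integral.
  move=> x xD; rewrite fimfunE -fsumEFin// ge0_mule_fsuml; last first.
    by move=> r; rewrite EFinM nnfun_muleindic_ge0.
  over.
rewrite [RHS]ge0_integral_fsum//; last 2 first.
  - move=> r; apply: emeasurable_funM.
      apply: measurable_funTS; apply/measurable_EFinP; apply: measurable_funM => //.
      exact: measurable_fiber.
    exact: measurable_rho_EFin.
  - move=> n x _; rewrite -EFinM lee_fin; apply: mulr_ge0; last exact: rho_ge0.
    by rewrite -lee_fin EFinM nnfun_muleindic_ge0.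
apply: eq_fsbigr => r _.
under eq_integral do rewrite EFinM.
under [RHS]eq_integral do rewrite EFinM -muleA.
have [r0|r0] := leP 0 r.
  rewrite ge0_integralZl//; last by apply/measurable_EFinP; exact: measurable_fiber.
  rewrite [RHS]ge0_integralZl//; last 2 first.
  - apply: emeasurable_funM; last exact: measurable_rho_EFin.
    apply: measurable_funTS; apply/measurable_EFinP.
    exact: measurable_fiber.
  - by move=> x _; rewrite -EFinM lee_fin mulr_ge0 ?rho_ge0.
  by rewrite integral_angle_indic.
have -> : f @^-1` [set r] = set0 by exact: preimage_nnfun0.
by rewrite !integral0_eq// => x _; rewrite indic0 ?mul0e ?mule0.
Qed.

(** The rule for a measure with density, obtained from indicators through simple functions by
    monotone convergence. *)
Lemma integral_angle (f : R -> \bar R) : measurable_fun setT f -> (forall x, 0 <= f x)%E ->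
  (\int[ellipse_angle_prob]_x f x = \int[mu]_(x in D) (f x * (rho x)%:E))%E.
Proof.
move=> mf f0.
pose f_ := nnsfun_approx measurableT mf.
transitivity (lim (\int[ellipse_angle_prob]_x (f_ n x)%:E @[n --> \oo])%E).
  rewrite -monotone_convergence//=.
  - apply: eq_integral => ? /[!inE] xD; apply/esym/cvg_lim => //=.
    exact: cvg_nnsfun_approx.
  - by move=> n; exact/measurable_EFinP/measurable_funTS.
  - by move=> n ? _; rewrite lee_fin.
  - by move=> ? _ ? ? mn; rewrite lee_fin; exact/lefP/nd_nnsfun_approx.
rewrite [RHS](_ : _ = lim (\int[mu]_(x in D) ((f_ n x)%:E * (rho x)%:E) @[n --> \oo])%E); last first.
  rewrite -monotone_convergence//=.
  - apply: eq_integral => x /[!inE] xD; apply/esym/cvg_lim => //.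
    by apply: cvgeZr => //; exact: cvg_nnsfun_approx.
  - move=> n; apply: emeasurable_funM; last exact: measurable_rho_EFin.
    by apply: measurable_funTS; apply/measurable_EFinP; exact: (@measurable_funPT _ _ _ _ (f_ n)).
  - by move=> n x _; rewrite -EFinM lee_fin mulr_ge0 ?rho_ge0.
  - move=> x _ m n mn; apply: lee_wpmul2r; first by rewrite lee_fin rho_ge0.
    by rewrite lee_fin; have /lefP := nd_nnsfun_approx measurableT mf mn; apply.
by apply: congr_lim; apply/funext => n /=; exact: integral_angle_nnsfun.
Qed.
End angle_integral.

(** * Distortion of finite sets and the dual lower bound *)

Section quantizers.
Context {R : realType}.
Implicit Types (t : R) (a c x : R * R) (l : seq (R * R)).
Local Notation q := (pi / 2 : R).
Local Notation s := (@ellipse_speed R).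
Local Notation A := (@ellipse_length R).
Local Notation curve := (@ellipse_curve R).

Fixpoint min_sqdist a l x : R :=
  if l is c :: l' then Num.min (sqdist x c) (min_sqdist a l' x) else sqdist x a.

Lemma min_sqdist_le a l x c : c \in a :: l -> min_sqdist a l x <= sqdist x c.
Proof.
elim: l c => [|d l IH] c /=; first by rewrite inE => /eqP ->.
rewrite !inE => /or3P[/eqP ->|/eqP ->|cl]; rewrite ge_min.
- by rewrite IH ?inE ?eqxx// orbT.
- by rewrite lexx.
- by rewrite IH ?inE ?cl ?orbT.
Qed.

Lemma min_sqdist_in a l x : exists2 c, c \in a :: l & min_sqdist a l x = sqdist x c.
Proof.
elim: l => [|d l [c cl cE]] /=; first by exists a; rewrite ?inE.
case: leP => _; first by exists d; rewrite ?inE ?eqxx ?orbT.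
exists c => //; move: cl; rewrite !inE => /orP[->//|->]; by rewrite !orbT.
Qed.

Lemma ereal_inf_sqdist a l x :
  ereal_inf [set (sqdist x c)%:E | c in [set` a :: l]] = (min_sqdist a l x)%:E.
Proof.
apply/le_anti/andP; split.
  have [c cl ->] := min_sqdist_in a l x.
  by apply: ereal_inf_lbound; exists c.
apply/ereal_infP => _ [c cl <-]; rewrite lee_fin; exact: min_sqdist_le.
Qed.

Lemma sqdist_ge0 x c : 0 <= sqdist x c.
Proof. by rewrite /sqdist addr_ge0 ?sqr_ge0. Qed.
Lemma min_sqdist_ge0 a l x : 0 <= min_sqdist a l x.
Proof. by have [c _ ->] := min_sqdist_in a l x; exact: sqdist_ge0. Qed.

Lemma measurable_min_sqdist a l : measurable_fun setT (min_sqdist a l).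
Proof.
have ms c : measurable_fun setT (fun x : R * R => sqdist x c).
  apply: measurable_funD; apply: measurable_funX; apply: measurable_funB => //.
elim: l => [|c l IH]; first exact: ms.
exact: measurable_minr (ms c) IH.
Qed.

Definition dcurve c t : R := sqdist (curve t) c.
Definition mind a l t : R := min_sqdist a l (curve t).

(** Reduces continuity of the minimum to that of [posp], and splits the penalty of a list point by
    point. *)
Lemma minr_posp (u v : R) : Num.min u v = u - posp (u - v).
Proof.
case: leP => h; first by rewrite posp_neg ?subr_le0// subr0.
by rewrite posp_pos ?subr_ge0 ?(ltW h)//; ring.
Qed.

Lemma continuous_dcurve c : continuous (dcurve c).
Proof.
have cp (f : R -> R) : continuous f -> continuous (fun t => f t ^+ 2).
  by move=> cf; apply: (@continuous_M R) => //; exact: cf.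
have E : dcurve c = fun t => (2 * cos t - c.1) ^+ 2 + (sin t - c.2) ^+ 2 by [].
rewrite E; apply: continuous_D; apply: cp; apply: continuous_B; try exact: continuous_k.
- by apply: continuous_M; [exact: continuous_k|exact: continuous_cos].
- exact: continuous_sin.
Qed.

Lemma continuous_mind a l : continuous (mind a l).
Proof.
elim: l => [|c l IH]; first exact: continuous_dcurve.
have E : mind a (c :: l) = fun t => dcurve c t - posp (dcurve c t - mind a l t).
  by apply/funext => t; rewrite -minr_posp.
rewrite E; apply: continuous_B; first exact: continuous_dcurve.
by apply: continuous_posp; apply: continuous_B => //; exact: continuous_dcurve.
Qed.

Lemma distortionE a l : distortion (ellipse_uniform R) [set` a :: l] =
  (itg (fun t => mind a l t * s t) 0 (2 * pi) / A)%:E.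
Proof.
rewrite /distortion; under eq_integral do rewrite ereal_inf_sqdist.
rewrite ge0_integral_distribution; last 2 first.
- by apply/measurable_EFinP; exact: measurable_min_sqdist.
- by move=> x; rewrite lee_fin min_sqdist_ge0.
rewrite integral_angle; last 2 first.
- apply/measurable_EFinP; apply: continuous_measurable_fun; exact: continuous_mind.
- by move=> x; rewrite lee_fin min_sqdist_ge0.
have cm : continuous (fun t => mind a l t * s t).
  by apply: continuous_M; [exact: continuous_mind|exact: continuous_ellipse_speed].
have cA : continuous (fun t => A^-1 * (mind a l t * s t)).
  by apply: continuous_M => //; exact: continuous_k.
rewrite [itg _ _ _ / A]mulrC -(itgZ _ _ _ cm) -(EFin_itg _ _ cA); apply: eq_integral => t _.
by rewrite -EFinM /mind/=; congr EFin; ring.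
Qed.

Lemma itg_fold (f : R -> R) : continuous f ->
  itg f 0 (2 * pi) = itg (fun t => (f t + f (pi - t)) + (f (2 * pi - t) + f (pi + t))) 0 q.
Proof.
move=> cf; have p0 := @pi_gt0 R.
have cr (g : R -> R) (c : R) : continuous g -> continuous (fun t => g (c - t)).
  move=> cg u; apply: (@continuous_comp _ _ _ (fun u => c - u) g); last exact: cg.
  by apply: cvgB; [exact: cvg_cst|exact: cvg_id].
have ca (c : R) : continuous (fun t => f (c + t)).
  move=> u; apply: (@continuous_comp _ _ _ (fun u => c + u) f); last exact: cf.
  by apply: cvgD; [exact: cvg_cst|exact: cvg_id].
have H (g : R -> R) : continuous g -> itg g 0 pi = itg (fun t => g t + g (pi - t)) 0 q.
  move=> cg; rewrite itgD//; last exact: cr.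
  rewrite (@itg_chasles R g 0 q pi)//; [|lra|lra]; congr (_ + _).
  have q0 : 0 <= q by lra.
  by rewrite -(itg_reflect pi cg q0) subr0; congr itg; field.
rewrite (@itg_chasles R f 0 pi (2 * pi))//; [|lra|lra].
have -> : itg f pi (2 * pi) = itg (fun t => f (2 * pi - t)) 0 pi.
  by rewrite -(itg_reflect (2 * pi) cf (ltW p0)) subr0; congr itg; ring.
rewrite (H f)// (H (fun t => f (2 * pi - t))); last exact: cr.
rewrite -itgD.
- apply: eq_itg => t _; congr (_ + (_ + f _)); ring.
- exact: (continuous_D cf (cr f pi cf)).
- have c2 := cr f (2 * pi) cf.
  exact: (continuous_D c2 (cr (fun t => f (2 * pi - t)) pi c2)).
Qed.

Lemma trig_fold t : [/\ cos (pi - t) = - cos t, sin (pi - t) = sin t,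
  cos (2 * pi - t) = cos t, sin (2 * pi - t) = - sin t &
  cos (pi + t) = - cos t /\ sin (pi + t) = - sin t].
Proof.
have c2 : cos (2 * pi) = 1 :> R by rewrite mulrC mulr_natr cos2pi.
have s2 : sin (2 * pi) = 0 :> R by rewrite mulrC mulr_natr sin2pi.
rewrite !cosB !sinB cosD sinD cospi sinpi c2 s2.
by split; try ring; split; ring.
Qed.

Lemma even_fold t : [/\ s (pi - t) = s t, s (2 * pi - t) = s t, s (pi + t) = s t &
  [/\ zc (pi - t) = zc t, zc (2 * pi - t) = zc t & zc (pi + t) = zc t]].
Proof.
have [c1 s1 c2 s2 [c3 s3]] := trig_fold t.
by rewrite /ellipse_speed !zc_cos c1 s1 c2 s2 c3 s3 !sqrrN.
Qed.

Definition vfun t : R := wfun t + 5 / 2 + 3 / 2 * zc t.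

Lemma continuous_vfun : continuous vfun.
Proof.
apply: continuous_D; first apply: continuous_D; first exact: continuous_wpoly.
- exact: continuous_k.
- by apply: continuous_M; [exact: continuous_k|exact: continuous_zc].
Qed.

Lemma vfun_dcurve c t : vfun t - dcurve c t = gfun c.1 c.2 (c.1 ^+ 2 + c.2 ^+ 2) t.
Proof. by rewrite gfun_dist. Qed.

Lemma vfun_fold t : [/\ vfun (pi - t) = vfun t, vfun (2 * pi - t) = vfun t & vfun (pi + t) = vfun t].
Proof. by have [_ _ _ [z1 z2 z3]] := even_fold t; rewrite /vfun /wfun /wpoly z1 z2 z3. Qed.

Lemma LamP c : itg (fun t => posp (vfun t - dcurve c t) * s t) 0 (2 * pi) = Lam c.1 c.2.
Proof.
have E : (fun t => posp (vfun t - dcurve c t) * s t) = gpos c.1 c.2 (c.1 ^+ 2 + c.2 ^+ 2).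
  by apply/funext => t; rewrite vfun_dcurve.
have cg := @continuous_gpos R; rewrite E itg_fold// /Lam /LamE /pint.
rewrite -!itgD; do ?[exact: cg|apply: continuous_D].
apply: eq_itg => t _.
have [c1 s1 c2 s2 [c3 s3]] := trig_fold t; have [p1 p2 p3 [z1 z2 z3]] := even_fold t.
have G (d1 d2 : R) u : s u = s t -> zc u = zc t -> cos u = d1 * cos t -> sin u = d2 * sin t ->
  gpos c.1 c.2 (c.1 ^+ 2 + c.2 ^+ 2) u = gpos (d1 * c.1) (d2 * c.2) (c.1 ^+ 2 + c.2 ^+ 2) t.
  move=> su zu cu du; rewrite /gpos su; congr (posp _ * _).
  by rewrite !gfunE zu cu du; ring.
rewrite (G (-1) 1 (pi - t)) ?mulN1r ?mul1r// (G 1 (-1) (2 * pi - t)) ?mulN1r ?mul1r//.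
rewrite (G (-1) (-1) (pi + t)) ?mulN1r//; ring.
Qed.

Definition W : R := itg (fun t => vfun t * s t) 0 (2 * pi).
Definition penalty a l : R := itg (fun t => posp (vfun t - mind a l t) * s t) 0 (2 * pi).

Lemma continuous_penalty (f : R -> R) : continuous f ->
  continuous (fun t => posp (vfun t - f t) * s t).
Proof.
move=> cf; apply: continuous_M; last exact: continuous_ellipse_speed.
by apply: continuous_posp; apply: continuous_B => //; exact: continuous_vfun.
Qed.

(** Pointwise, the positive part of [v - min] is attained at one of the points, hence at most the
    sum of the positive parts for all points. *)
Lemma penalty_le a l : penalty a l <= \sum_(c <- a :: l) Lam c.1 c.2.
Proof.
elim: l => [|c l IH]; first by rewrite big_seq1 -LamP.
have -> : \sum_(d <- [:: a, c & l]) Lam d.1 d.2 = Lam c.1 c.2 + \sum_(d <- a :: l) Lam d.1 d.2.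
  by rewrite !big_cons addrCA.
apply: le_trans (lerD (lexx _) IH); rewrite -LamP /penalty -itgD; last 2 first.
- by apply: continuous_penalty; exact: continuous_dcurve.
- by apply: continuous_penalty; exact: continuous_mind.
apply: le_itg.
- by apply: continuous_penalty; exact: (continuous_mind (l := c :: l)).
- apply: continuous_D; apply: continuous_penalty; [exact: continuous_dcurve|exact: continuous_mind].
- move=> t _; rewrite -mulrDl ler_wpM2r ?speed_ge0// /mind /= -/(dcurve c t) -/(mind a l t).
  have a0 := posp_ge0 (vfun t - dcurve c t); have b0 := posp_ge0 (vfun t - mind a l t).
  rewrite minr_posp; have [h|/ltW h] := leP (dcurve c t - mind a l t) 0.
    by rewrite (posp_neg h) subr0 lerDl.
  by rewrite (posp_pos h) [dcurve c t - (_ - _)]subKr lerDr.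
Qed.

Lemma itg_mind_ge a l : W - \sum_(c <- a :: l) Lam c.1 c.2 <= itg (fun t => mind a l t * s t) 0 (2 * pi).
Proof.
apply: le_trans (lerB (lexx W) (penalty_le a l)) _.
have cv : continuous (fun t => vfun t * s t).
  by apply: continuous_M; [exact: continuous_vfun|exact: continuous_ellipse_speed].
have cp : continuous (fun t => posp (vfun t - mind a l t) * s t).
  by apply: continuous_penalty; exact: continuous_mind.
rewrite /W /penalty -itgB//; apply: le_itg.
- exact: continuous_B.
- by apply: continuous_M; [exact: continuous_mind|exact: continuous_ellipse_speed].
- move=> t _; rewrite -mulrBl ler_wpM2r ?speed_ge0//.
  by have := posp_ge (vfun t - mind a l t); lra.
Qed.

(** [clamp] is the projection to the rectangle [[-2, 2] x [-1, 1]] around the ellipse, on which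
    [Lam] is bounded; it brings a point closer to every point of the curve. *)
Definition clamp1 (B u : R) : R := Num.max (- B) (Num.min B u).
Definition clamp c : R * R := (clamp1 2 c.1, clamp1 1 c.2).

Lemma clamp1P (B u : R) : 0 <= B -> [/\ `|clamp1 B u| <= B,
  (`|clamp1 B u| < B -> clamp1 B u = u) & forall v, `|v| <= B -> (v - clamp1 B u) ^+ 2 <= (v - u) ^+ 2].
Proof.
move=> B0; rewrite /clamp1.
have [h|h] := leP B u.
  rewrite max_r; last lra.
  rewrite (ger0_norm B0); split=> //; first by rewrite ltxx.
  move=> v; rewrite ler_norml => /andP[v1 v2].
  have : 0 <= (u - B) * ((B - v) + (u - v)) by rewrite mulr_ge0//; lra.
  lra.
have [h'|h'] := leP (- B) u.
  by split=> //; rewrite ler_norml h' ltW.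
rewrite normrN (ger0_norm B0); split=> //; first by rewrite ltxx.
move=> v; rewrite ler_norml => /andP[v1 v2].
have : 0 <= (- B - u) * ((v + B) + (v - u)) by rewrite mulr_ge0//; lra.
lra.
Qed.

Lemma dcurve_clamp c t : dcurve (clamp c) t <= dcurve c t.
Proof.
have [_ _ h1] := clamp1P c.1 (ler0n R 2); have [_ _ h2] := clamp1P c.2 ler01.
apply: lerD; [apply: h1|apply: h2] => /=.
- rewrite normrM ger0_norm// -[leRHS]mulr1 ler_pM2l//.
  by rewrite ler_norml cos_geN1 cos_le1.
- by rewrite ler_norml sin_geN1 sin_le1.
Qed.

Lemma mind_clamp a l t : mind (clamp a) (map clamp l) t <= mind a l t.
Proof.
have [c cl] := min_sqdist_in a l (curve t); rewrite /mind => ->.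
by apply: le_trans (dcurve_clamp c t); apply: min_sqdist_le; exact: (map_f clamp cl).
Qed.

(** The contact points lie in the open rectangle, whereas a coordinate that is moved lands on its
    boundary. *)
Lemma contact_clamp c : contact (clamp c).1 (clamp c).2 -> clamp c = c.
Proof.
have [_ ua _ ub [_ uc _ _ _]] := @numbersP R.
have a2 : (a1 : R) < 2 by lra.
have b2' : (b1 : R) < 2 by lra.
have b3 : (b2 : R) < 1 by lra.
have [_ h1 _] := clamp1P c.1 (ler0n R 2); have [_ h2 _] := clamp1P c.2 ler01.
suff : `|(clamp c).1| < 2 -> `|(clamp c).2| < 1 -> clamp c = c.
  by move=> K [[e1 e2]|[e1 e2]]; apply: K; rewrite ?e1 ?e2 ?normr0.
by move=> /h1 k1 /h2 k2; rewrite /clamp k1 k2; case: (c).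
Qed.

Lemma Lam_clamp_le c : Lam (clamp c).1 (clamp c).2 <= Kval.
Proof.
have [h1 _ _] := clamp1P c.1 (ler0n R 2); have [h2 _ _] := clamp1P c.2 ler01.
exact: Lam_le_K.
Qed.

Lemma Lam_clamp_lt c : ~ contact c.1 c.2 -> Lam (clamp c).1 (clamp c).2 < Kval.
Proof.
have [h1 _ _] := clamp1P c.1 (ler0n R 2); have [h2 _ _] := clamp1P c.2 ler01 => nc.
apply: Lam_lt_K => // cc; apply: nc; by rewrite -(contact_clamp cc).
Qed.

Lemma itg_mind_clamp a l : W - \sum_(c <- a :: l) Lam (clamp c).1 (clamp c).2 <=
  itg (fun t => mind a l t * s t) 0 (2 * pi).
Proof.
have := itg_mind_ge (clamp a) (map clamp l); rewrite -(map_cons clamp) big_map => /le_trans; apply.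
apply: le_itg.
- by apply: continuous_M; [exact: continuous_mind|exact: continuous_ellipse_speed].
- by apply: continuous_M; [exact: continuous_mind|exact: continuous_ellipse_speed].
- by move=> t _; rewrite ler_wpM2r ?speed_ge0// mind_clamp.
Qed.

End quantizers.

(** This encloses [(W - 6 * Kval) / A], numerator and denominator being divided by 4 to refer to one
    quarter of the ellipse. *)
Definition b_V : zball := Eval vm_compute in
  bdiv (bsub (comb4 (badd b_w0 (bhalf (bint 5))) (badd b_w1 (bhalf (bint 3))) b_w2 (bcst kz)
    M0q M1q M2q M3q) (bhalf (bscale 3 b_K))) M0q.
Lemma b_V_check : [/\ b_V =
  bdiv (bsub (comb4 (badd b_w0 (bhalf (bint 5))) (badd b_w1 (bhalf (bint 3))) b_w2 (bcst kz)
    M0q M1q M2q M3q) (bhalf (bscale 3 b_K))) M0q, positive M0q & dec8 b_V 19 87 93 5 90].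
Proof. by vm_compute. Qed.

(** * The optimal set of six-means and its error *)

Section six_means.
Context {R : realType}.
Implicit Types (t : R) (a c x : R * R) (l : seq (R * R)).
Local Notation q := (pi / 2 : R).
Local Notation s := (@ellipse_speed R).
Local Notation A := (@ellipse_length R).
Local Notation t0 := (@tcut R).
Local Notation p1 := ((a1, 0) : R * R).
Local Notation p2 := ((b1, b2) : R * R).
Local Notation p3 := ((- b1, b2) : R * R).
Local Notation p4 := ((- a1, 0) : R * R).
Local Notation p5 := ((- b1, - b2) : R * R).
Local Notation p6 := ((b1, - b2) : R * R).

Definition contacts : seq (R * R) := [:: p2; p3; p4; p5; p6].

(** The upper bound assigns the four mirror images of a curve point to the mirror images of one
    contact point. *)
Lemma mind_le4 (c c' c'' c3 : R * R) t :
  c \in p1 :: contacts -> c' \in p1 :: contacts -> c'' \in p1 :: contacts -> c3 \in p1 :: contacts ->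
  dcurve c' (pi - t) = dcurve c t -> dcurve c'' (2 * pi - t) = dcurve c t ->
  dcurve c3 (pi + t) = dcurve c t ->
  (mind p1 contacts t * s t + mind p1 contacts (pi - t) * s (pi - t)) +
  (mind p1 contacts (2 * pi - t) * s (2 * pi - t) + mind p1 contacts (pi + t) * s (pi + t))
  <= 4 * (dcurve c t * s t).
Proof.
move=> h h' h'' h3 e' e'' e3; have [s1 s2 s3 _] := even_fold t; rewrite s1 s2 s3.
have m d v : d \in p1 :: contacts -> mind p1 contacts v * s t <= dcurve d v * s t.
  by move=> hd; rewrite ler_wpM2r ?speed_ge0//; exact: min_sqdist_le.
have := m _ t h; have := m _ (pi - t) h'; have := m _ (2 * pi - t) h''; have := m _ (pi + t) h3.
rewrite e' e'' e3; move: (mind _ _ _ * _) (mind _ _ _ * _) (mind _ _ _ * _) (mind _ _ _ * _) (dcurve _ _ * _).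
by clear => *; lra.
Qed.

Lemma dcurve_fold (u v : R) t : [/\ dcurve (- u, v) (pi - t) = dcurve (u, v) t,
  dcurve (u, - v) (2 * pi - t) = dcurve (u, v) t & dcurve (- u, - v) (pi + t) = dcurve (u, v) t].
Proof.
have [c1 s1 c2 s2 [c3 s3]] := trig_fold t.
rewrite /dcurve /sqdist /ellipse_curve; cbn [fst snd].
by rewrite c1 s1 c2 s2 c3 s3; split; ring.
Qed.

Lemma itg_vd (c : R * R) u v : 0 <= u -> u <= v ->
  itg (fun t => 4 * (dcurve c t * s t)) u v = 4 * (itg (fun t => vfun t * s t) u v -
  (prim_g c.1 c.2 (c.1 ^+ 2 + c.2 ^+ 2) v - prim_g c.1 c.2 (c.1 ^+ 2 + c.2 ^+ 2) u)).
Proof.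
move=> u0 uv; have cs := @continuous_ellipse_speed R.
have cd : continuous (fun t => dcurve c t * s t).
  by apply: continuous_M => //; exact: continuous_dcurve.
have cv : continuous (fun t => vfun t * s t).
  by apply: continuous_M => //; exact: continuous_vfun.
have cg : continuous (fun t => gfun c.1 c.2 (c.1 ^+ 2 + c.2 ^+ 2) t * s t).
  by apply: continuous_M => //; exact: continuous_gfun.
rewrite (itgZ _ _ _ cd) -(itg_gpoly w0 w1 w2 kk c.1 c.2 _ u0 uv) -(itgB _ _ cv cg).
by congr (_ * _); apply: eq_itg => t _; rewrite -vfun_dcurve; ring.
Qed.

Lemma W_fold : W = 4 * itg (fun t => vfun t * s t) 0 q.
Proof.
have cv : continuous (fun t : R => vfun t * s t).
  by apply: continuous_M; [exact: continuous_vfun|exact: continuous_ellipse_speed].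
rewrite /W (itg_fold cv) -(itgZ _ _ _ cv); apply: eq_itg => t _.
by have [s1 s2 s3 _] := even_fold t; have [v1 v2 v3] := vfun_fold t; rewrite s1 s2 s3 v1 v2 v3; ring.
Qed.

Lemma itg_contacts_le : itg (fun t => mind p1 contacts t * s t) 0 (2 * pi) <= W - 6 * Kval.
Proof.
have cm : continuous (fun t => mind p1 contacts t * s t).
  by apply: continuous_M; [exact: continuous_mind|exact: continuous_ellipse_speed].
have cr (c : R) : continuous (fun t : R => mind p1 contacts (c - t) * s (c - t)).
  move=> u; apply: (@continuous_comp _ _ _ (fun u => c - u) (fun t => mind p1 contacts t * s t)); last exact: cm.
  by apply: cvgB; [exact: cvg_cst|exact: cvg_id].
have ca (c : R) : continuous (fun t : R => mind p1 contacts (c + t) * s (c + t)).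
  move=> u; apply: (@continuous_comp _ _ _ (fun u => c + u) (fun t => mind p1 contacts t * s t)); last exact: cm.
  by apply: cvgD; [exact: cvg_cst|exact: cvg_id].
have cF := continuous_D (continuous_D cm (cr pi)) (continuous_D (cr (2 * pi)) (ca pi)).
have c4 (c : R * R) : continuous (fun t : R => 4 * (dcurve c t * s t)).
  apply: continuous_M; first exact: continuous_k.
  by apply: continuous_M; [exact: continuous_dcurve|exact: continuous_ellipse_speed].
have cv : continuous (fun t : R => vfun t * s t).
  by apply: continuous_M; [exact: continuous_vfun|exact: continuous_ellipse_speed].
have /andP[/ltW t00 /ltW t0q] := @tcut_itv R.
rewrite (itg_fold cm) (itg_chasles cF t00 t0q).
have N0 : - (0 : R) = 0 by rewrite oppr0.
have M k : (k < 6)%N -> nth p1 (p1 :: contacts) k \in p1 :: contacts by move=> k6; apply: mem_nth.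
apply: le_trans (_ : itg (fun t => 4 * (dcurve p1 t * s t)) 0 t0 +
  itg (fun t => 4 * (dcurve p2 t * s t)) t0 q <= _).
  apply: lerD; apply: le_itg; do ?[exact: cF|exact: c4] => t _.
  - have [d1 d2 d3] := dcurve_fold a1 0 t; rewrite N0 in d2 d3.
    (* The indices are the positions in [p1 :: contacts] of the mirror images; the point on the
       major axis has only two distinct ones. *)
    exact: (@mind_le4 _ _ _ _ t (M 0%N isT) (M 3%N isT) (M 0%N isT) (M 3%N isT) d1 d2 d3).
  - have [d1 d2 d3] := dcurve_fold b1 b2 t.
    exact: (@mind_le4 _ _ _ _ t (M 1%N isT) (M 2%N isT) (M 5%N isT) (M 4%N isT) d1 d2 d3).
rewrite (itg_vd p1 (lexx 0) t00) (itg_vd p2 t00 t0q) W_fold (itg_chasles cv t00 t0q).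
cbn [fst snd]; rewrite cell_B expr0n addr0 cell_A.
have -> : prim_g a1 0 (a1 ^+ 2) 0 = 0 :> R by rewrite /prim_g -itg_gpoly0 itgxx.
by rewrite !subrr !mul0r !addr0; move: (itg _ 0 t0) (itg _ t0 q) => X Y; lra.
Qed.

Definition Vopt : R := (W - 6 * Kval) / A.

Lemma Vopt_bounds : dec 19 87 93 5 <= Vopt <= dec 19 87 93 5 + 90 / 100 / 100 / 100 / 100.
Proof.
have [E p d] := b_V_check; apply: (dec8P _ d).
have [i0 i1 i2 i3] := @inb_w R; have [_ iK] := @inb_be R.
have [m0 m1 m2 m3 _] := @inb_moments_q R.
have M0 : moment 0 q != 0 :> R by rewrite lt0r_neq0// moment0_gt0// q_gt0.
have AE : A = 4 * moment 0 q.
  have -> : A = itg s 0 (2 * pi) by [].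
  rewrite (itg_fold (@continuous_ellipse_speed R)) moment0E -(itgZ _ _ _ (@continuous_ellipse_speed R)).
  by apply: eq_itg => t _; have [s1 s2 s3 _] := even_fold t; rewrite s1 s2 s3; ring.
have WE : W = 4 * lin4 (w0 + 5 / 2) (w1 + 3 / 2) w2 kk (moment 0 q) (moment 1 q) (moment 2 q) (moment 3 q).
  have := itg_gpoly0 (w0 + 5 / 2) (w1 + 3 / 2) w2 kk 0 0 0 q.
  rewrite W_fold /prim_gpoly !(mulr0, mul0r) !addr0 subr0 => <-; congr (_ * _).
  by apply: eq_itg => t _; rewrite /vfun /wfun /gpoly /wpoly /lin4; ring.
have -> : Vopt = (lin4 (w0 + 5 / 2) (w1 + 3 / 2) w2 kk (moment 0 q) (moment 1 q) (moment 2 q) (moment 3 q)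
   - 3 * Kval / 2) / moment 0 q.
  by rewrite /Vopt WE AE; field.
have I5 : inb (bhalf (bint 5)) (5 / 2 : R) by apply: inb_half; exact: (inb_int5 5).
have I3 : inb (bhalf (bint 3)) (3 / 2 : R) by apply: inb_half; exact: (inb_int5 3).
rewrite E; apply: (inb_div _ m0 p); apply: inb_sub.
  apply: inb_lin4; [exact: inb_add i0 I5|exact: inb_add i1 I3|exact: i2|exact: i3|exact: m0|exact: m1|exact: m2|exact: m3].
by apply: inb_half; rewrite -[3](ZR_nat 3); exact: (inb_scale 3).
Qed.

(** Positivity makes fewer than six points strictly worse: their total saving is at most their
    number times [Kval]. It follows from [0 <= Lam 0 0 < Kval]. *)
Lemma Kval_gt0 : 0 < Kval :> R.
Proof.
have [la _ lb _ _] := @numbersP R.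
have h0 : ~ contact (0 : R) 0.
  by rewrite /contact normr0 => -[[e _]|[e _]]; move: la lb; rewrite -e; lra.
have := @Lam_lt_K R 0 0; rewrite normr0 ler0n ler01 => /(_ isT isT h0); apply: le_lt_trans.
by rewrite /Lam /LamE !addr_ge0 ?pint_ge0.
Qed.

Lemma contactP c : contact c.1 c.2 -> c \in p1 :: contacts.
Proof.
case: c => u v; rewrite /contact; cbn [fst snd].
have H (y b : R) : `|y| = b -> y = b \/ y = - b.
  move=> <-; have [y0|/ltW y0] := leP 0 y; first by left; rewrite ger0_norm.
  by right; rewrite ler0_norm// opprK.
rewrite !inE => -[[/H[->|->] ->]|[/H[->|->] /H[->|->]]]; by rewrite eqxx ?orbT.
Qed.

Lemma sum_le_size (f : R * R -> R) l K : (forall c, f c <= K) -> \sum_(c <- l) f c <= (size l)%:R * K.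
Proof.
move=> fK; elim: l => [|c l IH]; first by rewrite big_nil mul0r.
by rewrite big_cons /= -natr1 mulrDl mul1r addrC lerD.
Qed.

Lemma sum_lt_size (f : R * R -> R) l K d : (forall c, f c <= K) -> d \in l -> f d < K ->
  \sum_(c <- l) f c < (size l)%:R * K.
Proof.
move=> fK + fd; elim: l => [//|c l IH]; rewrite inE big_cons /= -natr1 mulrDl mul1r addrC.
case/predU1P => [<-|/IH h]; first by apply: ler_ltD => //; exact: sum_le_size.
exact: ltr_leD.
Qed.

Lemma distortion0 : distortion (ellipse_uniform R) set0 = +oo%E.
Proof.
rewrite /distortion; under eq_integral do rewrite image_set0 ereal_inf0.
apply: etrans (@integral_cst _ _ R (ellipse_uniform R) setT measurableT +oo%E) _.
rewrite -[RHS](@mule1 R); congr (_ * _)%E; exact: (probability_setT (ellipse_uniform R)).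
Qed.

Lemma distortion_ge (alpha : set (R * R)) : (alpha #<= `I_6)%card ->
  (Vopt%:E <= distortion (ellipse_uniform R) alpha)%E /\
  (distortion (ellipse_uniform R) alpha = Vopt%:E -> alpha = [set` p1 :: contacts]).
Proof.
move=> a6; have fin : finite_set alpha by apply/finite_set_leP; exists 6%N.
have [l0 [ul sl ->]] : exists l, [/\ uniq l, (size l <= 6)%N & alpha = [set` l]].
  exists (finmap.enum_fset (fset_set alpha)); split.
  - exact: finmap.fset_uniq.
  - exact: geq_card_fset_set a6.
  - by rewrite -[LHS](fset_setK fin).
case: l0 ul sl => [|a l] ul sl.
  have -> : [set` [::]] = set0 :> set (R * R) by apply/seteqP; split.
  by rewrite distortion0; split; [exact: leey|].
rewrite distortionE; have A0 := @ellipse_length_gt0 R; have K0 := Kval_gt0.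
have ge := itg_mind_clamp a l; have s6 : ((size (a :: l))%:R : R) <= 6 by rewrite ler_nat.
have fK c : Lam (clamp c).1 (clamp c).2 <= Kval by exact: Lam_clamp_le.
split.
  rewrite lee_fin /Vopt ler_pM2r ?invr_gt0//; apply: le_trans ge; rewrite lerD2l lerN2.
  by apply: le_trans (sum_le_size _ fK) _; rewrite ler_pM2r.
(* Equality forces the sum of the savings to reach [6 * Kval]: then no term is below [Kval], so all
   points are contacts, and there are six of them. *)
case=> /(mulIf (lt0r_neq0 (_ : 0 < A^-1))); rewrite invr_gt0 A0 => /(_ isT) E.
rewrite E lerD2l lerN2 in ge.
have allc c : c \in a :: l -> contact c.1 c.2.
  move=> cl; apply/not_notP => nc.
  have := sum_lt_size fK cl (Lam_clamp_lt nc); rewrite ltNge => /negP; apply.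
  by apply: le_trans ge; rewrite ler_pM2r.
have z6 : (6 <= size (a :: l))%N.
  have := le_trans ge (sum_le_size (a :: l) fK); by rewrite ler_pM2r// ler_nat.
have sub : {subset a :: l <= p1 :: contacts} by move=> c /allc; exact: contactP.
have [_ eq] := uniq_min_size ul sub z6.
by apply/seteqP; split=> c /=; rewrite eq.
Qed.

Lemma contacts_card : ([set` p1 :: contacts] #<= `I_6)%card.
Proof.
have -> : [set` p1 :: contacts] = [set nth p1 (p1 :: contacts) i | i in `I_6].
  apply/seteqP; split=> [c /= cl|_ [i /= i6 <-]]; last exact: mem_nth.
  by exists (index c (p1 :: contacts)); [rewrite index_mem|exact: nth_index].
exact: card_image_le.
Qed.

Lemma distortion_contacts : distortion (ellipse_uniform R) [set` p1 :: contacts] = Vopt%:E.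
Proof.
apply/le_anti/andP; split; last by have [] := distortion_ge contacts_card.
rewrite distortionE lee_fin /Vopt ler_pM2r ?invr_gt0 ?ellipse_length_gt0//.
exact: itg_contacts_le.
Qed.

Lemma quantization_error6 : quantization_error (ellipse_uniform R) 6 = Vopt%:E.
Proof.
apply/le_anti/andP; split.
  by apply: ereal_inf_lbound; exists [set` p1 :: contacts]; [exact: contacts_card|exact: distortion_contacts].
by apply/ereal_infP => _ [alpha a6 <-]; have [] := distortion_ge a6.
Qed.

Lemma optimal_means6 (alpha : set (R * R)) :
  optimal_means (ellipse_uniform R) 6 alpha <-> alpha = [set p1; p2; p3; p4; p5; p6].
Proof.
have -> : [set p1; p2; p3; p4; p5; p6] = [set` p1 :: contacts].
  apply/seteqP; split=> c /=; rewrite !inE.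
    by move=> [[[[[->|->]|->]|->]|->]|->]; rewrite eqxx ?orbT.
  by case/predU1P => [h|/predU1P[h|/predU1P[h|/predU1P[h|/predU1P[h|/eqP h]]]]]; tauto.
rewrite /optimal_means quantization_error6; split=> [[a6 dE]|->].
  by have [_] := distortion_ge a6; exact.
by split; [exact: contacts_card|exact: distortion_contacts].
Qed.

End six_means.

(** * From the enclosures to the stated decimals *)

Section decimals.
Context {R : realType}.

Lemma decimal4 (n d1 d2 d3 d4 : nat) : decimal n [:: d1; d2; d3; d4] =
  n%:R + d1%:R / 10 + d2%:R / 10 / 10 + d3%:R / 10 / 10 / 10 + d4%:R / 10 / 10 / 10 / 10 :> R.
Proof.
rewrite /decimal !big_ord_recr big_ord0 /= add0r expr1.
by move: n%:R d1%:R d2%:R d3%:R d4%:R => *; field.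
Qed.

Lemma decimal6 (n d1 d2 d3 d4 d5 d6 : nat) : decimal n [:: d1; d2; d3; d4; d5; d6] =
  n%:R + d1%:R / 10 + d2%:R / 10 / 10 + d3%:R / 10 / 10 / 10 + d4%:R / 10 / 10 / 10 / 10
  + d5%:R / 10 / 10 / 10 / 10 / 10 + d6%:R / 10 / 10 / 10 / 10 / 10 / 10 :> R.
Proof.
rewrite /decimal !big_ord_recr big_ord0 /= add0r expr1.
by move: n%:R d1%:R d2%:R d3%:R d4%:R d5%:R d6%:R => *; field.
Qed.

Lemma decimal_approx4 (x y : R) : x - y < 1 / 10 / 10 / 10 / 10 -> y - x < 1 / 10 / 10 / 10 / 10 ->
  decimal_approx 4 x y.
Proof.
rewrite /decimal_approx => h1 h2.
have -> : 10 ^- 4 = 1 / 10 / 10 / 10 / 10 :> R by field.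
by rewrite ltr_norml; apply/andP; split; lra.
Qed.

Lemma decimal_approx6 (x y : R) : x - y < 1 / 10 / 10 / 10 / 10 / 10 / 10 ->
  y - x < 1 / 10 / 10 / 10 / 10 / 10 / 10 -> decimal_approx 6 x y.
Proof.
rewrite /decimal_approx => h1 h2.
have -> : 10 ^- 6 = 1 / 10 / 10 / 10 / 10 / 10 / 10 :> R by field.
by rewrite ltr_norml; apply/andP; split; lra.
Qed.

Lemma decimal_approxN k (x y : R) : decimal_approx k x y -> decimal_approx k (- x) (- y).
Proof. by rewrite /decimal_approx -opprD normrN. Qed.

Lemma contact_decimals : [/\ decimal_approx 4 (a1 : R) (decimal 1 [:: 7; 9; 7; 5]%N),
  decimal_approx 6 (b1 : R) (decimal 0 [:: 7; 4; 8; 2; 0; 5]%N),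
  decimal_approx 6 (b2 : R) (decimal 0 [:: 8; 9; 7; 6; 0; 9]%N) &
  decimal_approx 6 (Vopt : R) (decimal 0 [:: 1; 9; 8; 7; 9; 4]%N)].
Proof.
have [/andP[la ua] /andP[lb ub] /andP[lc uc]] := @contact_bounds R.
have /andP[lv uv] := @Vopt_bounds R.
rewrite !decimal6 decimal4; rewrite /dec in la ua lb ub lc uc lv uv.
split; [apply: decimal_approx4|apply: decimal_approx6|apply: decimal_approx6|apply: decimal_approx6].
- by clear -ua; lra.
- by clear -la; lra.
- by clear -ub; lra.
- by clear -lb; lra.
- by clear -uc; lra.
- by clear -lc; lra.
- by clear -uv; lra.
- by clear -lv; lra.
Qed.
End decimals.

Theorem proposition5p5 (R : realType) :
  (exists a1 a2 a3 a4 a5 a6 : R * R,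
    (forall alpha : set (R * R),
       optimal_means (ellipse_uniform R) 6 alpha <->
       alpha = [set a1; a2; a3; a4; a5; a6]) /\
    (decimal_approx 4 a1.1 (decimal 1 [:: 7; 9; 7; 5]%N) /\
     a1.2 = 0) /\
    (decimal_approx 6 a2.1 (decimal 0 [:: 7; 4; 8; 2; 0; 5]%N) /\
     decimal_approx 6 a2.2 (decimal 0 [:: 8; 9; 7; 6; 0; 9]%N)) /\
    (decimal_approx 6 a3.1 (- decimal 0 [:: 7; 4; 8; 2; 0; 5]%N) /\
     decimal_approx 6 a3.2 (decimal 0 [:: 8; 9; 7; 6; 0; 9]%N)) /\
    (decimal_approx 4 a4.1 (- decimal 1 [:: 7; 9; 7; 5]%N) /\
     a4.2 = 0) /\
    (decimal_approx 6 a5.1 (- decimal 0 [:: 7; 4; 8; 2; 0; 5]%N) /\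
     decimal_approx 6 a5.2 (- decimal 0 [:: 8; 9; 7; 6; 0; 9]%N)) /\
    (decimal_approx 6 a6.1 (decimal 0 [:: 7; 4; 8; 2; 0; 5]%N) /\
     decimal_approx 6 a6.2 (- decimal 0 [:: 8; 9; 7; 6; 0; 9]%N))) /\
  (exists2 v : R, quantization_error (ellipse_uniform R) 6 = v%:E &
    decimal_approx 6 v (decimal 0 [:: 1; 9; 8; 7; 9; 4]%N)).
Proof.
have [da db1 db2 dv] := @contact_decimals R; split; last first.
  by exists Vopt; [exact: quantization_error6|exact: dv].
exists (a1, 0), (b1, b2), (- b1, b2), (- a1, 0), (- b1, - b2), (b1, - b2).
split; first exact: optimal_means6.
have da' := decimal_approxN da; have db1' := decimal_approxN db1.
have db2' := decimal_approxN db2.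
by do !split.
Qed.
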